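(* Let $\gamma\subset\hat{\mathbb C}$ be a Jordan curve and let $\Omega,\Omega^*$ be the two connected components of $\hat{\mathbb C}\smallsetminus\gamma$. If $\gamma$ is not a circle, then the two Epstein--Poincaré surfaces $\Sigma_\Omega=\mathrm{Ep}_\Omega(\Omega)$ and $\Sigma_{\Omega^*}=\mathrm{Ep}_{\Omega^*}(\Omega^* )$ are disjoint subsets of $\mathbb H^3$.
   Context: $\hat{\mathbb C}=\mathbb C\cup\{\infty\}$ is the boundary at infinity of hyperbolic 3-space $\mathbb H^3$, modelled as $\{(Z,\xi): Z\in\mathbb C,\ \xi>0\}$. ''Circle'' means a round circle of $\hat{\mathbb C}$ (including lines union $\infty$). Epstein maps. For $x\in\mathbb H^3$ let $\nu_x$ be the visual metric on $\hat{\mathbb C}$ from $x$, i.e. the pull-back of the round metric of the unit sphere by the boundary extension of any isometry to the ball model sending $x$ to the origin (so the visual metric from $(0,1)$ is $4|dz|^2/(1+|z|^2)^2$). For a smooth conformal metric $\rho$ on a domain $U\subset\hat{\mathbb C}$ and $z\in U$, the set $\mathfrak H(z,\rho)=\{x\in\mathbb H^3:\nu_x(z)=\rho(z)\}$ is a horosphere based at $z$. There is a unique smooth map $\widetilde{\mathrm{Ep}}_\rho:U\to T^1\mathbb H^3$, with base-point projection $\mathrm{Ep}_\rho:U\to\mathbb H^3$, such that $\mathrm{Ep}_\rho(z)\in\mathfrak H(z,\rho)$, $\widetilde{\mathrm{Ep}}_\rho(z)$ is the unit normal at $\mathrm{Ep}_\rho(z)$ pointing out of the horoball bounded by $\mathfrak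 H(z,\rho)$, and the image of $D_z\mathrm{Ep}_\rho$ is orthogonal to $\widetilde{\mathrm{Ep}}_\rho(z)$. $\mathrm{Ep}_\rho$ is the Epstein map of $\rho$. Explicitly, if $U\subset\mathbb C$ and $\rho=e^{\varphi}|dz|^2$, then $\mathrm{Ep}_\rho(z)=(Z,\xi)$ with $\xi=\frac{2e^{-\varphi/2}}{1+|\varphi_{\bar z}|^2e^{-\varphi}}$ and $Z=z+\frac{2\varphi_{\bar z}e^{-\varphi}}{1+|\varphi_{\bar z}|^2e^{-\varphi}}$. For a simply connected domain $\Omega$ with hyperbolic (complete, curvature $-1$) metric $\rho_\Omega$, $\mathrm{Ep}_\Omega:=\mathrm{Ep}_{\rho_\Omega}$ is the Epstein--Poincaré map and $\Sigma_\Omega:=\mathrm{Ep}_\Omega(\Omega)$ the Epstein--Poincaré surface. *)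

(* Defs.v *)
From HB Require Import structures.
From mathcomp Require Import all_boot all_order all_algebra.
From mathcomp Require Import complex.
From mathcomp Require Import all_classical all_reals all_analysis.

Set Implicit Arguments.
Unset Strict Implicit.
Unset Printing Implicit Defensive.

Import Order.TTheory GRing.Theory Num.Theory.
Import numFieldNormedType.Exports.

Local Open Scope classical_set_scope.
Local Open Scope complex_scope.
Local Open Scope ring_scope.

Section EpsteinPoincare.
Variable R : realType.

(* R[i]^o is R[i] with the topology of its norm. *)
Definition sphere : Type := one_point_compactification R[i]^o.
HB.instance Definition _ := Topological.on sphere.

Definition finite_pt (z : R[i]) : sphere := Some z.
Definition infty : sphere := None.

Definition sqmod (z : R[i]) : R := (complex.Re z) ^+ 2 + (complex.Im z) ^+ 2.

Definition unit_circle : set R[i]^o := [set z | `|z| = 1].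

Definition jordan_curve (gamma : set sphere) : Prop :=
  exists f : R[i]^o -> sphere,
    [/\ {within unit_circle, continuous f}, set_inj unit_circle f
      & gamma = f @` unit_circle].

(* Round circles, and lines Re (a z) = d completed by infinity. *)
Definition circle (gamma : set sphere) : Prop :=
  (exists (c : R[i]) (r : R),
     0 < r /\ gamma = finite_pt @` [set z | sqmod (z - c) = r ^+ 2]) \/
  (exists (a : R[i]) (d : R),
     a != 0 /\
     gamma = infty |` (finite_pt @` [set z | complex.Re (a * z) = d])).

Definition component (A C : set sphere) : Prop :=
  exists2 p, A p & C = connected_component A p.

(* The two standard holomorphic coordinates on the sphere, z and w = 1/z,
   given by the inverse charts, with C identified with R * R. *)
Variant chart := at_zero | at_infinity.

Definition cplx (u : R * R) : R[i] := u.1 +i* u.2.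

Definition cinv (u : R * R) : R * R :=
  (complex.Re (cplx u)^-1, complex.Im (cplx u)^-1).

Definition param (k : chart) (u : R * R) : sphere :=
  match k with
  | at_zero => finite_pt (cplx u)
  | at_infinity => if u == 0 then infty else finite_pt (cplx u)^-1
  end.

(* C^n, then C^infinity, maps on an open set A. *)
Fixpoint Cn (V W : normedModType R) (n : nat) (A : set V) (f : V -> W) : Prop :=
  match n with
  | 0 => forall x, A x -> {for x, continuous f}
  | m.+1 => (forall x, A x -> {for x, continuous f}) /\
            forall v : V, (forall x, A x -> derivable f x v) /\
                          Cn m A (fun x => 'D_v f x)
  end.

Definition smooth (V W : normedModType R) (A : set V) (f : V -> W) : Prop :=
  forall n, Cn n A f.

(* A conformal metric is given by its coefficient of |d zeta|^2 in each of the
   two coordinates zeta. *)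
Definition density := chart -> R * R -> R.

Definition conformal_metric (U : set sphere) (rho : density) : Prop :=
  [/\ forall k, smooth (param k @^-1` U) (rho k),
      forall k u, U (param k u) -> 0 < rho k u
    & forall u, u != 0 -> U (param at_zero u) ->
        rho at_zero u = rho at_infinity (cinv u) / sqmod (cplx u) ^+ 2].

Definition laplacian (f : R * R -> R) (u : R * R) : R :=
  'D_(1, 0) (fun v => 'D_(1, 0) f v) u + 'D_(0, 1) (fun v => 'D_(0, 1) f v) u.

(* Gaussian curvature of f |d zeta|^2. *)
Definition curvature (f : R * R -> R) (u : R * R) : R :=
  - laplacian (fun v => ln (f v)) u / (2 * f u).

Definition enorm (u : R * R) : R := Num.sqrt (sqmod (cplx u)).

(* Every C^1 path on [0, 1] is the restriction of a C^1 path on R. *)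
Definition C1_path (c : R -> R * R) : Prop :=
  (forall t, derivable c t 1) /\ continuous (fun t => 'D_1 c t).

(* A piecewise C^1 path in U from p to q of length l: it may be subdivided so
   that each piece lies in the domain of one of the two coordinates. *)
Inductive path_length (U : set sphere) (rho : density) :
    sphere -> sphere -> \bar R -> Prop :=
| path_nil p : U p -> path_length U rho p p 0%E
| path_cons k c q l :
    C1_path c ->
    (forall t : R, 0 <= t <= 1 -> U (param k (c t))) ->
    path_length U rho (param k (c 1)) q l ->
    path_length U rho (param k (c 0)) q
      (\int[lebesgue_measure]_(t in `[0%R, 1%R])
          (Num.sqrt (rho k (c t)) * enorm ('D_1 c t))%:E + l)%E.

Definition conf_dist (U : set sphere) (rho : density) (p q : sphere) : \bar R :=
  ereal_inf [set l | path_length U rho p q l].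

Definition complete_metric (U : set sphere) (rho : density) : Prop :=
  forall s : nat -> sphere,
    (forall n, U (s n)) ->
    (forall e : R, 0 < e -> exists N : nat, forall m n : nat,
       (N <= m)%N -> (N <= n)%N -> (conf_dist U rho (s m) (s n) < e%:E)%E) ->
    exists2 p, U p & (conf_dist U rho (s n) p @[n --> \oo] --> 0%E).

Definition hyperbolic_metric (U : set sphere) (rho : density) : Prop :=
  [/\ conformal_metric U rho,
      forall k u, U (param k u) -> curvature (rho k) u = -1
    & complete_metric U rho].

(* Hyperbolic space is the set of points ((X, Y), xi) with xi > 0, where
   Z = X + i Y. *)
Local Notation pt3 := (R * R * R)%type.

Definition H3 : set pt3 := [set x | 0 < x.2].

Definition dot3 (v w : pt3) : R :=
  v.1.1 * w.1.1 + v.1.2 * w.1.2 + v.2 * w.2.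

(* At (0, 1) the visual metric is 4 |dz|^2 / (1 + |z|^2)^2; at (Z, xi) it is the
   pull-back of the latter by z |-> (z - Z) / xi, which is the boundary extension
   of an isometry of H3 sending (Z, xi) to (0, 1). The second line is the same
   metric in the coordinate w = 1/z. *)
Definition visual (x : pt3) : density := fun k u =>
  match k with
  | at_zero =>
      4 * x.2 ^+ 2 / (x.2 ^+ 2 + sqmod (cplx u - cplx x.1)) ^+ 2
  | at_infinity =>
      4 * x.2 ^+ 2 /
        (x.2 ^+ 2 * sqmod (cplx u) + sqmod (1 - cplx u * cplx x.1)) ^+ 2
  end.

Definition horosphere (rho : density) (p : sphere) : set pt3 :=
  [set x | H3 x /\ forall k u, param k u = p -> visual x k u = rho k u].

(* v is the unit normal at x to the horosphere through x based at p, pointing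
   out of the horoball, i.e. towards smaller values of y |-> nu_y(p). The
   hyperbolic metric at x is dot3 divided by x.2 ^+ 2. *)
Definition outward_unit_normal (p : sphere) (x v : pt3) : Prop :=
  dot3 v v = x.2 ^+ 2 /\
  forall k u, param k u = p ->
    'D_v (fun y : pt3 => visual y k u) x < 0 /\
    forall w : pt3, 'D_w (fun y : pt3 => visual y k u) x = 0 -> dot3 w v = 0.

Definition epstein_lift (U : set sphere) (rho : density)
    (E N : sphere -> pt3) : Prop :=
  (forall k, smooth (param k @^-1` U) (E \o param k) /\
             smooth (param k @^-1` U) (N \o param k)) /\
  (forall p, U p -> horosphere rho p (E p)) /\
  (forall p, U p -> outward_unit_normal p (E p) (N p)) /\
  (forall k u w, U (param k u) ->
     dot3 ('D_w (E \o param k) u) (N (param k u)) = 0).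

Definition epstein_map (U : set sphere) (rho : density)
    (E : sphere -> pt3) : Prop := exists N, epstein_lift U rho E N.

(* Only the values of E on Omega are constrained. *)
Definition epstein_poincare_map (Omega : set sphere)
    (E : sphere -> pt3) : Prop :=
  exists rho, hyperbolic_metric Omega rho /\ epstein_map Omega rho E.

End EpsteinPoincare.

(* Main.v *)
(* In the coordinate zeta of z = a + 1/zeta, with a a finite point of gamma,
   Omega and Omega* become disjoint open subsets U, U' of C carrying complete
   metrics e^f |dzeta|^2, e^f' |dzeta|^2 of curvature -1. A common point of the
   two surfaces lies on a horosphere of each metric, and Cauchy-Schwarz gives
   S(z, w) = e^((f z + f' w)/2) |z - w|^2 <= 4 for some z in U, w in U'.

   Conversely S >= 4. The complex Hessian of ln S at (z, w), in the direction
   where z moves holomorphically and w antiholomorphically, is (1 - 4/S)/2, so S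
   has no interior minimum with S < 4. As S need not attain its infimum, 1/S is
   cut off by a function of the energies of long polygonal chains from fixed base
   points; completeness makes the sublevel sets of these energies compact.

   If S = 4 somewhere, Hopf's lemma makes the set of such z open. There ln S is
   minimal, so the Schwarzian q - p^2/2 of f vanishes (p = f_z, q = f_zz), which
   says that e^(-f/2) = al |z|^2 + 2 Re(b z) + c, and the partner w is the
   reflection of z in the circle where this form vanishes. Completeness continues
   this along radial segments; al <> 0 would give a ray to infinity of finite
   length. So al = 0, U and U' contain the two sides of a line, and gamma is a
   circle. *)

(* ln (S/4) is the signed hyperbolic distance between the horospheres at [z] and [w], so S >= 4 says
   that the horoballs of the two metrics never overlap, and S = 4 that they are tangent. As ln |z -
   w|^2 is pluriharmonic, it has a mixed second derivative only because one of the points moves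
   antiholomorphically; along suitable unit vectors this term outweighs the two curvature terms as
   soon as S < 4.

   A cut-off must have bounded derivatives along exactly such motions. Smoothness of the distance to
   a base point would need the global geometry of the domain, whereas the energy of a chain is
   explicit. Moving all vertices by a discrete parallel transport, damped by i/N, bounds its mixed
   second derivative by energy + 4. So the first and second order terms of ln (1 + energy) are
   bounded by constants, and division by a large [tau] makes them negligible.

   Every extremum is tested at one point only, so expansions of order one and two at a point, with
   little-o remainders, carry the calculus. *)
Require Import Defs.
From mathcomp Require Import all_boot all_order all_algebra.
From mathcomp Require Import complex ring lra.
From mathcomp Require Import all_classical all_reals all_analysis.

Set Implicit Arguments.
Unset Strict Implicit.
Unset Printing Implicit Defensive.

Import Order.TTheory GRing.Theory Num.Theory.
Import numFieldNormedType.Exports.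

Local Open Scope classical_set_scope.
Local Open Scope complex_scope.
Local Open Scope ring_scope.

(** * Norms and first-order jets *)

Section Plane.
Variable R : realType.
Local Notation C := R[i].
Implicit Types (z w h : C) (r : R).

Lemma eqle (x y : R) : x = y -> x <= y. Proof. by move=> ->. Qed.

Definition nm z : R := Normc.normc z.
Arguments nm : simpl never.
Local Notation re := (@complex.Re R).
Local Notation im := (@complex.Im R).

Lemma nm_ge0 z : 0 <= nm z.
Proof. by case: z => a b; exact: sqrtr_ge0. Qed.

Lemma nm0 : nm 0 = 0. Proof. exact: Normc.normc0. Qed.
Lemma nm1 : nm 1 = 1. Proof. exact: Normc.normc1. Qed.
Lemma nmM z w : nm (z * w) = nm z * nm w. Proof. exact: Normc.normcM. Qed.
Lemma nmV z : nm z^-1 = (nm z)^-1. Proof. exact: Normc.normcV. Qed.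
Lemma nmN z : nm (- z) = nm z. Proof. exact: normcN. Qed.
Lemma nmD z w : nm (z + w) <= nm z + nm w. Proof. exact: le_normcD. Qed.
Lemma nmB z w : nm (z - w) <= nm z + nm w.
Proof. by rewrite -(nmN w) nmD. Qed.
Lemma nmBC z w : nm (z - w) = nm (w - z).
Proof. by rewrite -nmN opprB. Qed.
Lemma nm_eq0 z : (nm z == 0) = (z == 0).
Proof.
by apply/eqP/eqP => [/Normc.eq0_normc //|->]; rewrite nm0.
Qed.
Lemma nm_gt0 z : (0 < nm z) = (z != 0).
Proof. by rewrite lt_def nm_ge0 andbT nm_eq0. Qed.
Lemma nmX z n : nm (z ^+ n) = nm z ^+ n.
Proof. by elim: n => [|n IH]; rewrite ?expr0 ?nm1 // !exprS nmM IH. Qed.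
Lemma nm_tri z w t : nm (z - t) <= nm (z - w) + nm (w - t).
Proof. by rewrite (_ : z - t = (z - w) + (w - t)) ?nmD //; ring. Qed.
Lemma nm_sub z w : nm z - nm w <= nm (z - w).
Proof. by rewrite lerBlDr (_ : z = (z - w) + w) ?addrK ?nmD //; ring. Qed.

Lemma nm_sqr z : nm z ^+ 2 = re z ^+ 2 + im z ^+ 2.
Proof. by case: z => a b; rewrite sqr_sqrtr // addr_ge0 ?sqr_ge0. Qed.
Lemma sqmodE z : sqmod z = nm z ^+ 2. Proof. by rewrite nm_sqr. Qed.

Lemma nm_real r : nm r%:C = `|r|.
Proof. by rewrite /nm /= expr0n /= addr0 sqrtr_sqr. Qed.
Lemma nm_conj z : nm z^* = nm z.
Proof. by case: z => a b; rewrite /nm /= sqrrN. Qed.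
Lemma re_le z : `|re z| <= nm z.
Proof.
by case: z => a b; rewrite -sqrtr_sqr ler_sqrt ?lerDl ?sqr_ge0// addr_ge0 ?sqr_ge0.
Qed.
Lemma im_le z : `|im z| <= nm z.
Proof.
by case: z => a b; rewrite -sqrtr_sqr ler_sqrt ?lerDr ?sqr_ge0// addr_ge0 ?sqr_ge0.
Qed.
Lemma nm_le z : nm z <= `|re z| + `|im z|.
Proof.
rewrite -(@ler_pXn2r _ 2) ?nnegrE ?nm_ge0 ?addr_ge0//.
rewrite nm_sqr sqrrD !real_normK ?num_real//.
by rewrite lerD2r lerDl mulrn_wge0 // mulr_ge0.
Qed.
Lemma re_leP z : re z <= nm z.
Proof. by have := re_le z; rewrite ler_norml => /andP[]. Qed.

Lemma mul_conj z : z * z^* = (nm z ^+ 2)%:C.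
Proof. by rewrite nm_sqr; case: z => a b; apply/eqP; rewrite eq_complex /=; apply/andP; split; apply/eqP; ring. Qed.

Lemma reD z w : re (z + w) = re z + re w. Proof. by case: z; case: w. Qed.
Lemma reN z : re (- z) = - re z. Proof. by case: z. Qed.
Lemma reB z w : re (z - w) = re z - re w. Proof. by rewrite reD reN. Qed.
Lemma reZ r z : re (r%:C * z) = r * re z.
Proof. by case: z => a b /=; rewrite mul0r subr0. Qed.
Lemma re_conj z : re z^* = re z. Proof. by case: z. Qed.
Lemma nmZ r z : nm (r%:C * z) = `|r| * nm z.
Proof. by rewrite nmM nm_real. Qed.

Lemma rcD r r' : (r + r')%:C = r%:C + r'%:C :> C. Proof. exact: rmorphD. Qed.
Lemma rcB r r' : (r - r')%:C = r%:C - r'%:C :> C. Proof. exact: rmorphB. Qed.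
Lemma rcM r r' : (r * r')%:C = r%:C * r'%:C :> C. Proof. exact: rmorphM. Qed.
Lemma rcN r : (- r)%:C = - r%:C :> C. Proof. exact: rmorphN. Qed.
Lemma rcV r : r^-1%:C = (r%:C)^-1 :> C. Proof. exact: fmorphV. Qed.
Lemma rcX r n : (r ^+ n)%:C = r%:C ^+ n :> C. Proof. exact: rmorphXn. Qed.
Lemma cjD z w : (z + w)^* = z^* + w^*. Proof. exact: rmorphD. Qed.
Lemma cjB z w : (z - w)^* = z^* - w^*. Proof. exact: rmorphB. Qed.
Lemma cjM z w : (z * w)^* = z^* * w^*. Proof. exact: rmorphM. Qed.
Lemma cjN z : (- z)^* = - z^*. Proof. exact: rmorphN. Qed.
Lemma cjV z : (z^-1)^* = (z^*)^-1. Proof. exact: fmorphV. Qed.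
Lemma cjX z n : (z ^+ n)^* = z^* ^+ n. Proof. exact: rmorphXn. Qed.
Lemma cj_rc r : (r%:C)^* = r%:C. Proof. by apply/eqP; rewrite eq_complex /= oppr0 !eqxx. Qed.
Lemma cjK z : z^*^* = z. Proof. exact: conjcK. Qed.
Lemma rc0 : 0%:C = 0 :> C. Proof. by []. Qed.
Lemma rc1 : 1%:C = 1 :> C. Proof. by []. Qed.
Lemma rc_inj : injective (fun r => r%:C : C). Proof. by move=> x y []. Qed.

(** This is r(h) = o(|h|^k) as h tends to 0, spelled out so that remainders can be handled by
    inequalities alone. *)
Definition small (k : nat) (r : C -> R) : Prop :=
  forall e : R, 0 < e -> exists2 d : R, 0 < d &
    forall h, nm h < d -> `|r h| <= e * nm h ^+ k.

Lemma small_le k (r r' : C -> R) (d : R) : 0 < d ->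
  (forall h, nm h < d -> `|r h| <= `|r' h|) -> small k r' -> small k r.
Proof.
move=> d0 rr' sr e e0; have [d1 d10 H] := sr e e0.
exists (Num.min d d1); first by rewrite lt_min d0.
move=> h; rewrite lt_min => /andP[hd hd1].
exact: le_trans (rr' h hd) (H h hd1).
Qed.

Lemma small_dom k (r r' : C -> R) : small k r' ->
  (forall h, `|r h| <= `|r' h|) -> small k r.
Proof. by move=> sr' rr'; apply: (small_le ltr01) sr' => h _. Qed.

Lemma small_add k (r r' : C -> R) :
  small k r -> small k r' -> small k (fun h => r h + r' h).
Proof.
move=> sr sr' e e0; have e20 : 0 < e / 2 by rewrite divr_gt0.
have [d d0 H] := sr _ e20; have [d1 d10 H1] := sr' _ e20.
exists (Num.min d d1); first by rewrite lt_min d0.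
move=> h; rewrite lt_min => /andP[hd hd1].
rewrite (le_trans (ler_normD _ _))// (splitr e) mulrDl lerD ?H ?H1//.
Qed.

Lemma small_bound k (r b : C -> R) K d : 0 < d ->
  (forall h, nm h < d -> `|b h| <= K) -> small k r ->
  small k (fun h => b h * r h).
Proof.
move=> d0 bK sr e e0.
have K0 : 0 <= K by have := bK 0; rewrite nm0 => /(_ d0); apply: le_trans.
have eK : 0 < e / (K + 1) by rewrite divr_gt0// ltr_wpDl.
have [d1 d10 H] := sr _ eK.
exists (Num.min d d1); first by rewrite lt_min d0.
move=> h; rewrite lt_min => /andP[hd hd1].
rewrite normrM; apply: le_trans (ler_pM _ _ (bK h hd) (H h hd1)) _ => //.
rewrite mulrA ler_wpM2r ?exprn_ge0 ?nm_ge0//.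
by rewrite mulrCA ger_pMr// ler_pdivrMr ?mul1r ?lerDl// ltr_wpDl.
Qed.

Lemma small_powS k (r : C -> R) K d : 0 < d ->
  (forall h, nm h < d -> `|r h| <= K * nm h ^+ k.+1) -> small k r.
Proof.
move=> d0 rK e e0.
have eK : 0 < e / (`|K| + 1) by rewrite divr_gt0// ltr_wpDl.
exists (Num.min d (e / (`|K| + 1))); first by rewrite lt_min d0.
move=> h; rewrite lt_min => /andP[hd hd1].
apply: le_trans (rK h hd) _; rewrite exprS mulrA ler_wpM2r ?exprn_ge0 ?nm_ge0//.
apply: (@le_trans _ _ ((`|K| + 1) * (e / (`|K| + 1)))).
  apply: (@le_trans _ _ (`|K| * nm h)).
    by rewrite ler_wpM2r ?nm_ge0// ler_norm.
  by rewrite ler_pM// ?nm_ge0 ?lerDl// ltW.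
by rewrite mulrC divfK// gt_eqF// ltr_wpDl.
Qed.

Lemma small_eq0 k (r : C -> R) : (forall h, r h = 0) -> small k r.
Proof.
by move=> r0 e e0; exists 1 => // h _; rewrite r0 normr0 mulr_ge0 ?exprn_ge0 ?nm_ge0 ?ltW.
Qed.

(* A and B are the Wirtinger derivatives of F at z. *)
Definition D1 (F : C -> C) z (A B : C) : Prop :=
  small 1 (fun h => nm (F (z + h) - F z - A * h - B * h^*)).

Lemma D1_lip F z A B : D1 F z A B ->
  exists2 d : R, 0 < d & forall h, nm h < d ->
    nm (F (z + h) - F z) <= (nm A + nm B + 1) * nm h.
Proof.
move=> /(_ 1 ltr01)[d d0 H]; exists d => // h /H.
rewrite ger0_norm ?nm_ge0// mul1r expr1 => {}H.
have -> : F (z + h) - F z =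
  (F (z + h) - F z - A * h - B * h^*) + (A * h + B * h^*) by ring.
rewrite (le_trans (nmD _ _))// [leRHS]mulrDl mul1r [leRHS]addrC lerD//.
by rewrite (le_trans (nmD _ _))// !nmM nm_conj mulrDl.
Qed.

Lemma D1_cont F z A B : D1 F z A B -> forall e : R, 0 < e ->
  exists2 d : R, 0 < d & forall h, nm h < d -> nm (F (z + h) - F z) < e.
Proof.
move=> /D1_lip[d d0 H] e e0; set K := nm A + nm B + 1 in H.
have K0 : 0 < K by rewrite ltr_wpDl// addr_ge0 ?nm_ge0.
exists (Num.min d (e / K)); first by rewrite lt_min d0 divr_gt0.
move=> h; rewrite lt_min => /andP[hd he].
by rewrite (le_lt_trans (H h hd))// mulrC -ltr_pdivlMr.
Qed.

Lemma D1_eq F G z A B (d : R) : 0 < d -> (forall h, nm h < d -> F (z + h) = G (z + h)) ->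
  D1 F z A B -> D1 G z A B.
Proof.
move=> d0 FG DF; apply: (small_le d0) DF => h hd.
have := FG 0; rewrite nm0 addr0 => /(_ d0) ->; by rewrite FG.
Qed.

Lemma D1_holo_cst c z : D1 (fun=> c) z 0 0.
Proof.
by apply: small_eq0 => h; rewrite !mul0r !subr0 subrr nm0.
Qed.

Lemma D1_add F G z A B A' B' : D1 F z A B -> D1 G z A' B' ->
  D1 (fun x => F x + G x) z (A + A') (B + B').
Proof.
move=> DF DG; apply: (small_le ltr01) (small_add DF DG) => h _.
rewrite !ger0_norm ?addr_ge0 ?nm_ge0//; apply: le_trans (nmD _ _).
by apply: eqle; congr nm; ring.
Qed.

Lemma D1_mul F G z A B A' B' : D1 F z A B -> D1 G z A' B' ->
  D1 (fun x => F x * G x) z (A * G z + F z * A') (B * G z + F z * B').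
Proof.
move=> DF DG; have [d d0 LG] := D1_lip DG; have [d1 d10 LF] := D1_lip DF.
set KG := nm A' + nm B' + 1 in LG; set KF := nm A + nm B + 1 in LF.
have s1 : small 1 (fun h => nm (G z) * nm (F (z + h) - F z - A * h - B * h^*)).
  by apply: (@small_bound 1 _ (fun=> nm (G z)) (nm (G z)) 1) DF => // h _; rewrite ger0_norm ?nm_ge0.
have s2 : small 1 (fun h => nm (F z) * nm (G (z + h) - G z - A' * h - B' * h^*)).
  by apply: (@small_bound 1 _ (fun=> nm (F z)) (nm (F z)) 1) DG => // h _; rewrite ger0_norm ?nm_ge0.
have s3 : small 1 (fun h => nm (F (z + h) - F z) * nm (G (z + h) - G z)).
  apply: (@small_powS 1 _ (KF * KG) (Num.min d d1)); first by rewrite lt_min d0.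
  move=> h; rewrite lt_min => /andP[hd hd1].
  rewrite ger0_norm ?mulr_ge0 ?nm_ge0//.
  apply: le_trans (ler_pM _ _ (LF h hd1) (LG h hd)) _; rewrite ?nm_ge0//.
  by apply: eqle; ring.
apply: (small_le ltr01) (small_add (small_add s1 s2) s3) => h _.
rewrite !ger0_norm ?addr_ge0 ?mulr_ge0 ?nm_ge0// -!nmM.
apply: le_trans (le_trans (nmD _ _) (lerD (nmD _ _) (lexx _))).
by apply: eqle; congr nm; ring.
Qed.

End Plane.

(** * Mean values, chain rules and real-valued functions *)

Section Calculus.
Variable R : realType.
Local Notation C := R[i].
Local Notation re := (@complex.Re R).
Local Notation im := (@complex.Im R).
Implicit Types (z w h : C).

Lemma is_derive_eps (G : R -> R) (x g : R) :
  is_derive x 1 G g <-> (forall e : R, 0 < e -> exists2 d : R, 0 < d &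
    forall k, `|k| < d -> `|G (x + k) - G x - g * k| <= e * `|k|).
Proof.
split.
  move=> [dG vG] e e0.
  have : (fun k => k^-1 *: (G (k *: 1 + x) - G x)) @ 0^' --> g.
    by rewrite -vG; exact: dG.
  move=> /cvgrPdist_le /(_ e e0); rewrite near_withinE near_simpl.
  move=> /nbhs_ballP[d /= d0 H]; exists d => // k kd.
  have [->|k0] := eqVneq k 0.
    by rewrite addr0 subrr mulr0 subr0 normr0 mulr0.
  have bk : ball (0 : R) d k by rewrite /ball /= sub0r normrN.
  have {H} : `|g - k^-1 * (G (k * 1 + x) - G x)| <= e := H k bk k0.
  rewrite -(ler_pM2r (x := `|k|)) ?normr_gt0// distrC -normrM mulr1.
  rewrite [k + x]addrC (_ : (k^-1 * (G (x + k) - G x) - g) * k = G (x + k) - G x - g * k)//.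
  by field.
move=> H.
have cG : (fun k => k^-1 *: (G (k *: 1 + x) - G x)) @ 0^' --> g.
  apply/cvgrPdist_le => e e0; have [d d0 Hd] := H e e0.
  rewrite near_withinE near_simpl; apply/nbhs_ballP; exists d => //= k.
  rewrite /ball /= sub0r normrN => kd k0; have {Hd} := Hd k kd.
  change (`|G (x + k) - G x - g * k| <= e * `|k| -> `|g - k^-1 * (G (k * 1 + x) - G x)| <= e).
  move=> Hd0; rewrite -(ler_pM2r (x := `|k|)) ?normr_gt0// distrC -normrM mulr1.
  rewrite [k + x]addrC (_ : (k^-1 * (G (x + k) - G x) - g) * k = G (x + k) - G x - g * k)//.
  by field.
by apply: DeriveDef; [apply/cvg_ex; exists g|exact/cvg_lim].
Qed.

Lemma mvt_bound (G g : R -> R) (K : R) :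
  (forall t : R, 0 <= t <= 1 -> is_derive t 1 G (g t)) ->
  (forall t : R, 0 <= t <= 1 -> `|g t| <= K) -> `|G 1 - G 0| <= K.
Proof.
move=> dG gK; have [c c01 ->] : exists2 c, c \in `[0, 1] & G 1 - G 0 = g c * (1 - 0).
  apply: MVT_segment => //.
    by move=> x; rewrite in_itv /= => /andP[? ?]; apply: dG; rewrite !ltW.
  apply: derivable_within_continuous => x; rewrite in_itv /= => x01.
  by have [] := dG x x01.
by rewrite subr0 mulr1 gK// -in_itv.
Qed.

Lemma D1_comp F (M : C -> C) z A B a b :
  D1 F (M z) A B -> D1 M z a b ->
  D1 (F \o M) z (A * a + B * b^*) (A * b + B * a^*).
Proof.
move=> DF DM; have [d1 d10 LM] := D1_lip DM; set K := nm a + nm b + 1 in LM.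
have K0 : 0 < K by rewrite ltr_wpDl// addr_ge0 ?nm_ge0.
have s1 : small 1 (fun h => nm (F (M (z + h)) - F (M z) - A * (M (z + h) - M z) - B * (M (z + h) - M z)^*)).
  move=> e e0; have [d d0 H] := DF (e / K) (divr_gt0 e0 K0).
  exists (Num.min d1 (d / K)); first by rewrite lt_min d10 divr_gt0.
  move=> h; rewrite lt_min => /andP[hd1 hd].
  have hk : nm (M (z + h) - M z) < d.
    by rewrite (le_lt_trans (LM h hd1))// mulrC -ltr_pdivlMr.
  have := H _ hk; rewrite (addrC (M z)) subrK => /le_trans; apply.
  rewrite !expr1 -mulrA ler_pM2l// mulrC ler_pdivrMr// mulrC.
  exact: LM.
have s2 : small 1 (fun h => (nm A + nm B) * nm (M (z + h) - M z - a * h - b * h^*)).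
  by apply: (@small_bound R 1 _ (fun=> nm A + nm B) (nm A + nm B) 1) DM => // h _; rewrite ger0_norm ?addr_ge0 ?nm_ge0.
apply: (small_le ltr01) (small_add s1 s2) => h _.
rewrite !ger0_norm ?addr_ge0 ?mulr_ge0 ?addr_ge0 ?nm_ge0//=.
set k := M (z + h) - M z; set r := k - a * h - b * h^*.
have rc : r^* = k^* - a^* * h^* - b^* * h.
  by rewrite /r !cjB !cjM cjK.
have -> : F (M (z + h)) - F (M z) - (A * a + B * b^*) * h - (A * b + B * a^*) * h^* =
  (F (M (z + h)) - F (M z) - A * k - B * k^*) + (A * r + B * r^*).
  by rewrite rc /r; ring.
rewrite (le_trans (nmD _ _))// lerD2l (le_trans (nmD _ _))//.
by rewrite !nmM nm_conj mulrDl.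
Qed.

Lemma D1_conj F z A B : D1 F z A B -> D1 (fun x => (F x)^*) z B^* A^*.
Proof.
move=> DF; apply: (small_le ltr01) DF => h _; rewrite -nm_conj; apply: eqle; congr (`|nm _|).
by rewrite !cjB !cjM !cjK; ring.
Qed.

Lemma D1_id z : D1 id z 1 0.
Proof.
apply: small_eq0 => h; rewrite /id.
by rewrite (_ : z + h - z - 1 * h - 0 * h^* = 0) ?nm0//; ring.
Qed.

Lemma D1_inv F z A B : D1 F z A B -> F z != 0 ->
  D1 (fun x => (F x)^-1) z (- A / F z ^+ 2) (- B / F z ^+ 2).
Proof.
move=> DF Fz; pose u := F z.
have Du : D1 (fun x => x^-1) u (- u^-1 ^+ 2) 0.
  have u0 : 0 < nm u by rewrite nm_gt0.
  apply: (@small_powS R 1 _ (2 / nm u ^+ 3) (nm u / 2)); first by rewrite divr_gt0.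
  move=> h hu; have uh : nm u / 2 <= nm (u + h).
    have := nm_sub u (- h); rewrite nmN opprK; lra.
  have uh0 : u + h != 0 by rewrite -nm_gt0; lra.
  have -> : (u + h)^-1 - u^-1 - - u^-1 ^+ 2 * h - 0 * h^* = h ^+ 2 / (u ^+ 2 * (u + h)).
    by field; rewrite uh0 Fz.
  rewrite ger0_norm ?nm_ge0// nmM nmV nmX nmM nmX mulrC ler_wpM2r ?exprn_ge0 ?nm_ge0//.
  rewrite ler_pdivlMr ?exprn_gt0// mulrC ler_pdivrMr ?mulr_gt0 ?exprn_gt0//; last lra.
  rewrite exprSr (_ : 2 * (nm u ^+ 2 * nm (u + h)) = nm u ^+ 2 * (2 * nm (u + h))); last by ring.
  by rewrite ler_pM2l ?exprn_gt0//; lra.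
have E X : - X / F z ^+ 2 = - u^-1 ^+ 2 * X by rewrite /u; field.
by have := D1_comp Du DF; rewrite !mul0r !addr0 !E.
Qed.

(* Real-valued functions: the Wirtinger derivatives are conjugate. *)
Definition DR (f : C -> R) z (p : C) := D1 (fun x => (f x)%:C) z p p^*.

Lemma add_conj z : z + z^* = (2 * re z)%:C.
Proof. by case: z => a b; apply/eqP; rewrite eq_complex /=; apply/andP; split; apply/eqP; ring. Qed.

Lemma DR_small f z p :
  DR f z p <-> small 1 (fun h => f (z + h) - f z - 2 * re (p * h)).
Proof.
have E h : nm ((f (z + h))%:C - (f z)%:C - p * h - p^* * h^*) =
    `|f (z + h) - f z - 2 * re (p * h)|.
  by rewrite -nm_real !rcB -add_conj cjM; congr nm; ring.
by split=> H; apply: (small_le ltr01) H => h _; rewrite E normr_id.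
Qed.

Lemma DR_comp (G : R -> R) (g : R) (f : C -> R) z p : is_derive (f z) (1 : R) G g -> DR f z p ->
  DR (G \o f) z (g%:C * p).
Proof.
move=> /is_derive_eps dG Df; apply/DR_small.
have [d1 d10 LM] := D1_lip Df; set K := nm p + nm p^* + 1 in LM.
have K0 : 0 < K by rewrite ltr_wpDl// addr_ge0 ?nm_ge0.
have s1 : small 1 (fun h => G (f (z + h)) - G (f z) - g * (f (z + h) - f z)).
  move=> e e0; have [d d0 H] := dG (e / K) (divr_gt0 e0 K0).
  exists (Num.min d1 (d / K)); first by rewrite lt_min d10 divr_gt0.
  move=> h; rewrite lt_min => /andP[hd1 hd].
  have := LM h hd1; rewrite -rcB nm_real => {}LM.
  have hk : `|f (z + h) - f z| < d.
    by rewrite (le_lt_trans LM)// mulrC -ltr_pdivlMr.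
  have := H _ hk; rewrite (addrC (f z)) subrK => /le_trans; apply.
  by rewrite expr1 -mulrA ler_pM2l// mulrC ler_pdivrMr// mulrC.
have s2 : small 1 (fun h => g * (f (z + h) - f z - 2 * re (p * h))).
  by apply: (@small_bound R 1 _ (fun=> g) `|g| 1) => //; exact/DR_small.
apply: (small_le ltr01) (small_add s1 s2) => h _.
by rewrite /= -mulrA reZ; apply: eqle; congr `|_|; ring.
Qed.

Lemma DR_line (f : C -> R) (u v : C) (t : R) p : DR f (u + t%:C * v) p ->
  is_derive t 1 (fun s => f (u + s%:C * v)) (2 * re (p * v)).
Proof.
move=> /DR_small Df; apply/is_derive_eps => e e0.
have v0 : 0 < nm v + 1 by rewrite ltr_wpDl ?nm_ge0.
have [d d0 H] := Df (e / (nm v + 1)) (divr_gt0 e0 v0).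
exists (d / (nm v + 1)); first exact: divr_gt0.
move=> k kd.
have kv : nm (k%:C * v) <= `|k| * (nm v + 1).
  by rewrite nmM nm_real ler_wpM2l// lerDl.
have := H (k%:C * v); rewrite (le_lt_trans kv) -?ltr_pdivlMr// => /(_ isT).
rewrite mulrCA reZ.
rewrite (_ : u + t%:C * v + k%:C * v = u + (t + k)%:C * v); last by rewrite rcD; ring.
rewrite (_ : 2 * (k * re (p * v)) = 2 * re (p * v) * k); last by ring.
move=> /le_trans; apply; rewrite expr1.
by rewrite -mulrA ler_pM2l// ler_pdivrMl// [leRHS]mulrC.
Qed.

End Calculus.

(** * Second-order jets *)

Section Jets.
Variable R : realType.
Local Notation C := R[i].
Local Notation re := (@complex.Re R).
Local Notation im := (@complex.Im R).
Implicit Types (z w h s : C).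

(* Second order Taylor polynomial at 0 of a real function of s in C:
   b, beta and d are its derivatives in s, s s and s (conj s). *)
Definition J2 (g : C -> R) (g0 : R) (b beta : C) (d : R) : Prop :=
  small 2%N (fun s => g s - (g0 + 2 * re (b * s) + re (beta * s ^+ 2) + d * nm s ^+ 2)).

Lemma J2_small g g0 b beta d (g' : C -> R) g0' b' beta' d' :
  small 2%N (fun s => g s - g' s) ->
  (forall s, g0 + 2 * re (b * s) + re (beta * s ^+ 2) + d * nm s ^+ 2 =
             g0' + 2 * re (b' * s) + re (beta' * s ^+ 2) + d' * nm s ^+ 2) ->
  J2 g g0 b beta d -> J2 g' g0' b' beta' d'.
Proof.
move=> sg E Jg.
have sg' : small 2%N (fun s => - (g s - g' s)).
  by apply: (small_dom sg) => h; rewrite normrN.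
apply: (small_dom (small_add Jg sg')) => h.
by rewrite -E; apply: eqle; congr `|_|; ring.
Qed.

Lemma J2_eq g g' g0 b beta d b' beta' d' : J2 g g0 b beta d ->
  g =1 g' -> b = b' -> beta = beta' -> d = d' -> J2 g' g0 b' beta' d'.
Proof.
move=> J gg' <- <- <-; apply: J2_small J => //.
by apply: small_eq0 => h; rewrite gg' subrr.
Qed.

Lemma J2_cast g g' g0 g0' b beta d b' d' : J2 g g0 b beta d ->
  g =1 g' -> g0 = g0' -> b = b' -> d = d' -> J2 g' g0' b' beta d'.
Proof. by move=> J gg' <- bb dd; exact: J2_eq J gg' bb (erefl _) dd. Qed.

Lemma J2_poly g g0 b beta d :
  (forall s, g s = g0 + 2 * re (b * s) + re (beta * s ^+ 2) + d * nm s ^+ 2) ->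
  J2 g g0 b beta d.
Proof.
move=> E; apply: small_eq0 => h.
by rewrite E subrr.
Qed.

Lemma J2_cst c : J2 (fun=> c) c 0 0 0.
Proof. by apply: J2_poly => s; rewrite !mul0r !mulr0 !addr0. Qed.

Lemma J2_add g g0 b beta d g' g0' b' beta' d' :
  J2 g g0 b beta d -> J2 g' g0' b' beta' d' ->
  J2 (fun s => g s + g' s) (g0 + g0') (b + b') (beta + beta') (d + d').
Proof.
move=> J J'; apply: (small_dom (small_add J J')) => s.
by rewrite !mulrDl !reD; apply: eqle; congr `|_|; ring.
Qed.

Lemma J2_scale c g g0 b beta d : J2 g g0 b beta d ->
  J2 (fun s => c * g s) (c * g0) (c%:C * b) (c%:C * beta) (c * d).
Proof.
move=> J; have : small 2%N (fun s => c * (g s - (g0 + 2 * re (b * s) + re (beta * s ^+ 2) + d * nm s ^+ 2))).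
  by apply: (@small_bound R 2%N _ (fun=> c) `|c| 1) J.
move=> {}J; apply: (small_dom J) => s.
by rewrite -!mulrA !reZ; apply: eqle; congr `|_|; ring.
Qed.

Lemma J2_lip g g0 b beta d : J2 g g0 b beta d ->
  exists2 D : R, 0 < D & exists2 K : R, 0 < K & forall s, nm s < D ->
    `|g s - g0| <= K * nm s /\
    `|g s - g0 - 2 * re (b * s)| <= K * nm s ^+ 2.
Proof.
move=> /(_ 1 ltr01)[D D0 H].
pose K2 := 1 + nm beta + `|d|; pose K := K2 + 2 * nm b.
have K20 : 0 < K2 by rewrite /K2 -addrA ltr_wpDr// addr_ge0 ?nm_ge0.
have q s : nm s < D -> `|g s - g0 - 2 * re (b * s)| <= K2 * nm s ^+ 2.
  move=> /H; rewrite mul1r => Hs.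
  have -> : g s - g0 - 2 * re (b * s) = (g s - (g0 + 2 * re (b * s) + re (beta * s ^+ 2) + d * nm s ^+ 2)) + re (beta * s ^+ 2) + d * nm s ^+ 2 by ring.
  rewrite (_ : K2 * nm s ^+ 2 = nm s ^+ 2 + nm beta * nm s ^+ 2 + `|d| * nm s ^+ 2); last by rewrite /K2; ring.
  rewrite (le_trans (ler_normD _ _))// lerD//; last first.
    by rewrite normrM (ger0_norm (exprn_ge0 _ (nm_ge0 _))).
  rewrite (le_trans (ler_normD _ _))// lerD// (le_trans (re_le _))//.
  by rewrite nmM nmX.
exists (Num.min D 1); first by rewrite lt_min D0 ltr01.
exists K; first by rewrite /K ltr_wpDr// mulr_ge0 ?nm_ge0.
move=> s; rewrite lt_min => /andP[sD s1]; split; last first.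
  apply: le_trans (q s sD) _; rewrite ler_wpM2r ?exprn_ge0 ?nm_ge0//.
  by rewrite /K lerDl mulr_ge0 ?nm_ge0.
have -> : g s - g0 = (g s - g0 - 2 * re (b * s)) + 2 * re (b * s) by ring.
rewrite (_ : K * nm s = K2 * nm s + 2 * nm b * nm s); last by rewrite /K; ring.
rewrite (le_trans (ler_normD _ _))// lerD//.
  apply: le_trans (q s sD) _; rewrite ler_pM2l// expr2.
  exact: ler_piMr (nm_ge0 s) (ltW s1).
rewrite normrM ger0_norm// -mulrA ler_pM2l// (le_trans (re_le _))//.
by rewrite nmM.
Qed.

Definition peano2 (G : R -> R) (y G1 G2 : R) : Prop :=
  forall e : R, 0 < e -> exists2 d : R, 0 < d &
    forall k, `|k| < d -> `|G (y + k) - (G y + G1 * k + G2 / 2 * k ^+ 2)| <= e * k ^+ 2.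

Lemma J2_comp (G : R -> R) (G1 G2 : R) g g0 b beta d :
  g0 = g 0 -> peano2 G g0 G1 G2 -> J2 g g0 b beta d ->
  J2 (G \o g) (G g0) (G1%:C * b) (G1%:C * beta + G2%:C * b ^+ 2)
     (G1 * d + G2 * nm b ^+ 2).
Proof.
move=> g00 PG J; have [D D0 [K K0 L]] := J2_lip J.
have s1 : small 2%N (fun s => G (g s) - (G g0 + G1 * (g s - g0) + G2 / 2 * (g s - g0) ^+ 2)).
  move=> e e0; have [d' d0 H] := PG (e / K ^+ 2) (divr_gt0 e0 (exprn_gt0 _ K0)).
  exists (Num.min D (d' / K)); first by rewrite lt_min D0 divr_gt0.
  move=> s; rewrite lt_min => /andP[sD sd].
  have [Ls _] := L s sD.
  have ks : `|g s - g0| < d'.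
    by rewrite (le_lt_trans Ls)// mulrC -ltr_pdivlMr.
  have := H _ ks; rewrite (addrC g0) subrK => /le_trans; apply.
  rewrite -mulrA ler_pM2l// mulrC ler_pdivrMr ?exprn_gt0// -exprMn.
  by rewrite [nm s * K]mulrC -(real_normK (num_real (g s - g0))) ler_pXn2r ?nnegrE ?mulr_ge0 ?nm_ge0 ?(ltW K0).
have s2 : small 2%N (fun s => G1 * (g s - (g0 + 2 * re (b * s) + re (beta * s ^+ 2) + d * nm s ^+ 2))).
  by apply: (@small_bound R 2%N _ (fun=> G1) `|G1| 1) J.
have s3 : small 2%N (fun s => G2 / 2 * ((g s - g0) ^+ 2 - (2 * re (b * s)) ^+ 2)).
  apply: (@small_bound R 2%N _ (fun=> G2 / 2) `|G2 / 2| 1) => //.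
  apply: (@small_powS R 2%N _ (K * (K + 2 * nm b)) D) => // s sD.
  have [L1 L2] := L s sD.
  rewrite subr_sqr normrM (_ : _ * nm s ^+ 3 = (K * nm s ^+ 2) * ((K + 2 * nm b) * nm s)); last by ring.
  apply: ler_pM => //.
  rewrite (le_trans (ler_normD _ _))// (mulrDl K) lerD// normrM ger0_norm//.
  by rewrite -mulrA ler_pM2l// (le_trans (re_le _))// nmM.
apply: (small_dom (small_add (small_add s1 s2) s3)) => s.
have E2 : (2 * re (b * s)) ^+ 2 = 2 * re (b ^+ 2 * s ^+ 2) + 2 * (nm b ^+ 2 * nm s ^+ 2).
  by rewrite !nm_sqr; case: (b) => b1 b2; case: (s) => x y /=; ring.
rewrite E2 /= (mulrDl (G1%:C * beta)) reD -!mulrA !reZ; apply: eqle; congr `|_|.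
by field.
Qed.

Lemma peano2_derive (G G' : R -> R) (y G2 : R) (D : R) : 0 < D ->
  (forall x : R, `|x - y| < D -> is_derive x (1 : R) G (G' x)) ->
  is_derive y (1 : R) G' G2 -> peano2 G y (G' y) G2.
Proof.
move=> D0 dG /is_derive_eps dG' e e0.
have [d d0 H] := dG' e e0; exists (Num.min d D); first by rewrite lt_min d0.
move=> k; rewrite lt_min => /andP[kd kD].
pose f (t : R) := G (y + t * k) - (G y + G' y * (t * k) + G2 / 2 * (t * k) ^+ 2).
pose f' (t : R) := k * (G' (y + t * k) - G' y - G2 * (t * k)).
have tk t : 0 <= t <= 1 -> `|t * k| <= `|k|.
  by move=> /andP[t0 t1]; rewrite normrM ger0_norm// ler_piMl.
have := @mvt_bound R f f' (e * k ^+ 2).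
have -> : f 0 = 0 by rewrite /f !mul0r addr0 expr0n /= !mulr0 !addr0 subrr.
rewrite /f mul1r subr0; apply.
- move=> t t01; have yt : `|y + t * k - y| < D.
    by rewrite addrAC subrr add0r (le_lt_trans (tk t t01)).
  have dl : is_derive t (1 : R) (fun t : R => y + t * k) k.
    by apply: is_derive_eq; rewrite /GRing.scale /=; ring.
  have h1 := @is_derive1_comp R G (fun t : R => y + t * k) t _ _ (dG _ yt) dl.
  have h2 : is_derive t (1 : R) (fun t : R => G y + G' y * (t * k) + G2 / 2 * (t * k) ^+ 2) (G' y * k + G2 * (t * k) * k).
    by apply: is_derive_eq; rewrite /GRing.scale /=; field.
  have h3 := is_deriveB h1 h2.
  apply: is_derive_eq; rewrite /f'; ring.
- move=> t t01; have := H (t * k); rewrite (le_lt_trans (tk t t01) kd) => /(_ isT) Ht.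
  have -> : k ^+ 2 = `|k| * `|k| by rewrite -expr2 real_normK ?num_real.
  rewrite /f' normrM [leRHS]mulrCA ler_wpM2l//.
  by rewrite (le_trans Ht)// ler_pM2l// tk.
Qed.

Lemma J2_exp g g0 b beta d : g0 = g 0 -> J2 g g0 b beta d ->
  J2 (fun s => expR (g s)) (expR g0) ((expR g0)%:C * b)
     ((expR g0)%:C * (beta + b ^+ 2)) (expR g0 * (d + nm b ^+ 2)).
Proof.
move=> g00 J; have P : peano2 expR g0 (expR g0) (expR g0).
  by apply: (@peano2_derive expR expR _ _ 1) => //; exact: is_derive_expR.
by apply: (J2_eq (J2_comp g00 P J)) => //; ring.
Qed.

Lemma J2_ln g g0 b beta d : g0 = g 0 -> 0 < g0 -> J2 g g0 b beta d ->
  J2 (fun s => ln (g s)) (ln g0) (g0^-1%:C * b)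
     (g0^-1%:C * beta - (g0^-1%:C * b) ^+ 2) (g0^-1 * d - (g0^-1 * nm b) ^+ 2).
Proof.
move=> g00 gp J; have P : peano2 (@ln R) g0 g0^-1 (- g0^-1 ^+ 2).
  apply: (@peano2_derive (@ln R) (fun x => x^-1) _ _ g0) => //.
    move=> x; rewrite ltr_norml ltrBrDl subrr => /andP[x0 _].
    exact: is_derive1_ln.
  apply/is_derive_eps => e e0.
  have := @D1_inv R id g0%:C 1 0 (D1_id _).
  rewrite /id -rc0 (inj_eq (@rc_inj R)) gt_eqF// => /(_ isT) /(_ e e0)[D D0 H].
  exists D => // k kD; have := H k%:C; rewrite !nm_real => /(_ kD).
  have -> : (g0%:C + k%:C)^-1 - g0%:C^-1 - -1 / g0%:C ^+ 2 * k%:C - - 0%:C / g0%:C ^+ 2 * k%:C^* =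
      ((g0 + k)^-1 - g0^-1 - - g0^-1 ^+ 2 * k)%:C.
    by rewrite exprVn !(rcB, rcN, rcM, rcV, rcX, rcD) rc0; ring.
  by rewrite nm_real normr_id expr1.
apply: (J2_eq (J2_comp g00 P J)) => //.
- by rewrite rcN rcX; ring.
- by rewrite exprMn mulNr.
Qed.

Lemma J2_mul g g0 b beta d g' g0' b' beta' d' :
  J2 g g0 b beta d -> J2 g' g0' b' beta' d' ->
  J2 (fun s => g s * g' s) (g0 * g0') (g0%:C * b' + g0'%:C * b)
    (g0%:C * beta' + g0'%:C * beta + 2 * b * b')
    (g0 * d' + g0' * d + 2 * re (b * b'^*)).
Proof.
move=> J J'; have [D D0 [K K0 L]] := J2_lip J; have [D' D0' [K' K0' L']] := J2_lip J'.
have s1 := J2_scale g0 J'; have s2 := J2_scale g0' J.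
have s3 : J2 (fun s => (g s - g0) * (g' s - g0')) 0 0 (2 * b * b') (2 * re (b * b'^*)).
  have s5 : J2 (fun s => (2 * re (b * s)) * (2 * re (b' * s))) 0 0 (2 * b * b') (2 * re (b * b'^*)).
    apply: J2_poly => s; rewrite nm_sqr.
    by case: b {J L s2} => b1 b2; case: b' {J' L' s1} => b1' b2'; case: s => x y /=; ring.
  apply: (J2_small _ _ s5) => //.
  have s4 : small 2%N (fun s => - ((g s - g0) * (g' s - g0') - (2 * re (b * s)) * (2 * re (b' * s)))).
    apply: (@small_powS R 2%N _ (K * K' + 2 * nm b' * K) (Num.min D D')); first by rewrite lt_min D0.
    move=> s; rewrite lt_min => /andP[sD sD'].
    have [L1 L2] := L s sD; have [L1' L2'] := L' s sD'.
    have -> : - ((g s - g0) * (g' s - g0') - (2 * re (b * s)) * (2 * re (b' * s))) =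
      - ((g s - g0) * (g' s - g0' - 2 * re (b' * s)) + (2 * re (b' * s)) * (g s - g0 - 2 * re (b * s))) by ring.
    rewrite normrN (le_trans (ler_normD _ _))// (mulrDl (K * K')) lerD// normrM.
      by rewrite (_ : _ * nm s ^+ 3 = (K * nm s) * (K' * nm s ^+ 2)) ?ler_pM//; ring.
    rewrite (_ : _ * nm s ^+ 3 = (2 * (nm b' * nm s)) * (K * nm s ^+ 2)); last by ring.
    by rewrite ler_pM// normrM ger0_norm// ler_pM2l// (le_trans (re_le _))// nmM.
  by apply: (small_dom s4) => s; apply: eqle; congr `|_|; ring.
apply: (J2_small _ _ (J2_add (J2_add (J2_add s1 s2) s3) (J2_cst (- (g0 * g0'))))) => [|s].
  by apply: small_eq0 => s; ring.
by rewrite !addr0 (mulrC g0' g0) addrK.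
Qed.

(** On s = t v with small t > 0, division by t isolates 2 re (b v), and its sign at v = conj b
    forces b = 0; a second division by t leaves the quadratic form. *)
Lemma J2_max g g0 b beta d D : 0 < D -> J2 g g0 b beta d ->
  (forall s, nm s < D -> g s <= g0) ->
  b = 0 /\ forall s, re (beta * s ^+ 2) + d * nm s ^+ 2 <= 0.
Proof.
move=> D0 J gm.
have key s (e : R) : 0 < e -> exists2 T : R, 0 < T & forall t : R, 0 < t < T ->
    2 * re (b * s) + t * (re (beta * s ^+ 2) + d * nm s ^+ 2) <= t * e.
  move=> e0; have ns : 0 < nm s + 1 by rewrite ltr_wpDl ?nm_ge0.
  have e0' : 0 < e / (nm s + 1) ^+ 2 by rewrite divr_gt0// exprn_gt0.
  have [D' D0' H] := J _ e0'.
  exists (Num.min D D' / (nm s + 1)).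
    by rewrite divr_gt0// lt_min D0.
  move=> t /andP[t0]; rewrite ltr_pdivlMr// lt_min => /andP[tD tD'].
  have nts : nm (t%:C * s) <= t * (nm s + 1).
    by rewrite nmM nm_real gtr0_norm// ler_pM2l// lerDl.
  have := gm _ (le_lt_trans nts tD); have := H _ (le_lt_trans nts tD').
  rewrite ler_norml => /andP[H1 _] H2.
  have : e / (nm s + 1) ^+ 2 * nm (t%:C * s) ^+ 2 <= e * t ^+ 2.
    rewrite -mulrA ler_pM2l// ler_pdivrMl ?exprn_gt0// -exprMn.
    by rewrite ler_pXn2r ?nnegrE ?nm_ge0// ?mulr_ge0 ?(ltW ns) ?(ltW t0)// [leRHS]mulrC.
  have E1 : re (b * (t%:C * s)) = t * re (b * s) by rewrite mulrCA reZ.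
  have E2 : re (beta * (t%:C * s) ^+ 2) = t ^+ 2 * re (beta * s ^+ 2).
    by rewrite exprMn -rcX mulrCA reZ.
  have E3 : nm (t%:C * s) ^+ 2 = t ^+ 2 * nm s ^+ 2.
    by rewrite nmM nm_real exprMn real_normK ?num_real.
  move: H1; rewrite E1 E2 E3.
  set n := nm s; set x := re (b * s); set y := re (beta * s ^+ 2) => H1 H3.
  rewrite -(ler_pM2l t0) -subr_ge0.
  have -> : t * (t * e) - t * (2 * x + t * (y + d * n ^+ 2)) = e * t ^+ 2 - (2 * (t * x) + t ^+ 2 * y + d * (t ^+ 2 * n ^+ 2)) by ring.
  move: H2 H1 H3; set A := g _; set B := e / _ * _; lra.
have b0 s : re (b * s) <= 0.
  rewrite leNgt; apply/negP => bs; have [T T0 H] := key s 1 ltr01.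
  set c := re (beta * s ^+ 2) + d * nm s ^+ 2 in H.
  pose t := Num.min (T / 2) (re (b * s) / (`|c| + 1)).
  have c1 : 0 < `|c| + 1 by rewrite ltr_wpDl.
  have t0 : 0 < t by rewrite lt_min !divr_gt0.
  have tT : t < T by rewrite gt_min ltr_pdivrMr// mulr_natr mulr2n ltrDr T0.
  have := H t; rewrite t0 tT => /(_ isT).
  have : t * (`|c| + 1) <= re (b * s).
    by rewrite -ler_pdivlMr// ge_min lexx orbT.
  have : - (t * `|c|) <= t * c by rewrite -mulrN ler_pM2l// lerNl -normrN ler_norm.
  rewrite mulrDr mulr1; lra.
have bE : b = 0.
  have := b0 b^*; rewrite mul_conj /= => h; apply/eqP; rewrite -nm_eq0 -sqrf_eq0.
  by rewrite eq_le h sqr_ge0.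
split=> // s; apply/ler_addgt0Pr => e e0; have [T T0 H] := key s e e0.
have := H (T / 2); rewrite bE mul0r mulr0 add0r ler_pM2l ?divr_gt0//.
by rewrite add0r; apply; rewrite ltr_pdivrMr// mulr_natr mulr2n ltrDr.
Qed.

(** Adding the quadratic conditions at s = 1 and s = i cancels [beta] and leaves the Laplacian part
    [d]. *)
Lemma J2_max_d g g0 b beta d D : 0 < D -> J2 g g0 b beta d ->
  (forall s, nm s < D -> g s <= g0) -> d <= 0.
Proof.
move=> D0 J gm; have [_ H] := J2_max D0 J gm.
have := H 1; have := H 'i; rewrite /nm /= !expr0n /= !expr1n ?mulr1.
by rewrite sqr_i mulrN1 reN ?expr1n ?mulr1 ?addr0 ?add0r sqrtr1 expr1n mulr1; lra.
Qed.

Lemma J2_holo g g0 b beta d (V : C) : J2 g g0 b beta d ->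
  J2 (fun s => g (s * V)) g0 (b * V) (beta * V ^+ 2) (d * nm V ^+ 2).
Proof.
move=> J e e0; have nV : 0 < nm V + 1 by rewrite ltr_wpDl ?nm_ge0.
have e0' : 0 < e / (nm V + 1) ^+ 2 by rewrite divr_gt0// exprn_gt0.
have [D D0 H] := J _ e0'; exists (D / (nm V + 1)); first exact: divr_gt0.
move=> s; rewrite ltr_pdivlMr// => sD.
have ns : nm (s * V) <= nm s * (nm V + 1) by rewrite nmM ler_wpM2l ?nm_ge0// lerDl.
have := H _ (le_lt_trans ns sD).
have -> : b * (s * V) = b * V * s by ring.
have -> : beta * (s * V) ^+ 2 = beta * V ^+ 2 * s ^+ 2 by ring.
have -> : d * nm (s * V) ^+ 2 = d * nm V ^+ 2 * nm s ^+ 2 by rewrite nmM; ring.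
move=> /le_trans; apply; rewrite -mulrA ler_pM2l//.
rewrite ler_pdivrMl ?exprn_gt0// -exprMn.
by rewrite ler_pXn2r ?nnegrE ?mulr_ge0 ?nm_ge0 ?(ltW nV)// [leRHS]mulrC.
Qed.

Lemma J2_conj g g0 b beta d : J2 g g0 b beta d ->
  J2 (fun s => g s^*) g0 b^* beta^* d.
Proof.
move=> J e e0; have [D D0 H] := J _ e0; exists D => // s sD.
have := H s^*; rewrite nm_conj => /(_ sD).
have -> : re (b * s^*) = re (b^* * s) by rewrite -re_conj cjM cjK.
by have -> : re (beta * s^* ^+ 2) = re (beta^* * s ^+ 2) by rewrite -re_conj cjM -cjX cjK.
Qed.

Lemma J2_anti g g0 b beta d (V : C) : J2 g g0 b beta d ->
  J2 (fun s => g (s^* * V)) g0 (b * V)^* (beta * V ^+ 2)^* (d * nm V ^+ 2).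
Proof. by move=> J; exact: (J2_conj (J2_holo V J)). Qed.

Lemma J2_normsq (l a c : C) :
  J2 (fun s => nm (l + s * a + s^* * c) ^+ 2) (nm l ^+ 2)
     (l^* * a + l * c^*) (2 * a * c^*) (nm a ^+ 2 + nm c ^+ 2).
Proof.
apply: J2_poly => s; rewrite !nm_sqr.
case: l => l1 l2; case: a => a1 a2; case: c => c1 c2; case: s => x y /=; ring.
Qed.

(** With L = l + s a + conj(s) c, formally ln |L|^2 is ln L plus its conjugate, and the mixed
    coefficient of ln L is - a c / l^2. It vanishes for purely holomorphic or purely antiholomorphic
    motion. *)
Lemma J2_lnnorm (l a c : C) : l != 0 ->
  J2 (fun s => ln (nm (l + s * a + s^* * c) ^+ 2)) (ln (nm l ^+ 2))
     (a / l + (c / l)^*) (- ((a / l) ^+ 2 + ((c / l) ^+ 2)^*))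
     (- (2 * re (a / l * (c / l)))).
Proof.
move=> l0; have n0 : 0 < nm l ^+ 2 by rewrite exprn_gt0// nm_gt0.
have n0' : (nm l ^+ 2)%:C = l * l^* by rewrite mul_conj.
have lc0 : l^* != 0 by rewrite -nm_gt0 nm_conj nm_gt0.
have h0 : nm l ^+ 2 = nm (l + 0 * a + 0^* * c) ^+ 2.
  by rewrite (_ : (0 : C)^* = 0) ?mul0r ?addr0// -rc0 cj_rc.
have E1 : (nm l ^+ 2)^-1%:C * (l^* * a + l * c^*) = a / l + (c / l)^*.
  by rewrite rcV n0' cjM cjV; field; rewrite l0 lc0.
apply: (J2_eq (J2_ln h0 n0 (J2_normsq l a c))) => //.
- by rewrite E1 rcV n0' !cjX !cjM !cjV; field; rewrite l0 lc0.
- have -> : (nm l ^+ 2)^-1 * nm (l^* * a + l * c^*) = nm (a / l + (c / l)^*).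
    by rewrite -E1 nmM nm_real ger0_norm// invr_ge0 exprn_ge0// nm_ge0.
  have -> : (nm l ^+ 2)^-1 * (nm a ^+ 2 + nm c ^+ 2) = nm (a / l) ^+ 2 + nm (c / l) ^+ 2.
    by rewrite !nmM !nmV !exprMn exprVn; ring.
  by rewrite !nm_sqr; case: (a / l) => a1 a2; case: (c / l) => c1 c2 /=; ring.
Qed.

End Jets.

(** * Metrics of curvature -1 on planar open sets *)

Section Hyperbolic.
Variable R : realType.
Local Notation C := R[i].
Local Notation re := (@complex.Re R).
Local Notation im := (@complex.Im R).
Implicit Types (z w h u v : C).

Lemma D1_re F z A B : D1 F z A B -> DR (fun x => re (F x)) z ((A + B^*) / 2).
Proof.
move=> DF; apply/DR_small; apply: (small_dom DF) => h.
rewrite [leRHS]ger0_norm ?nm_ge0//.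
have -> : re (F (z + h)) - re (F z) - 2 * re ((A + B^*) / 2 * h) =
  re (F (z + h) - F z - A * h - B * h^*).
  rewrite !reB; have -> : (A + B^*) / 2 * h = 2^-1%:C * ((A + B^*) * h).
    by rewrite rcV (_ : 2%:C = 2 :> C) ?rcD//; field.
  rewrite reZ mulrA divff// mul1r mulrDl reD -(re_conj (B^* * h)) cjM cjK; ring.
exact: re_le.
Qed.

Lemma D1_mulc F c z A B : D1 F z A B -> D1 (fun x => c * F x) z (c * A) (c * B).
Proof.
move=> DF; have := D1_mul (D1_holo_cst c z) DF; rewrite !mul0r !add0r.
by [].
Qed.

Lemma im_re z : im z = re (- 'i * z).
Proof. by case: z => a b /=; ring. Qed.

Lemma nmi : nm ('i : C) = 1.
Proof. by rewrite /nm /= expr0n expr1n /= add0r sqrtr1. Qed.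

(** The factor 2 comes from applying the real mean value theorem separately to re F and to im F = re
    (- i F). *)
Lemma D1_mvt F z h (A B : C -> C) (K : R) :
  (forall t : R, 0 <= t <= 1 ->
     D1 F (z + t%:C * h) (A (z + t%:C * h)) (B (z + t%:C * h)) /\
     nm (A (z + t%:C * h)) + nm (B (z + t%:C * h)) <= K) ->
  nm (F (z + h) - F z) <= 2 * K * nm h.
Proof.
have main (F' : C -> C) (A' B' : C -> C) : (forall t : R, 0 <= t <= 1 ->
     D1 F' (z + t%:C * h) (A' (z + t%:C * h)) (B' (z + t%:C * h)) /\
     nm (A' (z + t%:C * h)) + nm (B' (z + t%:C * h)) <= K) ->
  `|re (F' (z + h)) - re (F' z)| <= K * nm h.
  move=> H; pose G (t : R) := re (F' (z + t%:C * h)).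
  have -> : re (F' (z + h)) = G 1 by rewrite /G mul1r.
  have -> : re (F' z) = G 0 by rewrite /G mul0r addr0.
  apply: mvt_bound => t t01; have [D L] := H t t01.
    exact: DR_line (D1_re D).
  set a := A' _ in L *; set b := B' _ in L *.
  have -> : 2 * re ((a + b^*) / 2 * h) = re ((a + b^*) * h).
    have -> : (a + b^*) / 2 * h = 2^-1%:C * ((a + b^*) * h).
      by rewrite rcV (_ : 2%:C = 2 :> C) ?rcD//; field.
    by rewrite reZ mulrA divff// mul1r.
  rewrite (le_trans (re_le _))// nmM ler_wpM2r ?nm_ge0//.
  by rewrite (le_trans (nmD _ _))// nm_conj.
move=> H; rewrite (le_trans (nm_le _))// reB im_re mulrBr reB.
rewrite (_ : 2 * K * nm h = K * nm h + K * nm h); last by ring.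
rewrite lerD ?(main F A B)//.
apply: (main (fun x => - 'i * F x) (fun x => - 'i * A x) (fun x => - 'i * B x)) => t t01.
have [D L] := H t t01; split; first exact: D1_mulc.
by rewrite !nmM !nmN nmi !mul1r.
Qed.

(* A conformal metric e^f |dz|^2 of curvature -1: p = f_z, q = f_zz and
   f_{z conj z} = e^f / 2. *)
Record hyp (U : set C) (f : C -> R) (p q : C -> C) : Prop := Hyp {
  hyp_open : forall z, U z -> exists2 d : R, 0 < d & forall h, nm h < d -> U (z + h);
  hyp_f : forall z, U z -> DR f z (p z);
  hyp_p : forall z, U z -> D1 p z (q z) (expR (f z) / 2)%:C;
  hyp_q : forall z, U z -> exists2 d : R, 0 < d & exists K : R,
    forall h, nm h < d -> nm (q (z + h)) <= K }.

Section HypLocal.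
Variables (U : set C) (f : C -> R) (p q : C -> C).
Hypothesis H : hyp U f p q.

Lemma hyp_fcont z (e : R) : U z -> 0 < e -> exists2 d : R, 0 < d &
  forall h, nm h < d -> `|f (z + h) - f z| < e.
Proof.
move=> Uz e0; have [d d0 L] := D1_cont (hyp_f H Uz) e0.
by exists d => // h /L; rewrite -rcB nm_real.
Qed.

(** The local bound on [q] makes [p] Lipschitz, and the mean value theorem along segments then gives
    a quadratic Taylor bound for [f]. The constants are uniform near [z0], so that compactness can
    turn them into constants on a whole [exh k]. *)
Lemma hyp_loc z0 : U z0 -> exists2 d : R, 0 < d & exists2 K : R, 0 < K &
  forall z h, nm (z - z0) < d -> nm h < d ->
  [/\ U (z + h), `|f z| <= K, nm (p z) <= K, nm (p (z + h) - p z) <= K * nm h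
    & `|f (z + h) - f z - 2 * re (p z * h)| <= K * nm h ^+ 2].
Proof.
move=> U0; have [d1 d10 H1] := hyp_open H U0.
have [d2 d20 [Kq H2]] := hyp_q H U0.
have [d3 d30 H3] := hyp_fcont U0 ltr01.
have [d4 d40 H4] := D1_cont (hyp_p H U0) ltr01.
pose dm := Num.min (Num.min d1 d2) (Num.min d3 d4).
have dm0 : 0 < dm by rewrite !lt_min d10 d20 d30.
pose Kr := expR (`|f z0| + 1).
pose K1 := 2 * (`|Kq| + Kr / 2).
have Kr0 : 0 < Kr by exact: expR_gt0.
have K10 : 0 < K1 by rewrite mulr_gt0// ltr_wpDl// divr_gt0.
have B x : nm (x - z0) < dm -> [/\ U x, nm (q x) <= `|Kq|, `|f x| <= `|f z0| + 1 & nm (p x) <= nm (p z0) + 1].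
  rewrite !lt_min => /andP[/andP[x1 x2] /andP[x3 x4]].
  have xE : x = z0 + (x - z0) by ring.
  split.
  - by rewrite xE; exact: H1.
  - by rewrite xE (le_trans (H2 _ x2))// ler_norm.
  - have := H3 _ x3; rewrite -xE => h3.
    rewrite (_ : f x = f z0 + (f x - f z0)); last by ring.
    by rewrite (le_trans (ler_normD _ _))// lerD2l ltW.
  - have := H4 _ x4; rewrite -xE => h4.
    rewrite (_ : p x = p z0 + (p x - p z0)); last by ring.
    by rewrite (le_trans (nmD _ _))// lerD2l ltW.
have seg z h t : nm (z - z0) < dm / 2 -> nm h < dm / 2 -> 0 <= t <= 1 ->
    nm (z + t%:C * h - z0) < dm.
  move=> zd hd /andP[t0 t1].
  rewrite (_ : z + t%:C * h - z0 = (z - z0) + t%:C * h); last by ring.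
  rewrite (le_lt_trans (nmD _ _))// nmZ ger0_norm//.
  have : t * nm h <= nm h by rewrite ler_piMl ?nm_ge0.
  lra.
have plip z h : nm (z - z0) < dm / 2 -> nm h < dm / 2 -> nm (p (z + h) - p z) <= K1 * nm h.
  move=> zd hd.
  apply: (D1_mvt (A := q) (B := fun x => (expR (f x) / 2)%:C)) => t t01.
  have [Ux qx fx _] := B _ (seg z h t zd hd t01).
  split; first exact: (hyp_p H Ux).
  rewrite lerD// nm_real ger0_norm ?divr_ge0 ?expR_ge0// ler_pM2r ?invr_gt0//.
  by rewrite ler_expR (le_trans (ler_norm _)).
exists (dm / 2); first by rewrite divr_gt0.
exists (`|f z0| + 1 + (nm (p z0) + 1) + K1 + 2 * K1).
  by have := normr_ge0 (f z0); have := nm_ge0 (p z0); lra.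
move=> z h zd hd.
have zd' : nm (z - z0) < dm by rewrite (lt_trans zd)// ltr_pdivrMr// ltr_pMr// ltrDl.
have [Uz _ fz pz] := B _ zd'.
have nz := normr_ge0 (f z0); have np := nm_ge0 (p z0).
split.
- have t11 : (0 : R) <= (1 : R) <= (1 : R) by rewrite ler01 lexx.
  by have := seg z h 1 zd hd t11; rewrite mul1r => /B[].
- by apply: le_trans fz _; lra.
- by apply: le_trans pz _; lra.
- rewrite (le_trans (plip _ _ zd hd))// ler_wpM2r ?nm_ge0//; lra.
- pose G (t : R) := f (z + t%:C * h) - t * (2 * re (p z * h)).
  have -> : f (z + h) - f z - 2 * re (p z * h) = G 1 - G 0.
    by rewrite /G mul0r addr0 !mul1r mul0r subr0 addrAC.
  apply: (@le_trans _ _ (2 * K1 * nm h ^+ 2)); last first.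
    by rewrite ler_wpM2r ?exprn_ge0 ?nm_ge0//; lra.
  apply: (@mvt_bound _ G (fun t => 2 * re (p (z + t%:C * h) * h) - 2 * re (p z * h))) => t t01.
    have [Ux _ _ _] := B _ (seg z h t zd hd t01).
    have h1 := DR_line (hyp_f H Ux).
    have h2 : is_derive t (1 : R) (fun t : R => t * (2 * re (p z * h))) (2 * re (p z * h)).
      by apply: is_derive_eq; rewrite /GRing.scale /=; ring.
    exact: is_deriveB.
  rewrite -mulrBr -reB -mulrBl normrM ger0_norm// -mulrA ler_pM2l//.
  rewrite (le_trans (re_le _))// nmM expr2 mulrA ler_wpM2r ?nm_ge0//.
  have [t0 t1] := andP t01.
  have nth : nm (t%:C * h) <= nm h by rewrite nmZ ger0_norm// ler_piMl ?nm_ge0.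
  by rewrite (le_trans (plip z _ zd (le_lt_trans nth hd)))// ler_pM2l.
Qed.

(** Along the segment to z + h, the derivative of [f] minus its quadratic polynomial is 2 re of h
    times the first-order remainder of [p] at [z], hence o(|h|^2). *)
Lemma hyp_J2 z : U z -> J2 (fun s => f (z + s)) (f z) (p z) (q z) (expR (f z) / 2).
Proof.
move=> Uz e e0; have [d1 d10 H1] := hyp_open H Uz.
have e20 : 0 < e / 2 by rewrite divr_gt0.
have [d2 d20 H2] := hyp_p H Uz e20.
set r := expR (f z) / 2 in H2 *.
exists (Num.min d1 d2); first by rewrite lt_min d10.
move=> h; rewrite lt_min => /andP[hd1 hd2].
have nth t : 0 <= t <= 1 -> nm (t%:C * h) <= nm h.
  by move=> /andP[t0 t1]; rewrite nmZ ger0_norm// ler_piMl ?nm_ge0.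
pose c := re (q z * h ^+ 2) + r * nm h ^+ 2.
pose G (t : R) := f (z + t%:C * h) - (t * (2 * re (p z * h)) + t ^+ 2 * c).
have -> : f (z + h) - (f z + 2 * re (p z * h) + re (q z * h ^+ 2) + r * nm h ^+ 2) = G 1 - G 0.
  by rewrite /G /c mul0r addr0 !mul1r !mul0r expr1n expr0n /=; ring.
apply: (@mvt_bound _ G (fun t => 2 * re (p (z + t%:C * h) * h) - (2 * re (p z * h) + 2 * t * c))) => t t01.
  have Ux := H1 _ (le_lt_trans (nth t t01) hd1).
  have h1 := DR_line (hyp_f H Ux).
  have h2 : is_derive t (1 : R) (fun t : R => t * (2 * re (p z * h)) + t ^+ 2 * c) (2 * re (p z * h) + 2 * t * c).
    by apply: is_derive_eq; rewrite /GRing.scale /=; ring.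
  exact: is_deriveB.
have := H2 _ (le_lt_trans (nth t t01) hd2).
rewrite ger0_norm ?nm_ge0// expr1 => Ht.
have -> : 2 * re (p (z + t%:C * h) * h) - (2 * re (p z * h) + 2 * t * c) =
  2 * re ((p (z + t%:C * h) - p z - q z * (t%:C * h) - r%:C * (t%:C * h)^*) * h).
  rewrite /c nm_sqr; case: (p _) => p1 p2; case: (p z) => p3 p4.
  by case: (q z) => q1 q2; case: h {hd1 hd2 nth c G Ht} => h1 h2 /=; ring.
rewrite normrM ger0_norm// mulrC -ler_pdivlMr// (le_trans (re_le _))// nmM.
rewrite (_ : e * nm h ^+ 2 / 2 = e / 2 * nm h * nm h); last by ring.
by rewrite ler_wpM2r ?nm_ge0// (le_trans Ht)// ler_pM2l// nth.
Qed.

End HypLocal.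
End Hyperbolic.

(** * Polygonal chains and the Hopf-Rinow argument *)

Section Chains.
Variable R : realType.
Local Notation C := R[i].
Local Notation re := (@complex.Re R).
Local Notation im := (@complex.Im R).
Implicit Types (z w h u v : C).

(** Bolzano-Weierstrass, phrased with a cluster point instead of an extracted subsequence. *)
Lemma BW (s : nat -> C) (M : R) : (forall n, nm (s n) <= M) ->
  exists p, forall (d : R) (N : nat), 0 < d -> exists2 n, (N <= n)%N & nm (s n - p) < d.
Proof.
move=> sM; pose s' n : R * R := (re (s n), im (s n)).
have cbox : compact (`[- M, M]%classic `*` `[- M, M]%classic : set (R * R)).
  by apply: compact_setX; exact: segment_compact.
have : (s' @ \oo) (`[- M, M]%classic `*` `[- M, M]%classic : set (R * R)).
  exists 0%N => // n _; rewrite /= !in_itv /= -!ler_norml; split.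
    by rewrite (le_trans (re_le _)).
  by rewrite (le_trans (im_le _)).
move=> /(cbox _ _)[p [_ cp]]; exists (p.1 +i* p.2) => d N d0.
have [] := cp [set s' n | n in [set n | (N <= n)%N]] (ball p (d / 2)).
- by exists N => // n Nn; exists n.
- by apply: nbhsx_ballx; rewrite divr_gt0.
move=> _ [[n Nn <-]] [/= b1 b2]; exists n => //.
rewrite (le_lt_trans (nm_le _))//.
move: b1 b2; rewrite /ball /= !(distrC p.1) !(distrC p.2).
case: (s n) => a b /=; lra.
Qed.

Section Complete.
Variables (U : set C) (f : C -> R) (p q : C -> C).

Definition seg u v (t : R) := u + t%:C * (v - u).

Lemma seg0 u v : seg u v 0 = u. Proof. by rewrite /seg mul0r addr0. Qed.
Lemma seg1 u v : seg u v 1 = v. Proof. by rewrite /seg mul1r addrC subrK. Qed.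

(* The last argument bounds the length of a polygonal path for e^f |dz|^2. *)
Inductive chain : C -> C -> R -> Prop :=
| chain_nil z : U z -> chain z z 0
| chain_cons u v w (A l : R) :
    (forall t : R, 0 <= t <= 1 -> U (seg u v t) /\ expR (f (seg u v t) / 2) <= A) ->
    chain v w l -> chain u w (A * nm (v - u) + l).

(** Completeness is tested on sequences with geometric steps of ratio 2/3, the factor by which balls
    shrink in [hopf_rinow]. The limit is taken in the Euclidean sense. *)
Definition complete := forall (s : nat -> C) (A : R),
  (forall n, exists2 l, l <= A * (2 / 3) ^+ n & chain (s n) (s n.+1) l) ->
  exists2 z, U z & forall e : R, 0 < e ->
    exists N, forall n, (N <= n)%N -> nm (s n - z) < e.

Lemma chain_ge0 u v l : chain u v l -> 0 <= l.
Proof.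
elim=> [//|{u v l} u v w A l H _ l0]; rewrite addr_ge0// mulr_ge0 ?nm_ge0//.
have [_] := H 0 (introT andP (conj (lexx _) ler01)).
by apply: le_trans; exact: expR_ge0.
Qed.

Lemma chain_U u v l : chain u v l -> U u /\ U v.
Proof.
elim=> [//|{u v l} u v w A l H _ [_ Uw]]; split=> //.
by have [] := H 0 (introT andP (conj (lexx _) ler01)); rewrite seg0.
Qed.

Lemma chain_seg u v (A : R) :
  (forall t : R, 0 <= t <= 1 -> U (seg u v t) /\ expR (f (seg u v t) / 2) <= A) ->
  chain u v (A * nm (v - u)).
Proof.
move=> H; rewrite -[X in chain _ _ X]addr0; apply: chain_cons => //; apply: chain_nil.
by have [] := H 1 (introT andP (conj ler01 (lexx _))); rewrite seg1.
Qed.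

Lemma chain_cat u v w l l' : chain u v l -> chain v w l' -> chain u w (l + l').
Proof.
elim=> [x _|{u v l} u v x A l H _ IH] c'; first by rewrite add0r.
by rewrite -addrA; apply: chain_cons => //; exact: IH.
Qed.

Lemma chain_rev u v l : chain u v l -> chain v u l.
Proof.
elim=> [x Ux|{u v l} u v x A l H _ IH]; first exact: chain_nil.
rewrite addrC; apply: chain_cat IH _; rewrite nmBC; apply: chain_seg => t /andP[t0 t1].
have -> : seg v u t = seg u v (1 - t) by rewrite /seg rcB; ring.
by apply: H; rewrite subr_ge0 t1 lerBlDl lerDr.
Qed.

(** The cut falls inside the link where the accumulated label passes [a], at the parameter given by
    linear interpolation of that link's label. *)
Lemma chain_split z w l (a : R) : chain z w l -> 0 <= a <= l ->
  exists m l1 l2, [/\ chain z m l1, chain m w l2, l1 <= a & l2 <= l - a].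
Proof.
move=> c; elim: c a => [x Ux|{z w l} u v x A l H c IH] a.
  rewrite -eq_le => /eqP <-; exists x, 0, 0.
  by split; rewrite ?subrr//; exact: chain_nil.
move=> /andP[a0 al]; set k := A * nm (v - u).
have [ka|ak] := leP k a.
  have [] := IH (a - k); first by rewrite subr_ge0 ka lerBlDl.
  move=> m [l1 [l2 [c1 c2 h1 h2]]]; exists m, (k + l1), l2.
  split; [exact: chain_cons|by []|lra|lra].
have k0 : 0 < k by rewrite (le_lt_trans a0).
have [t [t0 t1 tk]] : exists t, [/\ 0 <= t, t <= 1 & t * k = a].
  exists (a / k); split; first by rewrite divr_ge0// ltW.
    by rewrite ler_pdivrMr// mul1r ltW.
  by rewrite divfK// gt_eqF.
exists (seg u v t), (A * nm (seg u v t - u)), (A * nm (v - seg u v t) + l); split.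
- apply: chain_seg => s /andP[s0 s1].
  have -> : seg u (seg u v t) s = seg u v (s * t) by rewrite /seg rcM; ring.
  by apply: H; rewrite mulr_ge0// mulr_ile1.
- apply: chain_cons => // s /andP[s0 s1].
  have -> : seg (seg u v t) v s = seg u v (t + s * (1 - t)).
    by rewrite /seg rcD rcM rcB; ring.
  apply: H; rewrite addr_ge0 ?mulr_ge0 ?subr_ge0//=.
  have : s * (1 - t) <= 1 - t by rewrite ler_piMl// subr_ge0.
  lra.
- have -> : seg u v t - u = t%:C * (v - u) by rewrite /seg; ring.
  by rewrite nmZ ger0_norm// mulrCA tk.
- have -> : v - seg u v t = (1 - t)%:C * (v - u) by rewrite /seg rcB; ring.
  rewrite nmZ ger0_norm ?subr_ge0// mulrCA mulrBl mul1r tk /k; lra.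
Qed.

(** Inside the disc each link costs at least c times its Euclidean length; induction over the links
    shows that the chain is too short to leave the disc, so this bound applies to all of them. *)
Lemma chain_near z0 (c r : R) x y l : 0 < c ->
  (forall x, nm (x - z0) < r -> c <= expR (f x / 2)) ->
  chain x y l -> nm (x - z0) + l / c < r -> nm (y - z0) <= nm (x - z0) + l / c.
Proof.
move=> c0 cf; elim=> [w _|{x y l} u v w A l H ch IH]; first by rewrite mul0r addr0.
have l0 := chain_ge0 ch; have lc0 : 0 <= l / c by rewrite divr_ge0// ltW.
have [_ uA] := H 0 (introT andP (conj (lexx _) ler01)); rewrite seg0 in uA.
have A0 : 0 <= A by rewrite (le_trans _ uA)// expR_ge0.
rewrite (mulrDl (A * nm (v - u))) => h.
have k0 : 0 <= A * nm (v - u) / c by rewrite !mulr_ge0 ?nm_ge0// invr_ge0 ltW.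
have ur : nm (u - z0) < r by lra.
have cA : c <= A := le_trans (cf u ur) uA.
have vu : nm (v - u) <= A * nm (v - u) / c.
  by rewrite ler_pdivlMr// mulrC ler_wpM2r ?nm_ge0.
have := nm_tri v u z0; have : nm (v - z0) + l / c < r by have := nm_tri v u z0; lra.
by move=> /IH; lra.
Qed.

Definition exh (k : nat) : set C :=
  [set u | nm u <= k%:R /\ forall v, ~ U v -> k.+1%:R^-1 <= nm (u - v)].

Lemma exh_sub k : exh k `<=` U.
Proof.
move=> u [_ H]; apply: contrapT => Uu; have := H _ Uu.
by rewrite subrr nm0 leNgt invr_gt0 ltr0n.
Qed.

Lemma exh_mono k k' : (k <= k')%N -> exh k `<=` exh k'.
Proof.
move=> kk u [h1 h2]; split; first by rewrite (le_trans h1)// ler_nat.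
by move=> v /h2; apply: le_trans; rewrite lef_pV2 ?posrE ?ltr0n// ler_nat ltnS.
Qed.

Lemma archi (x : R) : exists k : nat, x < k%:R.
Proof. by exists (Num.bound `|x|); rewrite (le_lt_trans (ler_norm x))// archi_boundP. Qed.

Lemma exh_cover u (d : R) : 0 < d -> (forall h, nm h < d -> U (u + h)) ->
  exists k, forall h, nm h < d / 2 -> exh k (u + h).
Proof.
move=> d0 H; have [k1 h1] := archi (nm u + d); have [k2 h2] := archi (2 / d).
exists (maxn k1 k2) => h hd; split.
  rewrite (le_trans (nmD _ _))// (@le_trans _ _ (nm u + d))//; first lra.
  by rewrite (le_trans (ltW h1))// ler_nat leq_maxl.
move=> v Uv; rewrite leNgt; apply/negP => vd; apply: Uv.
have -> : v = u + (h + (v - (u + h))) by ring.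
apply: H; rewrite (le_lt_trans (nmD _ _))// nmBC.
have : nm (u + h - v) < d / 2.
  rewrite (lt_le_trans vd)// -[leRHS]invrK lef_pV2 ?posrE ?invr_gt0 ?divr_gt0 ?ltr0n//.
  by rewrite invf_div (le_trans (ltW h2))// ler_nat (leq_trans (leq_maxr k1 k2)).
rewrite nmBC; lra.
Qed.

(** Otherwise points u_m of [exh k] violating P m would cluster at a point which lies in [U], being
    at distance at least 1/(k+1) from the complement. The local hypothesis at that point and
    monotonicity in m give a contradiction. *)
Lemma exh_unif (P : nat -> C -> Prop) k :
  (forall m m' u, (m <= m')%N -> P m u -> P m' u) ->
  (forall u, U u -> exists m, exists2 d : R, 0 < d & forall h, nm h < d -> P m (u + h)) ->
  exists m, forall u, exh k u -> P m u.
Proof.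
move=> Pm Pl; apply: contrapT => nP.
have bad m : exists u, exh k u /\ ~ P m u.
  apply: contrapT => nm'; apply: nP; exists m => u ku.
  by apply: contrapT => nPu; apply: nm'; exists u.
have [s sP] := choice bad.
have [n|z hz] := BW (s := s) (M := k%:R); first by have [[]] := sP n.
have Uz : U z.
  apply: contrapT => Uz; have k0 : (0 : R) < k.+1%:R^-1 by rewrite invr_gt0 ltr0n.
  have [n _ nz] := hz _ 0%N k0; have [[_ /(_ z Uz)]] := sP n.
  by rewrite leNgt nz.
have [m [d d0 mP]] := Pl z Uz; have [n mn nz] := hz d m d0.
have [_] := sP n; apply; apply: (Pm m) => //.
by rewrite (_ : s n = z + (s n - z)); [exact: mP|ring].
Qed.

Hypothesis H : hyp U f p q.

Lemma chain_local z0 : U z0 -> exists2 d : R, 0 < d & exists2 c : R, 0 < c &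
  exists2 K : R, 0 < K & 
  (forall h, nm h < d -> U (z0 + h) /\ c <= expR (f (z0 + h) / 2)) /\
  (forall x y, nm (x - z0) < d -> nm (y - z0) < d -> chain x y (K * nm (y - x))).
Proof.
move=> U0; have [d1 d10 H1] := hyp_open H U0.
have [d2 d20 H2] := hyp_fcont H U0 ltr01.
pose d := Num.min d1 d2.
have d0 : 0 < d by rewrite lt_min d10.
have B x : nm (x - z0) < d -> U x /\ `|f x - f z0| < 1.
  rewrite lt_min => /andP[/H1 + /H2]; rewrite (_ : z0 + (x - z0) = x)//; ring.
exists d => //; exists (expR ((f z0 - 1) / 2)); first exact: expR_gt0.
exists (expR ((f z0 + 1) / 2)); first exact: expR_gt0.
split=> [h hd|x y xd yd].
  have [] := B (z0 + h); first by rewrite (_ : z0 + h - z0 = h)//; ring.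
  move=> Uh; rewrite ltr_norml => /andP[fh _]; split=> //.
  by rewrite ler_expR ler_pM2r ?invr_gt0//; lra.
apply: chain_seg => t /andP[t0 t1].
have sd : nm (seg x y t - z0) < d.
  rewrite (_ : seg x y t - z0 = (1 - t)%:C * (x - z0) + t%:C * (y - z0)); last by rewrite /seg rcB; ring.
  rewrite (le_lt_trans (nmD _ _))// !nmZ !ger0_norm// ?subr_ge0//.
  have [t00|t00] := eqVneq t 0; first by rewrite t00 subr0 mul1r mul0r addr0.
  have tp : 0 < t by rewrite lt_def t00.
  have : t * nm (y - z0) < t * d by rewrite ltr_pM2l.
  have : (1 - t) * nm (x - z0) <= (1 - t) * d by rewrite ler_wpM2l ?subr_ge0// ltW.
  rewrite mulrBl mul1r; lra.
have [Us] := B _ sd; rewrite ltr_norml => /andP[_ fs]; split=> //.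
by rewrite ler_expR ler_pM2r ?invr_gt0//; lra.
Qed.

Hypothesis cU : complete.

Let tame z (r : R) := exists k, forall y l, chain z y l -> l < r -> exh k y.

(** If all points within r of [z] were tame for 2r/3, any chain of length between 2r/3 and r could
    be cut after 7r/12. Its first part ends in a fixed [exh k], and the rest, shorter than 5r/12,
    stays in a compact set that can be chosen uniformly over that [exh k]. *)
Lemma tame_step z r : 0 < r -> U z -> ~ tame z r ->
  exists y l, [/\ chain z y l, l <= r & ~ tame y (2 / 3 * r)].
Proof.
move=> r0 Uz nt; apply: contrapT => nex.
have all y l : chain z y l -> l <= r -> tame y (2 / 3 * r).
  by move=> c lr; apply: contrapT => ny; apply: nex; exists y, l.
have [k hk] := all z 0 (chain_nil Uz) (ltW r0).
(* The chains from [z] to w and from w to x make [P] vacuous at points not known to be near [z]. The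
   slack r/12 leaves room to check [P] on a small disc, since 2/3 + 1/12 + 1/24 < 1 and 7/12 + 1/24
   < 2/3. *)
pose P m x := forall w l, chain z w l -> l < 2 / 3 * r ->
  forall l', chain w x l' -> l' < r / 12 ->
  forall y l2, chain x y l2 -> l2 < r * (7 / 12) -> exh m y.
have [|x Ux|m hm] := @exh_unif P k.
- by move=> m m' u mm Pu w l c1 c2 l' c3 c4 y l2 c5 c6; apply: (exh_mono mm); exact: Pu c1 c2 _ c3 c4 _ _ c5 c6.
- have [d d0 [c c0 [K K0 [HU HK]]]] := chain_local Ux.
  pose d' := Num.min d (r / 24 / K).
  have d'0 : 0 < d' by rewrite lt_min d0 !divr_gt0.
  have near h : nm h < d' -> chain x (x + h) (K * nm h) /\ K * nm h < r / 24.
    rewrite lt_min => /andP[hd hr]; split; last by rewrite mulrC -ltr_pdivlMr.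
    have -> : nm h = nm (x + h - x) by congr nm; ring.
    by apply: HK; rewrite ?subrr ?nm0// (_ : x + h - x = h)//; ring.
  have [[h0 [hd0 [w0 [l0 [l0' [c0' c1 c2 c3]]]]]]|nw] := pselect
      (exists h, nm h < d' /\ exists w l l', [/\ chain z w l, l < 2 / 3 * r, chain w (x + h) l' & l' < r / 12]).
    have [nh nhr] := near h0 hd0.
    have [k' hk'] := all x (l0 + l0' + K * nm h0) (chain_cat (chain_cat c0' c2) (chain_rev nh)) ltac:(lra).
    exists k', d' => // h hd w l c4 c5 l' c6 c7 y l2 c8 c9.
    have [nh1 nhr1] := near h hd.
    by apply: hk' (chain_cat nh1 c8) _; lra.
  exists 0%N, d' => // h hd w l c4 c5 l' c6 c7; exfalso; apply: nw.
  by exists h; split=> //; exists w, l, l'.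
apply: nt; exists (maxn k m) => y l c lr.
have [l23|l23] := ltP l (2 / 3 * r).
  by apply: (exh_mono (leq_maxl k m)); exact: hk c l23.
have l0 := chain_ge0 c.
have [|x [l1 [l2 [c1 c2 h1 h2]]]] := @chain_split z y l (r * (7 / 12)) c; first lra.
have kx : exh k x by apply: hk c1 _; lra.
apply: (exh_mono (leq_maxr k m)).
apply: (hm x kx x l1 c1 _ 0 (chain_nil (exh_sub kx)) _ y l2 c2); lra.
Qed.

(* Hopf-Rinow: otherwise the balls that are not relatively compact can be
   shrunk by the factor 2/3 along a Cauchy sequence. *)
Lemma hopf_rinow z (r : R) : U z -> 0 < r ->
  exists k, forall y l, chain z y l -> l < r -> exh k y.
Proof.
move=> Uz r0; apply: contrapT => nt.
pose rr n := r * (2 / 3) ^+ n.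
have rr0 n : 0 < rr n by rewrite mulr_gt0// exprn_gt0// divr_gt0.
have step (nx : nat * C) : exists ny : nat * C, U nx.2 -> ~ tame nx.2 (rr nx.1) ->
    [/\ ny.1 = nx.1.+1, U ny.2, ~ tame ny.2 (rr ny.1) & exists2 l, l <= rr nx.1 & chain nx.2 ny.2 l].
  have [[Ux nx2]|nn] := pselect (U nx.2 /\ ~ tame nx.2 (rr nx.1)); last first.
    by exists nx => a b; exfalso; apply: nn.
  have [y [l [c lr ny]]] := tame_step (rr0 nx.1) Ux nx2.
  exists (nx.1.+1, y) => _ _; split=> //=; first by have [] := chain_U c.
    by rewrite /rr exprS mulrCA.
  by exists l.
have [g gP] := choice step.
pose s n := iter n g (0%N, z).
have sP n : [/\ (s n).1 = n, U (s n).2 & ~ tame (s n).2 (rr n)].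
  elim: n => [|n [h1 h2 h3]]; first by split=> //=; rewrite /rr expr0 mulr1.
  have := gP (s n) h2; rewrite h1 => /(_ h3)[h4 h5 h6 _].
  by rewrite /s iterS -/(s n); split=> //; rewrite -?h4.
have [n|y Uy yP] := cU (s := fun n => (s n).2) (A := r).
  have [h1 h2 h3] := sP n; have := gP (s n) h2; rewrite h1 => /(_ h3)[_ _ _ [l l1 l2]].
  by exists l.
(* The limit [y] has a disc contained in one [exh k]. For n large, chains of length below [rr n]
   from the n-th point cannot leave this disc, so that point is tame after all. *)
have [d d0 [c c0 [K K0 [HU HK]]]] := chain_local Uy.
have [k hk] := exh_cover d0 (fun h hd => (HU h hd).1).
have dc0 : 0 < d / 4 * c by rewrite mulr_gt0// divr_gt0.
have [N hN] : exists N, forall n, (N <= n)%N -> rr n < d / 4 * c.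
  have : rr n @[n --> \oo] --> 0.
    rewrite -(mulr0 r); apply: cvgMr; apply: cvg_expr.
    by rewrite ger0_norm ?divr_ge0// ltr_pdivrMr// mul1r ltr_nat.
  move=> /cvgrPdist_lt /(_ _ dc0)[N _ hN]; exists N => n /hN /=.
  by rewrite sub0r normrN gtr0_norm.
have d40 : 0 < d / 4 by rewrite divr_gt0.
have [M hM] := yP _ d40.
pose n := maxn N M; have := hN n (leq_maxl _ _) => rn.
have sn := hM n (leq_maxr _ _); have [_ _] := sP n; apply.
exists k => x l cx lr; rewrite (_ : x = y + (x - y)); last by ring.
apply: hk.
have lc : l / c < d / 4 by rewrite ltr_pdivrMr// (lt_trans lr).
have : nm (x - y) <= nm ((s n).2 - y) + l / c.
  apply: (chain_near (r := d) c0) cx _; last lra.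
  move=> w wd; have [_] := HU _ wd; rewrite (_ : y + (w - y) = w)//; ring.
lra.
Qed.

End Complete.
End Chains.

(** * Energies of chains *)

Section ChainJets.
Variable R : realType.
Local Notation C := R[i].
Local Notation re := (@complex.Re R).
Local Notation im := (@complex.Im R).
Implicit Types (z w h u v : C).

Lemma J2_sum (I : seq nat) (g : nat -> C -> R) (g0 : nat -> R) (b beta : nat -> C)
    (d : nat -> R) :
  (forall i, i \in I -> J2 (g i) (g0 i) (b i) (beta i) (d i)) ->
  J2 (fun s => \sum_(i <- I) g i s) (\sum_(i <- I) g0 i) (\sum_(i <- I) b i)
     (\sum_(i <- I) beta i) (\sum_(i <- I) d i).
Proof.
elim: I => [|i I IH] H.
  by rewrite !big_nil; apply: J2_poly => s; rewrite big_nil !mul0r !mulr0 !addr0.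
rewrite !big_cons; apply: (J2_eq (J2_add (H i (mem_head _ _)) (IH _))) => //.
  by move=> j jI; apply: H; rewrite inE jI orbT.
by move=> s; rewrite big_cons.
Qed.

Lemma nm_sum (I : seq nat) (b : nat -> C) :
  nm (\sum_(i <- I) b i) <= \sum_(i <- I) nm (b i).
Proof.
elim: I => [|i I IH]; first by rewrite !big_nil nm0.
by rewrite !big_cons (le_trans (nmD _ _))// lerD2l.
Qed.

Lemma nmD_sqr_conj (l g k : C) :
  nm (l * g + k) ^+ 2 = nm l ^+ 2 * nm g ^+ 2 + nm k ^+ 2 + 2 * re (g * (l^* * k)^*).
Proof.
by rewrite !nm_sqr; case: l => l1 l2; case: g => g1 g2; case: k => k1 k2 /=; ring.
Qed.

Lemma nm2 : nm (2 : C) = 2.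
Proof. by rewrite (_ : 2 = 2%:C) ?nm_real ?ger0_norm// rcD. Qed.

Lemma re_half z : 2 * re (z / 2) = re z.
Proof.
have -> : z / 2 = 2^-1%:C * z by rewrite rcV (_ : 2%:C = 2 :> C) ?rcD// mulrC.
by rewrite reZ mulrA divff// mul1r.
Qed.

Lemma nm1D_sqr z : nm (1 + z) ^+ 2 = 1 + 2 * re z + nm z ^+ 2.
Proof. by rewrite !nm_sqr; case: z => a b /=; ring. Qed.

Lemma expR_le_inv (x : R) : x < 1 -> expR x <= (1 - x)^-1.
Proof.
move=> x1; have x0 : 0 < 1 - x by rewrite subr_gt0.
rewrite -[x in expR x]opprK expRN lef_pV2 ?posrE ?expR_gt0//.
exact: expR_ge1Dx.
Qed.

Lemma expR_ge_sq (x : R) : `|x| <= 1 / 2 -> expR (- x - 2 * x ^+ 2) <= 1 - x.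
Proof.
rewrite ler_norml => /andP[x1 x2]; have x0 : 0 < 1 - x by lra.
have -> : expR (- x - 2 * x ^+ 2) = (expR (x + 2 * x ^+ 2))^-1.
  by rewrite -expRN; congr expR; ring.
rewrite -[leRHS]invrK lef_pV2 ?posrE ?expR_gt0 ?invr_gt0//.
have : 1 + x / (1 - x) <= expR (x + 2 * x ^+ 2).
  rewrite (le_trans (expR_ge1Dx _))// ler_expR ler_pdivrMr//; nra.
by apply: le_trans; rewrite le_eqVlt; apply/orP; left; apply/eqP; field; rewrite gt_eqF.
Qed.

Section Link.
Variables (U : set C) (f : C -> R) (p q : C -> C).
Hypothesis H : hyp U f p q.

(** A symmetric and explicit substitute for the squared length of the segment, with e^f replaced by
    the geometric mean of its values at the two ends. *)
Definition link y z : R := expR ((f y + f z) / 2) * nm (z - y) ^+ 2.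

Lemma link_ge0 y z : 0 <= link y z.
Proof. by rewrite mulr_ge0 ?expR_ge0 ?exprn_ge0 ?nm_ge0. Qed.

(** Both vertices move holomorphically. The first-order term is a multiple of m, so m = 0 is the
    discrete form of V' and V being parallel; only the curvature term is then left in the mixed
    coefficient. *)
Lemma link_J2 y z V' V : U y -> U z ->
  let l := z - y in let m := l * ((p y * V' + p z * V) / 2) + (V - V') in
  let E := expR ((f y + f z) / 2) in
  exists beta, J2 (fun s => link (y + s * V') (z + s * V)) (link y z)
    (E%:C * l^* * m) beta
    (link y z * ((expR (f y) * nm V' ^+ 2 + expR (f z) * nm V ^+ 2) / 4) + E * nm m ^+ 2).
Proof.
move=> Uy Uz l m E.
have Jy := J2_holo V' (hyp_J2 H Uy); have Jz := J2_holo V (hyp_J2 H Uz).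
have J1 := J2_scale (2^-1) (J2_add Jy Jz).
have e0 : 2^-1 * (f y + f z) = 2^-1 * (f (y + 0 * V') + f (z + 0 * V)).
  by rewrite !mul0r !addr0.
have J := J2_mul (J2_exp e0 J1) (J2_normsq l (V - V') 0).
have two : 2^-1%:C = 2^-1 :> C by rewrite rcV (_ : 2%:C = 2)// rcD.
have E0 : expR (2^-1 * (f y + f z)) = E by rewrite mulrC.
eexists; refine (J2_cast J _ _ _ _).
- move=> s; rewrite /link mulr0 addr0 [2^-1 * _]mulrC; congr (_ * nm _ ^+ 2).
  by rewrite /l; ring.
- by rewrite E0.
- rewrite E0 two (_ : (0 : C)^* = 0) -?rc0 ?cj_rc// rc0 mulr0 addr0.
  by rewrite -mul_conj /m; field.
rewrite E0 two nm0 (_ : (0 : C)^* = 0) -?rc0 ?cj_rc// rc0 mulr0 addr0.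
rewrite /link -/l -/E expr0n /= addr0 /m.
have -> : E%:C * (2^-1 * (p y * V' + p z * V)) = E%:C * ((p y * V' + p z * V) / 2) by field.
have -> : nm (2^-1 * (p y * V' + p z * V)) = nm ((p y * V' + p z * V) / 2) by rewrite mulrC.
set g := (p y * V' + p z * V) / 2; set k := V - V'.
have -> : nm (l * g + k) ^+ 2 = nm l ^+ 2 * nm g ^+ 2 + nm k ^+ 2 + 2 * re (g * (l^* * k)^*).
  exact: nmD_sqr_conj.
by rewrite -[E%:C * g * _]mulrA reZ; field.
Qed.

Lemma exh_bounds k : exists2 d : R, 0 < d & exists2 K : R, 0 < K &
  forall z h, exh U k z -> nm h < d ->
  [/\ U (z + h), `|f z| <= K, nm (p z) <= K, nm (p (z + h) - p z) <= K * nm h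
    & `|f (z + h) - f z - 2 * re (p z * h)| <= K * nm h ^+ 2].
Proof.
pose P (m : nat) z := forall h, nm h < m.+1%:R^-1 ->
  [/\ U (z + h), `|f z| <= m%:R, nm (p z) <= m%:R, nm (p (z + h) - p z) <= m%:R * nm h
    & `|f (z + h) - f z - 2 * re (p z * h)| <= m%:R * nm h ^+ 2].
have [|z Uz|m hm] := @exh_unif R U P k.
- move=> m m' z mm Pz h hd; have mm' : (m%:R : R) <= m'%:R by rewrite ler_nat.
  have [|h1 h2 h3 h4 h5] := Pz h.
    by rewrite (lt_le_trans hd)// lef_pV2 ?posrE ?ltr0n// ler_nat.
  split=> //; try by apply: le_trans mm'.
    by apply: (le_trans h4); rewrite ler_wpM2r ?nm_ge0.
  by apply: (le_trans h5); rewrite ler_wpM2r ?exprn_ge0 ?nm_ge0.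
- have [d d0 [K K0 L]] := hyp_loc H Uz.
  have [m1 hm1] := archi K; have [m2 hm2] := archi d^-1.
  have mK : K <= (maxn m1 m2)%:R by rewrite (le_trans (ltW hm1))// ler_nat leq_maxl.
  exists (maxn m1 m2), d => // w wd h hd.
  have [||h1 h2 h3 h4 h5] := L (z + w) h.
  + by rewrite (_ : z + w - z = w)//; ring.
  + rewrite (lt_le_trans hd)// -[leRHS]invrK lef_pV2 ?posrE ?invr_gt0 ?ltr0n//.
    by rewrite (le_trans (ltW hm2))// ler_nat (leq_trans (leq_maxr m1 m2)).
  split=> //; try by apply: le_trans mK.
    by apply: (le_trans h4); rewrite ler_wpM2r ?nm_ge0.
  by apply: (le_trans h5); rewrite ler_wpM2r ?exprn_ge0 ?nm_ge0.
exists m.+1%:R^-1; first by rewrite invr_gt0 ltr0n.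
exists m.+1%:R; first by rewrite ltr0n.
move=> z h kz hd; have [h1 h2 h3 h4 h5] := hm z kz h hd.
have mm : (m%:R : R) <= m.+1%:R by rewrite ler_nat.
split=> //; try by apply: le_trans mm.
  by apply: (le_trans h4); rewrite ler_wpM2r ?nm_ge0.
by apply: (le_trans h5); rewrite ler_wpM2r ?exprn_ge0 ?nm_ge0.
Qed.

(** The factor for which V' = ratio y z * V makes m = 0 in [link_J2]: with l = z - y, the equation l
    (p y V' + p z V) / 2 + V - V' = 0 is solved for V'. *)
Definition ratio y z := (1 + p z * (z - y) / 2) / (1 - p y * (z - y) / 2).

(** The bound 1/16 keeps 1 + p z l / 2 and 1 - p y l / 2, the two factors of [ratio], within 1/32 of
    1. The last two fields are the second-order control that [exh_bounds] provides. *)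
Record short (K : R) y z : Prop := Short {
  short_K : 0 < K;
  short_1 : nm (z - y) <= 1;
  short_l : K * nm (z - y) <= 1 / 16;
  short_py : nm (p y) <= K;
  short_pz : nm (p z) <= K;
  short_p : nm (p z - p y) <= K * nm (z - y);
  short_f : `|f z - f y - 2 * re (p y * (z - y))| <= K * nm (z - y) ^+ 2 }.

Lemma short_fd K y z : short K y z -> `|f z - f y| <= 3 / 16.
Proof.
move=> [K0 l1 Kl py pz dp df].
have -> : f z - f y = (f z - f y - 2 * re (p y * (z - y))) + 2 * re (p y * (z - y)) by ring.
rewrite (le_trans (ler_normD _ _))//.
have h1 : `|2 * re (p y * (z - y))| <= 2 / 16.
  rewrite normrM ger0_norm// ler_pM2l// (le_trans (re_le _))// nmM.
  by rewrite (@le_trans _ _ (K * nm (z - y))) ?ler_wpM2r ?nm_ge0//; lra.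
have h2 : K * nm (z - y) ^+ 2 <= 1 / 16.
  by rewrite expr2 mulrA (le_trans _ Kl)// ler_piMr// mulr_ge0 ?nm_ge0 ?ltW.
lra.
Qed.

Lemma short_half K y z x : short K y z -> nm x <= K -> nm (x * (z - y) / 2) <= 1 / 32.
Proof.
move=> S xK; rewrite !nmM nmV nm2.
rewrite ler_pdivrMr// (@le_trans _ _ (K * nm (z - y))) ?ler_wpM2r ?nm_ge0//.
by have := short_l S; lra.
Qed.

Lemma short_den K y z : short K y z -> 1 - p y * (z - y) / 2 != 0.
Proof.
move=> S; have := short_half S (short_py S).
have := nm_sub 1 (p y * (z - y) / 2); rewrite nm1 => h1 h2.
by rewrite -nm_gt0; lra.
Qed.

(** Transport by [ratio] lengthens vectors by at most a factor exp (O(|l|^2)): the first-order part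
    re (p y l) + re (p z l) of ln |ratio|^2 matches f z - f y. Such quadratic errors add up to
    little along a fine chain. *)
Lemma short_ratio K y z : short K y z ->
  expR (f y) * nm (ratio y z) ^+ 2 <=
  expR ((2 * K + 3 * K ^+ 2) * nm (z - y) ^+ 2) * expR (f z).
Proof.
move=> S; have [K0 l1 Kl py pz dp df] := S.
set n := nm (z - y) in l1 Kl dp df *; have n0 : 0 <= n by exact: nm_ge0.
set x1 := p z * (z - y) / 2; set x2 := p y * (z - y) / 2.
have den := short_den S.
have nx x : nm x <= K -> nm (x * (z - y) / 2) <= K * n / 2.
  move=> xK; have : nm x * n <= K * n by rewrite ler_wpM2r.
  by rewrite !nmM nmV nm2 -/n; lra.
have n1 : nm x1 <= K * n / 2 := nx _ pz; have n2 : nm x2 <= K * n / 2 := nx _ py.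
have sq x : nm x <= K * n / 2 -> nm x ^+ 2 <= K ^+ 2 * n ^+ 2 / 4.
  move=> h; rewrite (_ : K ^+ 2 * n ^+ 2 / 4 = (K * n / 2) ^+ 2); last by field.
  by rewrite ler_pXn2r ?nnegrE ?nm_ge0// !mulr_ge0// ?ltW.
have s1 := sq _ n1; have s2 := sq _ n2.
have up : nm (1 + x1) ^+ 2 <= expR (2 * re x1 + nm x1 ^+ 2).
  have -> : nm (1 + x1) ^+ 2 = 1 + (2 * re x1 + nm x1 ^+ 2).
    by rewrite nm1D_sqr addrA.
  exact: expR_ge1Dx.
have r2 : (re x2) ^+ 2 <= nm x2 ^+ 2 by rewrite nm_sqr lerDl sqr_ge0.
have lo : expR (- (2 * re x2) - 2 * (2 * re x2) ^+ 2) <= nm (1 - x2) ^+ 2.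
  apply: le_trans (expR_ge_sq _) _.
    rewrite normrM ger0_norm//; have := re_le x2; lra.
  have -> : nm (1 - x2) ^+ 2 = 1 - 2 * re x2 + nm x2 ^+ 2.
    by rewrite nm1D_sqr nmN reN mulrN.
  by rewrite lerDl exprn_ge0 ?nm_ge0.
have lop : 0 < nm (1 - x2) ^+ 2 by rewrite exprn_gt0// nm_gt0.
rewrite /ratio -/x1 -/x2 nmM nmV exprMn exprVn mulrA ler_pdivrMr//.
apply: (@le_trans _ _ (expR (f y) * expR (2 * re x1 + nm x1 ^+ 2))).
  by rewrite ler_pM2l ?expR_gt0.
apply: (@le_trans _ _ (expR ((2 * K + 3 * K ^+ 2) * n ^+ 2) * expR (f z) * expR (- (2 * re x2) - 2 * (2 * re x2) ^+ 2))); last first.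
  by rewrite ler_pM2l ?mulr_gt0 ?expR_gt0.
rewrite -!expRD ler_expR.
have e1 : 2 * re x1 = re (p z * (z - y)).
  exact: re_half.
have e2 : 2 * re x2 = re (p y * (z - y)).
  exact: re_half.
have d1 : re (p z * (z - y)) - re (p y * (z - y)) <= K * n ^+ 2.
  rewrite -reB -mulrBl (le_trans (re_leP _))// nmM expr2 mulrA ler_wpM2r//.
have := df; rewrite ler_norml => /andP[df1 _].
have -> : (2 * re x2) ^+ 2 = 4 * (re x2) ^+ 2 by ring.
rewrite e1 e2; have nn : 0 <= K ^+ 2 * n ^+ 2 by rewrite mulr_ge0 ?sqr_ge0.
have -> : (2 * K + 3 * K ^+ 2) * n ^+ 2 = 2 * (K * n ^+ 2) + 3 * (K ^+ 2 * n ^+ 2) by ring.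
lra.
Qed.

(** Discrete energy of a curve traversed in N steps of duration 1/N, whence the factor N. *)
Definition energy (N : nat) (x : nat -> C) : R :=
  N%:R * \sum_(1 <= i < N.+1) link (x i.-1) (x i).

Lemma energy_ge0 N x : 0 <= energy N x.
Proof. by rewrite mulr_ge0// sumr_ge0// => i _; exact: link_ge0. Qed.

Lemma sum_suffix (F : nat -> R) i N : (i <= N)%N -> (forall j, 0 <= F j) ->
  \sum_(i.+1 <= j < N.+1) F j <= \sum_(1 <= j < N.+1) F j.
Proof.
move=> iN F0; rewrite [leRHS](@big_cat_nat _ _ _ i.+1)//=.
by rewrite lerDr sumr_ge0.
Qed.

Section Field.
Variables (N : nat) (x : nat -> C) (K : R) (V : C).
Hypothesis N0 : (0 < N)%N.
Hypothesis Ux : forall i, (i <= N)%N -> U (x i).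
Hypothesis Sx : forall i, (0 < i <= N)%N -> short K (x i.-1) (x i).
Hypothesis Lx : expR ((2 * K + 3 * K ^+ 2) * \sum_(1 <= j < N.+1) nm (x j - x j.-1) ^+ 2) <= 2.
Hypothesis V1 : expR (f (x N)) * nm V ^+ 2 = 1.

Let P i := \prod_(i.+1 <= j < N.+1) ratio (x j.-1) (x j).
(* Discrete parallel transport of V along the chain, with the linear ramp i / N. *)
Let v i := (i%:R / N%:R)%:C * V * P i.

Let NR : (0 : R) < N%:R. Proof. by rewrite ltr0n. Qed.

Let P_step i : (0 < i <= N)%N -> P i.-1 = ratio (x i.-1) (x i) * P i.
Proof. by case: i => // i iN; rewrite /P /= big_ltn. Qed.

Let K0 : 0 < K. Proof. by apply: (short_K (Sx (i := 1) _)); rewrite N0. Qed.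

(** Downward induction from the last vertex, where the product [P] is empty, with one use of
    [short_ratio] per link. *)
Let amp i : (i <= N)%N -> expR (f (x i)) * nm (P i) ^+ 2 <=
  expR ((2 * K + 3 * K ^+ 2) * \sum_(i.+1 <= j < N.+1) nm (x j - x j.-1) ^+ 2) * expR (f (x N)).
Proof.
move=> iN; rewrite -(subKn iN); elim: (N - i)%N (leq_subr i N) => [_|k IH kN].
  by rewrite subn0 /P !big_geq// nm1 expr1n mulr1 mulr0 expR0 mul1r.
have := IH (ltnW kN); set j := (N - k)%N => IHj.
have j0 : (0 < j <= N)%N by rewrite subn_gt0 kN leq_subr.
have -> : (N - k.+1 = j.-1)%N by rewrite subnS.
have S := Sx j0; rewrite P_step// nmM exprMn mulrA.
have jE : j.-1.+1 = j by rewrite prednK//; case/andP: j0.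
rewrite jE [\sum_(j <= _ < _) _]big_ltn; last by rewrite ltnS; case/andP: j0.
rewrite [(2 * K + 3 * K ^+ 2) * (_ + _)]mulrDr expRD -mulrA.
apply: (@le_trans _ _ (expR ((2 * K + 3 * K ^+ 2) * nm (x j - x j.-1) ^+ 2) * (expR (f (x j)) * nm (P j) ^+ 2))).
  by rewrite mulrA [leRHS]mulrA ler_wpM2r ?exprn_ge0 ?nm_ge0//; exact: short_ratio S.
by rewrite -[leRHS]mulrA ler_pM2l ?expR_gt0.
Qed.

Let ampv i : (i <= N)%N -> expR (f (x i)) * nm (v i) ^+ 2 <= 2 * (i%:R / N%:R) ^+ 2.
Proof.
move=> iN; rewrite /v nmM nmM nm_real ger0_norm ?divr_ge0// !exprMn.
set t := _ ^+ 2 * _ ^+ 2; have t0 : 0 <= t by rewrite mulr_ge0 ?sqr_ge0.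
have n0 : 0 <= nm V ^+ 2 by rewrite exprn_ge0 ?nm_ge0.
rewrite (_ : expR _ * _ = t * (nm V ^+ 2 * (expR (f (x i)) * nm (P i) ^+ 2))); last by ring.
rewrite mulrC ler_wpM2r//; apply: le_trans (ler_wpM2l n0 (amp iN)) _.
rewrite mulrCA [nm V ^+ 2 * _]mulrC V1 mulr1 (le_trans _ Lx)// ler_expR.
rewrite ler_wpM2l//; first by rewrite addr_ge0// mulr_ge0 ?sqr_ge0 ?ltW.
by apply: sum_suffix => // j; rewrite sqr_ge0.
Qed.

(** Pure transport would give 0, by the choice of [ratio]. The ramp multiplies the transported
    vector at the vertex i - 1 by 1 - 1/i, and the missing part 1/i is what remains. *)
Let v_step i : (0 < i <= N)%N ->
  let y := x i.-1 in let z := x i in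
  (z - y) * ((p y * v i.-1 + p z * v i) / 2) + (v i - v i.-1) =
  (1 + p z * (z - y) / 2) * v i / i%:R%:C.
Proof.
move=> i0 y z; have S := Sx i0; have den := short_den S; rewrite -/y -/z in den.
have iR : (i%:R%:C : C) != 0.
  by rewrite -rc0 (inj_eq (@rc_inj R)) pnatr_eq0 -lt0n; case/andP: i0.
have NC : (N%:R%:C : C) != 0.
  by rewrite -rc0 (inj_eq (@rc_inj R)) gt_eqF.
have iE : (i.-1%:R : R) = i%:R - 1.
  by rewrite -subn1 natrB//; case/andP: i0.
have -> : v i.-1 = (1 - i%:R%:C^-1) * ratio y z * v i.
  rewrite /v P_step// iE !rcM rcB !rcV rc1 -/y -/z.
  by move: iR NC; move: (i%:R%:C : C) (N%:R%:C : C) => I n iR NC; field; rewrite iR NC.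
rewrite /ratio; move: den iR; move: (i%:R%:C : C) => I den iR.
have den' : 2 - p y * (z - y) != 0.
  by apply: contra den => /eqP h; apply/eqP; rewrite -(mulr0 2^-1) -h; field.
field.
by rewrite iR den'.
Qed.

Let E i := expR ((f (x i.-1) + f (x i)) / 2).
Let m i := (x i - x i.-1) * ((p (x i.-1) * v i.-1 + p (x i) * v i) / 2) + (v i - v i.-1).

(** The i^2 in the denominator cancels against the ramp in [ampv]. The constants 5/4, 33/32 and 2
    come from [short_fd], [short_half] and [ampv], and 5/2 times (33/32)^2 is below 4. *)
Let mE i : (0 < i <= N)%N -> E i * nm (m i) ^+ 2 <= 4 / N%:R ^+ 2.
Proof.
move=> i0; have S := Sx i0; have [i1 iN] := andP i0.
have iR : (0 : R) < i%:R by rewrite ltr0n.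
rewrite /m v_step// (nmM (_ * v i)) (nmM (1 + _)) nmV nm_real ger0_norm//.
rewrite [(_ * _ / _) ^+ 2]exprMn [(_ * nm (v i)) ^+ 2]exprMn exprVn.
have h1 : E i <= 5 / 4 * expR (f (x i)).
  have -> : E i = expR ((f (x i.-1) - f (x i)) / 2) * expR (f (x i)).
    by rewrite -expRD; congr expR; field.
  rewrite ler_pM2r ?expR_gt0//; have := short_fd S; rewrite ler_norml => /andP[d1 d2].
  rewrite (le_trans (expR_le_inv _)) //; first lra.
  rewrite -[leRHS]invrK lef_pV2 ?posrE ?invr_gt0//; lra.
have h2 : nm (1 + p (x i) * (x i - x i.-1) / 2) ^+ 2 <= (33 / 32) ^+ 2.
  rewrite ler_pXn2r ?nnegrE ?nm_ge0//; rewrite (le_trans (nmD _ _))// nm1.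
  by have := short_half S (short_pz S); lra.
have h3 := ampv iN; set A := nm (v i) ^+ 2 in h3 *; set B := nm (1 + _) ^+ 2 in h2 *.
have A0 : 0 <= A by rewrite exprn_ge0 ?nm_ge0.
have B0 : 0 <= B by rewrite exprn_ge0 ?nm_ge0.
apply: (@le_trans _ _ (5 / 4 * expR (f (x i)) * (B * A / i%:R ^+ 2))).
  apply: ler_wpM2r => //; apply: divr_ge0; [exact: mulr_ge0|exact: sqr_ge0].
rewrite (_ : 5 / 4 * _ * _ = 5 / 4 * B * (expR (f (x i)) * A) / i%:R ^+ 2); last by ring.
apply: (@le_trans _ _ (5 / 4 * B * (2 * (i%:R / N%:R) ^+ 2) / i%:R ^+ 2)).
  by rewrite ler_wpM2r ?invr_ge0 ?sqr_ge0// ler_wpM2l// mulr_ge0.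
rewrite (_ : 5 / 4 * B * _ / _ = (5 / 2 * B) * N%:R ^- 2); last by field; rewrite !gt_eqF.
by rewrite ler_wpM2r ?invr_ge0 ?sqr_ge0//; lra.
Qed.

(** The squared length of each transported vector is at most 2, so curvature contributes at most the
    value of the link itself, and the ramp contributes 4/N^2. Summing N links and multiplying by N
    gives energy + 4. The gradient bound is the arithmetic-geometric inequality for E |l| |m|. *)
Lemma energy_jet : exists w : nat -> C, [/\ w 0%N = 0, w N = V &
  exists b beta d, [/\ J2 (fun s => energy N (fun i => x i + s * w i)) (energy N x) b beta d,
    d <= energy N x + 4 & nm b <= (energy N x + 4) / 2]].
Proof.
exists v; split; first by rewrite /v mul0r rc0 !mul0r.
  by rewrite /v /P big_geq// divff ?rc1 ?mul1r ?mulr1// gt_eqF.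
have /choice[beta hb] : forall i, exists beta, (0 < i <= N)%N ->
    J2 (fun s => link (x i.-1 + s * v i.-1) (x i + s * v i)) (link (x i.-1) (x i))
    ((E i)%:C * (x i - x i.-1)^* * m i) beta
    (link (x i.-1) (x i) * ((expR (f (x i.-1)) * nm (v i.-1) ^+ 2 + expR (f (x i)) * nm (v i) ^+ 2) / 4)
      + E i * nm (m i) ^+ 2).
  move=> i; have [i0|i0] := boolP (0 < i <= N)%N; last by exists 0.
  have [i1 iN] := andP i0.
  have [beta hb] := link_J2 (v i.-1) (v i) (Ux (leq_trans (leq_pred i) iN)) (Ux iN).
  by exists beta.
have mem i : i \in index_iota 1 N.+1 -> (0 < i <= N)%N by rewrite mem_index_iota.
have J := J2_scale N%:R (J2_sum (fun i (h : i \in index_iota 1 N.+1) => hb i (mem i h))).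
eexists; eexists; eexists; split; first exact: J.
- rewrite /energy [leLHS]mulr_sumr.
  apply: (@le_trans _ _ (\sum_(1 <= i < N.+1) N%:R * (link (x i.-1) (x i) + 4 / N%:R ^+ 2))).
    rewrite big_seq [leRHS]big_seq; apply: ler_sum => i /mem i0.
    have [i1 iN] := andP i0.
    rewrite ler_pM2l// lerD ?mE//; rewrite ler_piMr ?link_ge0//.
    have h1 := ampv iN; have h2 := ampv (leq_trans (leq_pred i) iN).
    have le1 j : (j <= N)%N -> 2 * (j%:R / N%:R) ^+ 2 <= (2 : R).
      move=> jN; rewrite ger_pMr// expr_le1 ?divr_ge0//.
      by rewrite ler_pdivrMr// mul1r ler_nat.
    by have := le1 _ iN; have := le1 _ (leq_trans (leq_pred i) iN); lra.
  rewrite -mulr_sumr big_split /= mulrDr lerD2l sumr_const_nat subn1 /= -mulr_natr.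
  by apply: eqle; field; rewrite gt_eqF.
- rewrite nmM nm_real ger0_norm//.
  apply: (@le_trans _ _ (N%:R * \sum_(1 <= i < N.+1) ((link (x i.-1) (x i) + 4 / N%:R ^+ 2) / 2))).
    rewrite ler_pM2l//; apply: le_trans (nm_sum _ _) _.
    rewrite big_seq [leRHS]big_seq; apply: ler_sum => i /mem i0.
    rewrite !nmM nm_real nm_conj ger0_norm ?expR_ge0//.
    have := mE i0; rewrite /link -/(E i).
    have E0 : 0 <= E i by exact: expR_ge0.
    set a := nm (x i - x i.-1); set b := nm (m i).
    have : 0 <= E i * (a - b) ^+ 2 by rewrite mulr_ge0 ?sqr_ge0.
    nra.
  rewrite -mulr_suml big_split /= sumr_const_nat subn1 /= -mulr_natr /energy.
  by apply: eqle; field; rewrite gt_eqF.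
Qed.

End Field.
End Link.
End ChainJets.

(** * Fine chains of bounded energy and the logarithmic cut-off *)

Section GoodChain.
Variable R : realType.
Local Notation C := R[i].
Local Notation re := (@complex.Re R).
Local Notation im := (@complex.Im R).
Implicit Types (z w h u v : C).

(** Since f >= -K on [exh k], the sum of the squared Euclidean links is at most exp(K) E1 / N. So
    one large N, the same for all these chains, makes every link [short] and keeps the transport
    factor below exp (1/2) <= 2. The length bound sums 2 a <= 1/N + N a^2 over the links. *)
Lemma good_chain (U : set C) (f : C -> R) (p q : C -> C) (k : nat) (E1 : R) :
  hyp U f p q -> 0 < E1 -> exists2 N, (0 < N)%N &
  forall x, (forall i, (i <= N)%N -> exh U k (x i)) -> energy f N x <= E1 ->
  (forall V, expR (f (x N)) * nm V ^+ 2 = 1 ->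
    exists w : nat -> C, [/\ w 0%N = 0, w N = V &
    exists b beta d, [/\ J2 (fun s => energy f N (fun i => x i + s * w i)) (energy f N x) b beta d,
      d <= energy f N x + 4 & nm b <= (energy f N x + 4) / 2]]) /\
  (forall i, (i <= N)%N -> exists2 l, l <= 1 + energy f N x & chain U f (x 0%N) (x i) l).
Proof.
move=> H E10; have [d d0 [K K0 B]] := exh_bounds H k.
pose D := Num.min (Num.min 1 d) (1 / 16 / K).
have D0 : 0 < D by rewrite !lt_min ltr01 d0 !divr_gt0.
pose c2 := 2 * K + 3 * K ^+ 2.
have c20 : 0 < c2 by rewrite addr_gt0// mulr_gt0// exprn_gt0.
pose M1 := expR K * E1.
have M10 : 0 < M1 by rewrite mulr_gt0// expR_gt0.
have [n1 hn1] := archi (M1 / D ^+ 2); have [n2 hn2] := archi (2 * c2 * M1).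
pose N := (maxn n1 n2).+1.
have NR : (0 : R) < N%:R by rewrite ltr0n.
have N1 : M1 / N%:R < D ^+ 2.
  rewrite ltr_pdivrMr// mulrC -ltr_pdivrMr ?exprn_gt0// (lt_trans hn1)//.
  by rewrite ltr_nat ltnS leq_maxl.
have N2 : c2 * (M1 / N%:R) <= 1 / 2.
  have : 2 * c2 * M1 <= N%:R.
    by rewrite (le_trans (ltW hn2))// ler_nat (leq_trans (leq_maxr n1 n2)).
  rewrite mulrA ler_pdivrMr//; lra.
exists N => // x xk xE.
have Ux i : (i <= N)%N -> U (x i) by move=> /xk /exh_sub.
set S := \sum_(1 <= i < N.+1) link f (x i.-1) (x i).
have SE : S <= E1 / N%:R by rewrite ler_pdivlMr// mulrC.
have link_lb i : (0 < i <= N)%N -> nm (x i - x i.-1) ^+ 2 <= expR K * link f (x i.-1) (x i).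
  move=> /andP[i1 iN]; have iN' := leq_trans (leq_pred i) iN.
  have [|_ f1 _ _ _] := B (x i) 0 (xk i iN); first by rewrite nm0.
  have [|_ f2 _ _ _] := B (x i.-1) 0 (xk _ iN'); first by rewrite nm0.
  rewrite /link mulrA -expRD ler_peMl ?exprn_ge0 ?nm_ge0// -[leLHS]expR0 ler_expR.
  move: f1 f2; rewrite !ler_norml => /andP[f1 _] /andP[f2 _]; lra.
have sum_lb : \sum_(1 <= j < N.+1) nm (x j - x j.-1) ^+ 2 <= M1 / N%:R.
  apply: (@le_trans _ _ (expR K * S)).
    rewrite mulr_sumr big_seq [leRHS]big_seq; apply: ler_sum => i.
    by rewrite mem_index_iota => i0; exact: link_lb.
  by rewrite /M1 -mulrA ler_pM2l ?expR_gt0.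
have lD i : (0 < i <= N)%N -> nm (x i - x i.-1) < D.
  move=> i0; rewrite -(@ltr_pXn2r _ 2)// ?nnegrE ?nm_ge0 ?(ltW D0)//.
  apply: le_lt_trans N1; apply: le_trans sum_lb.
  rewrite (bigD1_seq i) ?iota_uniq ?mem_index_iota//=.
  by rewrite lerDl sumr_ge0// => j _; rewrite sqr_ge0.
have Sx i : (0 < i <= N)%N -> short f p K (x i.-1) (x i).
  move=> i0; have := lD i i0; rewrite !lt_min => /andP[/andP[l1 ld] lK].
  case/andP: (i0) => i1 iN; have iN' := leq_trans (leq_pred i) iN.
  have [_ _ py dp df] := B (x i.-1) _ (xk _ iN') ld.
  have [|_ _ pz _ _] := B (x i) 0 (xk i iN); first by rewrite nm0.
  have E : x i.-1 + (x i - x i.-1) = x i by ring.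
  rewrite E in dp df; split=> //; first exact: ltW.
  by rewrite mulrC -ler_pdivlMr// ltW.
split.
  move=> V V1; apply: (energy_jet H (K := K)) => //.
  apply: (@le_trans _ _ (expR (1 / 2))).
    by rewrite ler_expR (le_trans _ N2)// ler_pM2l.
  by rewrite (le_trans (expR_le_inv _))//; [lra|apply: eqle; field].
have part i : (i <= N)%N -> exists2 l, l <= i%:R / N%:R + N%:R * \sum_(1 <= j < i.+1) link f (x j.-1) (x j)
    & chain U f (x 0%N) (x i) l.
  elim: i => [_|i IH iN].
    by exists 0; [rewrite big_geq// mulr0 mul0r addr0|exact: chain_nil (Ux _ _)].
  have [l ll c] := IH (ltnW iN); have i0 : (0 < i.+1 <= N)%N by [].
  have S1 := Sx _ i0; rewrite /= in S1.
  have := lD _ i0; rewrite !lt_min /= => /andP[/andP[l1 ld] lK].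
  set y := x i in c S1 l1 ld lK *; set z := x i.+1 in S1 l1 ld lK *.
  (* On the link, [f] exceeds the mean of its end values by at most 1, so the density exceeds its
     geometric mean by a factor of at most exp (1/2) <= 2. *)
  pose A := 2 * expR ((f y + f z) / 4).
  have := short_fd S1; rewrite ler_norml => /andP[fd1 fd2].
  have cyz : chain U f y z (A * nm (z - y)).
    apply: chain_seg => t /andP[t0 t1].
    have tn : nm (t%:C * (z - y)) <= nm (z - y) by rewrite nmZ ger0_norm// ler_piMl ?nm_ge0.
    have [Us _ _ _ df] := B y _ (xk _ (ltnW iN)) (le_lt_trans tn ld).
    split=> //; rewrite -/(seg y z t) in df.
    have h1 : re (p y * (t%:C * (z - y))) <= 1 / 16.
      rewrite (le_trans (re_leP _))// nmM (le_trans _ (short_l S1))//.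
      by rewrite ler_pM ?nm_ge0// (short_py S1).
    have h2 : K * nm (t%:C * (z - y)) ^+ 2 <= 1 / 16.
      rewrite (le_trans _ (short_l S1))// ler_pM2l// expr2 (le_trans _ tn)//.
      by rewrite ler_piMr ?nm_ge0// (le_trans tn)// ltW.
    move: df; rewrite ler_norml => /andP[_ df].
    have h3 : f (seg y z t) / 2 <= 1 / 2 + (f y + f z) / 4 by lra.
    rewrite (le_trans (_ : _ <= expR (1 / 2 + (f y + f z) / 4))) ?ler_expR//.
    rewrite expRD ler_pM2r ?expR_gt0// (le_trans (expR_le_inv _))//; first lra.
    by apply: eqle; field.
  exists (l + A * nm (z - y)); last exact: chain_cat c cyz.
  rewrite big_nat_recr//= mulrDr -natr1 mulrDl.
  have : A * nm (z - y) <= 1 / N%:R + N%:R * link f y z.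
    have -> : link f y z = (expR ((f y + f z) / 4) * nm (z - y)) ^+ 2.
      by rewrite /link exprMn [expR _ ^+ 2]expr2 -expRD; congr (expR _ * _); field.
    set a := expR _ * nm _; have -> : A * nm (z - y) = 2 * a by rewrite /A -mulrA.
    rewrite -subr_ge0 (_ : _ - _ = (1 - N%:R * a) ^+ 2 / N%:R).
      by rewrite divr_ge0 ?sqr_ge0.
    by field; rewrite gt_eqF.
  by move=> h; rewrite /y /z in h *; lra.
move=> i iN; have [l ll c] := part i iN; exists l => //.
apply: le_trans ll _; rewrite lerD//; first by rewrite ler_pdivrMr// mul1r ler_nat.
rewrite /energy ler_pM2l// [leRHS](@big_cat_nat _ _ _ i.+1)//= lerDl.
by rewrite sumr_ge0// => j _; exact: link_ge0.
Qed.

(** Whatever the energy, ln (1 + g) has mixed coefficient at most 4 and first-order coefficient of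
    modulus at most 2. Passing to ln (1 - ln (1 + g) / tau) costs 4 / (tau Y) + 4 / (tau Y)^2, which
    is at most 8 / (tau Y^2) as Y <= 1 <= tau. *)
Lemma logchi_J2 (g : C -> R) (tau : R) b beta d : 1 <= tau ->
  0 <= g 0 -> ln (1 + g 0) < tau -> J2 g (g 0) b beta d ->
  d <= g 0 + 4 -> nm b <= (g 0 + 4) / 2 ->
  let Y := 1 - ln (1 + g 0) / tau in
  exists b' beta' d', J2 (fun s => ln (1 - ln (1 + g s) / tau)) (ln Y) b' beta' d' /\
    - 8 / (tau * Y ^+ 2) <= d'.
Proof.
move=> t1 E0; set E := g 0 in E0 * => lE J dE bE Y.
have t0 : 0 < tau by rewrite (lt_le_trans ltr01).
have E1 : 0 < 1 + E by rewrite ltr_wpDr.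
have J1 := J2_ln (erefl _) E1 (J2_add (J2_cst (1 : R)) J).
set bX := _ * (0 + b) in J1; set dX := _ - (_ * nm _) ^+ 2 in J1.
have J3 := J2_add (J2_cst (1 : R)) (J2_scale (- tau^-1) J1).
have YE : 1 + - tau^-1 * ln (1 + E) = Y by rewrite /Y; ring.
have Y0 : 0 < Y by rewrite subr_gt0 ltr_pdivrMr// mul1r.
have Y1 : Y <= 1.
  by rewrite lerBlDr lerDl divr_ge0 ?(ltW t0)// ln_ge0// lerDl.
rewrite YE in J3; have J4 := J2_ln (esym YE) Y0 J3.
eexists; eexists; eexists; split.
  refine (J2_cast J4 _ _ _ _) => // s.
  by congr ln; ring.
have dX4 : dX <= 4.
  have s0 := sqr_ge0 ((1 + E)^-1 * nm (0 + b)).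
  have : (1 + E)^-1 * (0 + d) <= 4.
    by rewrite add0r mulrC ler_pdivrMr//; lra.
  rewrite /dX; lra.
have bX2 : nm bX <= 2.
  rewrite /bX -/E add0r nmM nm_real ger0_norm ?invr_ge0 ?(ltW E1)// mulrC ler_pdivrMr//; lra.
rewrite !add0r nmM nm_real normrN ger0_norm ?invr_ge0 ?(ltW t0)//.
have i0 : 0 <= (tau * Y)^-1 by rewrite invr_ge0 mulr_ge0 ?ltW.
have hb : (Y^-1 * (tau^-1 * nm bX)) ^+ 2 <= 4 / (tau * Y) ^+ 2.
  rewrite (_ : Y^-1 * (tau^-1 * nm bX) = nm bX * (tau * Y)^-1); last by rewrite invfM; ring.
  rewrite exprMn exprVn ler_wpM2r ?invr_ge0 ?sqr_ge0//.
  by rewrite (_ : 4 = 2 ^+ 2) ?ler_pXn2r ?nnegrE ?nm_ge0//; ring.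
have hd : - (4 / (tau * Y)) <= Y^-1 * (- tau^-1 * dX).
  rewrite (_ : Y^-1 * (- tau^-1 * dX) = - (dX * (tau * Y)^-1)); last by rewrite invfM; ring.
  by rewrite lerN2 ler_wpM2r.
have q1 : 4 / (tau * Y) <= 4 / (tau * Y ^+ 2).
  rewrite ler_pM2l// lef_pV2 ?posrE ?mulr_gt0 ?exprn_gt0// ler_pM2l// expr2.
  by rewrite ger_pMr.
have q2 : 4 / (tau * Y) ^+ 2 <= 4 / (tau * Y ^+ 2).
  rewrite ler_pM2l// lef_pV2 ?posrE ?mulr_gt0 ?exprn_gt0 ?mulr_gt0// exprMn.
  by rewrite ler_pM2r ?exprn_gt0// expr2 ler_peMl// ltW.
rewrite (_ : - 8 / (tau * Y ^+ 2) = - (4 / (tau * Y ^+ 2)) - 4 / (tau * Y ^+ 2)); last by ring.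
lra.
Qed.

Lemma unif_le (N : nat) (Q : nat -> C -> Prop) :
  (forall i, (i <= N)%N -> exists2 d : R, 0 < d & forall s, nm s < d -> Q i s) ->
  exists2 d : R, 0 < d & forall i s, (i <= N)%N -> nm s < d -> Q i s.
Proof.
elim: N => [|N IH] H.
  by have [d d0 h] := H 0%N (leqnn _); exists d => // i s; rewrite leqn0 => /eqP ->; exact: h.
have [i iN|d d0 h] := IH; first by apply: H; exact: leqW.
have [d' d0' h'] := H N.+1 (leqnn _); exists (Num.min d d'); first by rewrite lt_min d0.
move=> i s; rewrite lt_min leq_eqVlt => /orP[/eqP -> /andP[_ sd]|iN /andP[sd _]]; first exact: h'.
exact: h.
Qed.

End GoodChain.

(** * The comparison inequality *)

Section Continuity.
Variable R : realType.
Local Notation C := R[i].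
Local Notation re := (@complex.Re R).
Local Notation im := (@complex.Im R).
(* |z - w|^2 for the two densities; unlike each factor it is Moebius invariant. *)
Definition pairS (f f' : C -> R) (z w : C) : R :=
  expR ((f z + f' w) / 2) * nm (z - w) ^+ 2.

Variable X : topologicalType.
Implicit Types (x : X) (g : X -> C).

Definition cC g x :=
  continuous_at x (fun y => re (g y)) /\ continuous_at x (fun y => im (g y)).

Lemma cC_near g x (d : R) : cC g x -> 0 < d -> \forall y \near x, nm (g y - g x) < d.
Proof.
move=> [/cvgrPdist_lt c1 /cvgrPdist_lt c2] d0.
have d2 : 0 < d / 2 by rewrite divr_gt0.
near=> y.
rewrite (le_lt_trans (nm_le _))// reB.
have -> : im (g y - g x) = im (g y) - im (g x) by case: (g y); case: (g x).
have h1 : `|re (g y) - re (g x)| < d / 2 by rewrite distrC; near: y; exact: c1.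
have h2 : `|im (g y) - im (g x)| < d / 2 by rewrite distrC; near: y; exact: c2.
lra.
Unshelve. all: by end_near. Qed.

Lemma cC_DR (f : C -> R) p g x : DR f (g x) p -> cC g x ->
  continuous_at x (fun y => f (g y)).
Proof.
move=> Df cg; apply/cvgrPdist_lt => e e0.
have [d d0 H] := D1_cont Df e0.
have := cC_near cg d0; apply: filterS => y yd.
by have := H _ yd; rewrite (addrC (g x)) subrK -rcB nm_real distrC.
Qed.

Lemma cC_normsq g g' x : cC g x -> cC g' x ->
  continuous_at x (fun y => nm (g y - g' y) ^+ 2).
Proof.
move=> [a1 a2] [b1 b2].
have -> : (fun y => nm (g y - g' y) ^+ 2) = (fun y => (re (g y) - re (g' y)) * (re (g y) - re (g' y)) + (im (g y) - im (g' y)) * (im (g y) - im (g' y))).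
  apply/funext => y; rewrite nm_sqr; case: (g y) => c d; case: (g' y) => c' d' /=; ring.
apply: cvgD; apply: cvgM; exact: cvgB.
Qed.

Lemma cont_exp (h : X -> R) x : continuous_at x h -> continuous_at x (fun y => expR (h y)).
Proof. by move=> ch; apply: continuous_comp ch _; exact: continuous_expR. Qed.

Lemma cont_link (f : C -> R) p p' g g' x : DR f (g x) p -> DR f (g' x) p' ->
  cC g x -> cC g' x -> continuous_at x (fun y => link f (g y) (g' y)).
Proof.
move=> D D' cg cg'; apply: cvgM; last exact: cC_normsq.
apply: cont_exp; apply: cvgM; last exact: cvg_cst.
by apply: cvgD; [exact: cC_DR D cg|exact: cC_DR D' cg'].
Qed.

Lemma cont_sum (I : seq nat) (F : nat -> X -> R) x :
  (forall i, i \in I -> continuous_at x (F i)) ->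
  continuous_at x (fun y => \sum_(i <- I) F i y).
Proof.
elim: I => [|i I IH] H.
  have -> : (fun y => \sum_(i <- [::]) F i y) = (fun=> 0) by apply/funext => y; rewrite big_nil.
  exact: cvg_cst.
have -> : (fun y => \sum_(j <- i :: I) F j y) = (fun y => F i y + \sum_(j <- I) F j y).
  by apply/funext => y; rewrite big_cons.
apply: cvgD; first by apply: H; rewrite mem_head.
by apply: IH => j jI; apply: H; rewrite inE jI orbT.
Qed.

Lemma cont_cutoff (tau : R) (g : X -> R) x : continuous_at x g -> 0 <= g x ->
  continuous_at x (fun y => ((1 - ln (1 + g y) / tau + `|1 - ln (1 + g y) / tau|) / 2) ^+ 2).
Proof.
move=> cg g0.
have c1 : continuous_at x (fun y => 1 + g y) by apply: cvgD => //; exact: cvg_cst.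
have c2 : continuous_at x (fun y => ln (1 + g y)).
  apply: (@continuous_comp _ _ _ (fun y => 1 + g y) (@ln R)) => //.
  by apply: continuous_ln; rewrite ltr_wpDr.
have c3 : continuous_at x (fun y => ln (1 + g y) / tau).
  by apply: cvgM => //; exact: cvg_cst.
have c4 : continuous_at x (fun y => 1 - ln (1 + g y) / tau).
  by apply: cvgB => //; exact: cvg_cst.
have c5 : continuous_at x (fun y => (1 - ln (1 + g y) / tau + `|1 - ln (1 + g y) / tau|) / 2).
  apply: cvgM; last exact: cvg_cst.
  by apply: cvgD => //; exact: cvg_norm.
exact: (cvgM c5 c5).
Qed.

Lemma cont_pairS (f f' : C -> R) p p' g g' x : DR f (g x) p -> DR f' (g' x) p' ->
  cC g x -> cC g' x -> continuous_at x (fun y => pairS f f' (g y) (g' y)).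
Proof.
move=> D D' cg cg'; apply: cvgM; last exact: cC_normsq.
apply: cont_exp; apply: cvgM; last exact: cvg_cst.
by apply: cvgD; [exact: cC_DR D cg|exact: cC_DR D' cg'].
Qed.

Lemma cont_energy (f : C -> R) (p : C -> C) (N : nat) (g : X -> nat -> C) x :
  (forall i, DR f (g x i) (p (g x i))) -> (forall i, cC (fun y => g y i) x) ->
  continuous_at x (fun y => energy f N (g y)).
Proof.
move=> Df cg; apply: cvgM; first exact: cvg_cst.
by apply: cont_sum => i _; exact: cont_link (Df _) (Df _) (cg _) (cg _).
Qed.

Lemma cont_quot (S h h' : X -> R) x : S x != 0 -> continuous_at x S ->
  continuous_at x h -> continuous_at x h' -> continuous_at x (fun y => 4 / S y * h y * h' y).
Proof.
move=> S0 cS ch ch'; apply: cvgM => //; apply: cvgM => //.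
by apply: cvgM; [exact: cvg_cst|exact: cvgV].
Qed.

End Continuity.

(** * Compact subsets of the plane *)

Section CompactPlane.
Variable R : realType.
Local Notation C := R[i].
Local Notation re := (@complex.Re R).
Local Notation im := (@complex.Im R).

Lemma ball_compact (A : set C) (M : R) :
  (forall u, A u -> nm u <= M) ->
  (forall u, (forall e : R, 0 < e -> exists2 v, A v & nm (v - u) < e) -> A u) ->
  compact [set x : R * R | A (cplx x)].
Proof.
move=> AM Acl.
have cbox : compact (`[- M, M]%classic `*` `[- M, M]%classic : set (R * R)).
  by apply: compact_setX; exact: segment_compact.
apply: subclosed_compact cbox _; last first.
  move=> x /AM xM; rewrite /= !in_itv /= -!ler_norml; split.
    by rewrite (le_trans (re_le (cplx x))).
  by rewrite (le_trans (im_le (cplx x))).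
move=> x clx; apply: Acl => e e0.
have [|y [/= Ay [b1 b2]]] := clx (ball x (e / 2)).
  by apply: nbhsx_ballx; rewrite divr_gt0.
exists (cplx y) => //; rewrite (le_lt_trans (nm_le _))//.
move: b1 b2; rewrite /ball /= !(distrC x.1) !(distrC x.2); lra.
Qed.

Lemma exh_compact (U : set C) k : compact [set x : R * R | exh U k (cplx x)].
Proof.
apply: (@ball_compact _ k%:R) => [u []//|u H]; split.
  apply/ler_addgt0Pr => e e0; have [v [v1 _] vu] := H e e0.
  have := nm_sub u v; rewrite nmBC; lra.
move=> w Uw; apply/ler_addgt0Pr => e e0; have [v [_ v1] vu] := H e e0.
by apply: le_trans (v1 w Uw) _; have := nm_tri v u w; lra.
Qed.

Lemma cplx_inv (u : C) : cplx (re u, im u) = u.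
Proof. by case: u. Qed.

End CompactPlane.

(** * Maximum principle for pairs of chains *)

Section TheoremA.
Variable R : realType.
Local Notation C := R[i].
Local Notation re := (@complex.Re R).
Local Notation im := (@complex.Im R).

Lemma pairS_gt0 (f f' : C -> R) (z w : C) : z != w -> 0 < pairS f f' z w.
Proof. by move=> zw; rewrite mulr_gt0 ?expR_gt0 ?exprn_gt0// nm_gt0 subr_eq0. Qed.

(** In the mixed coefficient, the curvature equation of each metric gives e^f |V|^2 / 4 and e^f'
    |W|^2 / 4, and [J2_lnnorm] gives the cross term. *)
Lemma pairS_J2 (U U' : set C) (f f' : C -> R) p p' q q' z w V W :
  hyp U f p q -> hyp U' f' p' q' -> U z -> U' w -> z != w ->
  J2 (fun s => ln (pairS f f' (z + s * V) (w + s^* * W))) (ln (pairS f f' z w))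
     (2^-1 * (p z * V + (p' w * W)^*) + (V / (z - w) + (- W / (z - w))^*))
     (2^-1 * (q z * V ^+ 2 + (q' w * W ^+ 2)^*) - ((V / (z - w)) ^+ 2 + ((- W / (z - w)) ^+ 2)^*))
     ((expR (f z) * nm V ^+ 2 + expR (f' w) * nm W ^+ 2) / 4
       + 2 * re (V / (z - w) * (W / (z - w)))).
Proof.
move=> H H' Uz Uw zw; have l0 : z - w != 0 by rewrite subr_eq0.
have J1 := J2_scale 2^-1 (J2_add (J2_holo V (hyp_J2 H Uz)) (J2_anti W (hyp_J2 H' Uw))).
have J := J2_add J1 (J2_lnnorm V (- W) l0).
have two : 2^-1%:C = 2^-1 :> C by rewrite rcV (_ : 2%:C = 2)// rcD.
have lnS z' w' : z' != w' -> ln (pairS f f' z' w') = 2^-1 * (f z' + f' w') + ln (nm (z' - w') ^+ 2).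
  move=> n; rewrite /pairS lnM ?posrE ?expR_gt0 ?exprn_gt0 ?nm_gt0 ?subr_eq0//.
  by rewrite expRK mulrC.
rewrite lnS//.
have {}J : J2 (fun s => 2^-1 * (f (z + s * V) + f' (w + s^* * W)) + ln (nm (z - w + s * V + s^* * - W) ^+ 2))
   (2^-1 * (f z + f' w) + ln (nm (z - w) ^+ 2))
     (2^-1 * (p z * V + (p' w * W)^*) + (V / (z - w) + (- W / (z - w))^*))
     (2^-1 * (q z * V ^+ 2 + (q' w * W ^+ 2)^*) - ((V / (z - w)) ^+ 2 + ((- W / (z - w)) ^+ 2)^*))
     ((expR (f z) * nm V ^+ 2 + expR (f' w) * nm W ^+ 2) / 4
       + 2 * re (V / (z - w) * (W / (z - w)))).
  apply: (J2_eq J) => //; rewrite ?two//.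
  by rewrite mulNr mulrN reN; field.
have n0 : 0 < nm (z - w) by rewrite nm_gt0.
pose D := nm (z - w) / (nm V + nm W + 1).
have K0 : 0 < nm V + nm W + 1 by rewrite ltr_wpDl// addr_ge0 ?nm_ge0.
have D0 : 0 < D by rewrite divr_gt0.
apply: (@small_le R 2 _ _ D D0 _ J) => s sD; apply: eqle; congr `|_ - _|.
rewrite lnS.
  by congr (_ + ln (nm _ ^+ 2)); ring.
rewrite -subr_eq0 -nm_gt0.
have : nm (s * V - s^* * W) < nm (z - w).
  rewrite (le_lt_trans (nmB _ _))// !nmM nm_conj -mulrDr.
  apply: (@le_lt_trans _ _ (nm s * (nm V + nm W + 1))).
    by rewrite ler_wpM2l ?nm_ge0// lerDl.
  by rewrite -ltr_pdivlMr.
have := nm_sub (z - w) (- (s * V - s^* * W)); rewrite nmN opprK.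
rewrite (_ : z - w + (s * V - s^* * W) = z + s * V - (w + s^* * W)); last by ring.
lra.
Qed.

(** Both vectors are positive multiples of i (z - w), which makes V W / (z - w)^2 negative and the
    mixed coefficient of [pairS_J2] as small as unit vectors allow, namely 1/2 - 2/S. *)
Lemma good_dirs (f f' : C -> R) z w : z != w -> exists V W,
  [/\ expR (f z) * nm V ^+ 2 = 1, expR (f' w) * nm W ^+ 2 = 1
    & 2 * re (V / (z - w) * (W / (z - w))) = - (2 / pairS f f' z w)].
Proof.
move=> zw; have n0 : 0 < nm (z - w) by rewrite nm_gt0 subr_eq0.
pose e := 'i * ((z - w) / (nm (z - w))%:C).
have ne : nm e = 1.
  by rewrite /e nmM nmi mul1r nmM nmV nm_real gtr0_norm// divff ?gt_eqF.
exists ((expR (- (f z / 2)))%:C * e), ((expR (- (f' w / 2)))%:C * e).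
have ex x : expR x * expR (- (x / 2)) ^+ 2 = 1 :> R.
  by rewrite expr2 -!expRD -[RHS]expR0; congr expR; field.
split; first by rewrite nmZ ne mulr1 ger0_norm ?expR_ge0.
  by rewrite nmZ ne mulr1 ger0_norm ?expR_ge0.
have l0 : z - w != 0 by rewrite subr_eq0.
have nC : (nm (z - w))%:C != 0 :> C by rewrite -rc0 (inj_eq (@rc_inj R)) gt_eqF.
set a := expR _; set b := expR _.
have -> : a%:C * e / (z - w) * (b%:C * e / (z - w)) = (- (a * b / nm (z - w) ^+ 2))%:C.
  have i2 : 'i * 'i = -1 :> C by rewrite -expr2 sqr_i.
  rewrite rcN !rcM rcV rcX /e.
  transitivity (('i * 'i) * (a%:C * b%:C / (nm (z - w))%:C ^+ 2)); last by rewrite i2; ring.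
  by field; rewrite l0 nC.
have -> : 2 / pairS f f' z w = 2 * (a * b / nm (z - w) ^+ 2).
  rewrite /pairS (invfM (expR _)) -expRN /a /b -expRD mulrA.
  by rewrite mulrA; congr (_ * expR _ * _); field.
by rewrite /= mulrN.
Qed.

(** Here [kk] stands for 4/S, and [a] and [c] for the squares of the two cut-offs. The second-order
    condition at the maximum is multiplied by a c, which absorbs the denominators of the cut-off
    errors. *)
Lemma cutoff_bound (tau kk a c d1 d2 : R) : 0 < tau -> 0 < a <= 1 -> 0 < c <= 1 ->
  -1 * ((1 + 1) / 4 - kk / 2) + 2 * d1 + 2 * d2 <= 0 ->
  - 8 / (tau * a) <= d1 -> - 8 / (tau * c) <= d2 -> kk * a * c <= 1 + 64 / tau.
Proof.
move=> t0 /andP[a0 a1] /andP[c0 c1] h3 h4 h5.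
have : kk <= 1 - 4 * (- 8 / (tau * a)) - 4 * (- 8 / (tau * c)) by lra.
move=> /(ler_wpM2r (ltW (mulr_gt0 a0 c0))) h6; rewrite -mulrA; apply: le_trans h6 _.
have -> : (1 - 4 * (- 8 / (tau * a)) - 4 * (- 8 / (tau * c))) * (a * c) =
    a * c + (c + a) * (32 / tau) by field; rewrite !gt_eqF.
rewrite lerD//; first by rewrite mulr_ile1// ltW.
have -> : 64 / tau = 2 * (32 / tau) by field; rewrite gt_eqF.
by rewrite ler_pM2r ?divr_gt0//; lra.
Qed.

(* The S-inequality: maximise (4 / S) chi^2 chi'^2 over pairs of chains, chi
   being a cut-off in the energy of a chain, and vary both chains at once, the
   second one anti-holomorphically. *)
Theorem pairS_ge4 (U U' : set C) (f f' : C -> R) p p' q q' z0 w0 :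
  hyp U f p q -> hyp U' f' p' q' -> complete U f -> complete U' f' ->
  (forall z, U z -> U' z -> False) -> U z0 -> U' w0 -> 4 <= pairS f f' z0 w0.
Proof.
move=> H H' cU cU' dis Uz0 Uw0.
have ne z w : U z -> U' w -> z != w.
  by move=> Uz Uw; apply/negP => /eqP zw; apply: (dis z) => //; rewrite zw.
have S0 := pairS_gt0 f f' (ne _ _ Uz0 Uw0).
suff main (tau : R) : 1 <= tau -> 4 / pairS f f' z0 w0 <= 1 + 64 / tau.
  suff : 4 / pairS f f' z0 w0 <= 1 by rewrite ler_pdivrMr// mul1r.
  apply/ler_addgt0Pr => e e0.
  pose tau := Num.max 1 (64 / e).
  have t1 : 1 <= tau by rewrite le_max lexx.
  apply: le_trans (main tau t1) _; rewrite lerD2l ler_pdivrMr ?(lt_le_trans ltr01)//.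
  by rewrite mulrC -ler_pdivrMr// le_max lexx orbT.
move=> t1; have t0 : 0 < tau by rewrite (lt_le_trans ltr01).
(* The energy at which the cut-off [chi] below reaches 0. *)
pose E1 := expR tau - 1.
have E10 : 0 < E1 by rewrite subr_gt0 -[ltLHS]expR0 ltr_expR.
have E3 : 0 < E1 + 3 by rewrite addr_gt0.
(* A chain of energy at most [E1] has length at most 1 + E1, and a small displacement of a vertex
   will cost at most 1 more. The radius E1 + 3 thus keeps all vertices in one compact [exh k], also
   during variations. *)
have [k hk] := hopf_rinow H cU Uz0 E3.
have [k' hk'] := hopf_rinow H' cU' Uw0 E3.
have [N N0 gN] := good_chain k H E10; have [N' N0' gN'] := good_chain k' H' E10.
(* Coordinate i holds the i-th vertices of both chains. Infinite sequences give a single compact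
   space although N and N' may differ; index 0 is pinned to the base points. *)
pose X := prod_topology (fun _ : nat => (R * R * (R * R))%type).
pose A0 : set (R * R * (R * R)) := [set ((re z0, im z0), (re w0, im w0))].
pose A1 : set (R * R * (R * R)) := [set x | exh U k (cplx x)] `*` [set x | exh U' k' (cplx x)].
pose A : set X := [set x | forall i, (if i == 0%N then A0 else A1) (x i)].
have cA : compact A.
  apply: (@tychonoff nat (fun=> (R * R * (R * R))%type) (fun i => if i == 0%N then A0 else A1)) => i.
  case: ifP => _; first exact: compact_set1.
  by apply: compact_setX; exact: exh_compact.
have kz0 : exh U k z0 by apply: (hk z0 0 (chain_nil f Uz0)); rewrite addr_gt0.
have kw0 : exh U' k' w0 by apply: (hk' w0 0 (chain_nil f' Uw0)); rewrite addr_gt0.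
pose zz (x : X) i : C := cplx (x i).1; pose ww (x : X) i : C := cplx (x i).2.
have A00 x : A x -> zz x 0%N = z0 /\ ww x 0%N = w0.
  by move=> /(_ 0%N) /=; rewrite /zz /ww => ->; rewrite !cplx_inv.
have Ak x i : A x -> exh U k (zz x i) /\ exh U' k' (ww x i).
  move=> Ax; case: i => [|i]; first by have [-> ->] := A00 x Ax.
  by have [] := Ax i.+1.
pose En x := energy f N (zz x); pose En' x := energy f' N' (ww x).
pose S x := pairS f f' (zz x N) (ww x N').
pose chi (e : R) := 1 - ln (1 + e) / tau.
(* The positive part keeps [M] continuous on all of [A], with value 0 at chains of large energy. *)
pose cut (a : R) := (a + `|a|) / 2.
have cut_ge0 a : 0 <= cut a by rewrite divr_ge0//; have := ler_norm (- a); rewrite normrN; lra.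
have cut_pos a : 0 <= a -> cut a = a by move=> a0; rewrite /cut ger0_norm//; field.
have cut_gt0 a : 0 < cut a -> 0 < a.
  by move=> c0; rewrite ltNge; apply/negP => a0; move: c0; rewrite /cut ler0_norm// subrr mul0r ltxx.
pose M x := 4 / S x * cut (chi (En x)) ^+ 2 * cut (chi (En' x)) ^+ 2.
have cz x i : cC (fun y : X => zz y i) x.
  split; rewrite /zz /cplx /=.
    apply: (@continuous_comp _ _ _ (fun y : X => (y i).1) (@fst R R)); last exact: cvg_fst.
    by apply: (@continuous_comp _ _ _ (fun y : X => y i) (@fst (R * R) (R * R))); [exact: proj_continuous|exact: cvg_fst].
  apply: (@continuous_comp _ _ _ (fun y : X => (y i).1) (@snd R R)); last exact: cvg_snd.
  by apply: (@continuous_comp _ _ _ (fun y : X => y i) (@fst (R * R) (R * R))); [exact: proj_continuous|exact: cvg_fst].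
have cw x i : cC (fun y : X => ww y i) x.
  split; rewrite /ww /cplx /=.
    apply: (@continuous_comp _ _ _ (fun y : X => (y i).2) (@fst R R)); last exact: cvg_fst.
    by apply: (@continuous_comp _ _ _ (fun y : X => y i) (@snd (R * R) (R * R))); [exact: proj_continuous|exact: cvg_snd].
  apply: (@continuous_comp _ _ _ (fun y : X => (y i).2) (@snd R R)); last exact: cvg_snd.
  by apply: (@continuous_comp _ _ _ (fun y : X => y i) (@snd (R * R) (R * R))); [exact: proj_continuous|exact: cvg_snd].
have cM : {within A, continuous M}.
  apply: continuous_in_subspaceT => x; rewrite inE => Ax.
  have U1 i : U (zz x i) by have [/exh_sub] := Ak x i Ax.
  have U2 i : U' (ww x i) by have [_ /exh_sub] := Ak x i Ax.
  have cS := @cont_pairS R X f f' _ _ (fun y => zz y N) (fun y => ww y N') x (hyp_f H (U1 N)) (hyp_f H' (U2 N')) (cz x N) (cw x N').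
  have c1 := @cont_energy R X f p N zz x (fun i => hyp_f H (U1 i)) (cz x).
  have c2 := @cont_energy R X f' p' N' ww x (fun i => hyp_f H' (U2 i)) (cw x).
  have m1 := @cont_cutoff R X tau _ x c1 (energy_ge0 _ _ _).
  have m2 := @cont_cutoff R X tau _ x c2 (energy_ge0 _ _ _).
  apply: (@cont_quot R X S _ _ x _ cS m1 m2); by rewrite gt_eqF// pairS_gt0// ne.
(* Constant chains have energy 0, so [M] takes there the very value 4/S that is to be bounded. *)
pose x0 : X := fun=> ((re z0, im z0), (re w0, im w0)).
have Ax0 : A x0.
  move=> i; case: ifP => _ //; split; rewrite /= cplx_inv//.
have [|x] := compact_EVT_max _ cA cM; first by exists x0.
rewrite inE => Ax Mmax.
have Mx0 : M x0 = 4 / pairS f f' z0 w0.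
  have E0 : En x0 = 0 by rewrite /En /energy big1 ?mulr0// => i _; rewrite /link subrr nm0 expr0n mulr0.
  have E0' : En' x0 = 0 by rewrite /En' /energy big1 ?mulr0// => i _; rewrite /link subrr nm0 expr0n mulr0.
  rewrite /M E0 E0' /chi addr0 ln1 mul0r subr0 cut_pos// expr1n !mulr1.
  by rewrite /S /zz /ww !cplx_inv.
have Mle : 4 / pairS f f' z0 w0 <= M x by rewrite -Mx0; apply: Mmax; rewrite inE.
apply: (le_trans Mle).
have Ux i : U (zz x i) by have [/exh_sub] := Ak x i Ax.
have Uw i : U' (ww x i) by have [_ /exh_sub] := Ak x i Ax.
have Sx0 : 0 < S x by rewrite pairS_gt0// ne.
have Mx : 0 < M x by rewrite (lt_le_trans _ Mle)// divr_gt0.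
have cpos a b c : 0 < a -> 0 < a * cut b ^+ 2 * cut c ^+ 2 -> 0 < b /\ 0 < c.
  move=> a0 h; have cb := cut_ge0 b; have cc := cut_ge0 c.
  split; apply: cut_gt0; rewrite lt_def ?cut_ge0 andbT; apply: contraTneq h => ->.
    by rewrite expr0n mulr0 mul0r ltxx.
  by rewrite expr0n mulr0 ltxx.
have [Y0 Y0'] := cpos _ _ _ (divr_gt0 (ltr0n _ 4) Sx0) Mx.
set Y := chi (En x) in Y0; set Y' := chi (En' x) in Y0'.
have En0 : 0 <= En x := energy_ge0 _ _ _; have En0' : 0 <= En' x := energy_ge0 _ _ _.
have chi_ln e : 0 <= e -> 0 < chi e -> ln (1 + e) < tau /\ e <= E1.
  move=> e0; rewrite subr_gt0 ltr_pdivrMr// mul1r => h; split=> //.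
  rewrite /E1 lerBrDl -[1 + e]lnK ?posrE ?ltr_wpDr// ler_expR ltW//.
have [l1 EE1] := chi_ln _ En0 Y0; have [l2 EE1'] := chi_ln _ En0' Y0'.
have [|jet ch] := gN (zz x) _ EE1; first by move=> i _; have [] := Ak x i Ax.
have [|jet' ch'] := gN' (ww x) _ EE1'; first by move=> i _; have [] := Ak x i Ax.
have [V [W [V1 W1 VW]]] := good_dirs f f' (ne _ _ (Ux N) (Uw N')).
have [v [v0 vN [b [beta [d [J dE bE]]]]]] := jet V V1.
have [v' [v0' vN' [b' [beta' [d' [J' dE' bE']]]]]] := jet' W W1.
(* The maximum is unconstrained even if a vertex lies on the boundary of [exh k]: positive cut-offs
   place all vertices within length 1 + E1 of the base points, and nearby points are then still
   within E1 + 3. *)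
have stay (F : R[i] -> R) (G : set C) (pp qq : C -> C) (kk nn : nat) (xx vv : nat -> C) (c0 : C) :
    hyp G F pp qq -> (forall y l, chain G F c0 y l -> l < E1 + 3 -> exh G kk y) -> xx 0%N = c0 ->
    (forall i, (i <= nn)%N -> exists2 l, l <= 1 + E1 & chain G F (xx 0%N) (xx i) l) ->
    exists2 D : R, 0 < D & forall i s, (i <= nn)%N -> nm s < D -> exh G kk (xx i + s * vv i).
  move=> HG hkk x00 chx; apply: unif_le => i inn; have [l ll c] := chx i inn.
  have [_ Gi] := chain_U c; have [r r0 [cc cc0 [K K0 [_ HK]]]] := chain_local HG Gi.
  pose m := nm (vv i) + 1; have m0 : 0 < m by rewrite ltr_wpDl ?nm_ge0.
  exists (Num.min r (1 / K) / m); first by rewrite divr_gt0// lt_min r0 divr_gt0.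
  move=> s; rewrite ltr_pdivlMr// lt_min => /andP[s1 s2].
  have sm : nm (s * vv i) <= nm s * m by rewrite nmM ler_wpM2l ?nm_ge0// lerDl.
  have E : nm (xx i + s * vv i - xx i) = nm (s * vv i) by congr nm; ring.
  have c2 : chain G F (xx i) (xx i + s * vv i) (K * nm (s * vv i)).
    rewrite -E; apply: HK; first by rewrite subrr nm0.
    by rewrite E (le_lt_trans sm).
  rewrite x00 in c; apply: hkk (chain_cat c c2) _.
  have : K * nm (s * vv i) <= 1.
    by rewrite mulrC -ler_pdivlMr// (le_trans sm)// ltW.
  lra.
have [x00 w00] := A00 x Ax.
have [D D0 hD] := stay f U p q k N (zz x) v z0 H hk x00 (fun i iN =>
  let: ex_intro2 l h c := ch i iN in ex_intro2 _ _ l (le_trans h (lerD (lexx 1) EE1)) c).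
have [D' D0' hD'] := stay f' U' p' q' k' N' (ww x) v' w0 H' hk' w00 (fun i iN =>
  let: ex_intro2 l h c := ch' i iN in ex_intro2 _ _ l (le_trans h (lerD (lexx 1) EE1')) c).
pose xs (s : C) : X := fun i =>
  let a := if (i <= N)%N then zz x i + s * v i else zz x i in
  let b := if (i <= N')%N then ww x i + s^* * v' i else ww x i in
  ((re a, im a), (re b, im b)).
have zs s i : (i <= N)%N -> zz (xs s) i = zz x i + s * v i.
  by move=> iN; rewrite /zz /xs /= iN cplx_inv.
have ws s i : (i <= N')%N -> ww (xs s) i = ww x i + s^* * v' i.
  by move=> iN; rewrite /ww /xs /= iN cplx_inv.
have Axs s : nm s < Num.min D D' -> A (xs s).
  rewrite lt_min => /andP[sD sD'] i; case: i => [|i] /=.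
    by rewrite /xs /= v0 v0' !mulr0 !addr0 x00 w00.
  split; rewrite /xs /= cplx_inv.
    by case: ifP => h; [exact: hD|have [] := Ak x i.+1 Ax].
  by case: ifP => h; [apply: hD' => //; rewrite nm_conj|have [] := Ak x i.+1 Ax].
have Es s : En (xs s) = energy f N (fun i => zz x i + s * v i).
  rewrite /En /energy; congr (_ * _); rewrite big_nat [RHS]big_nat.
  apply: eq_bigr => i /andP[i1]; rewrite ltnS => iN.
  by rewrite !zs// (leq_trans (leq_pred i)).
have Es' s : En' (xs s) = energy f' N' (fun i => ww x i + s^* * v' i).
  rewrite /En' /energy; congr (_ * _); rewrite big_nat [RHS]big_nat.
  apply: eq_bigr => i /andP[i1]; rewrite ltnS => iN.
  by rewrite !ws// (leq_trans (leq_pred i)).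
have xs0 : En (xs 0) = En x /\ En' (xs 0) = En' x.
  have c0 : (0 : C)^* = 0 by rewrite -rc0 cj_rc.
  rewrite Es Es' c0; split; congr energy; apply/funext => i; by rewrite mul0r addr0.
have [e0 e0'] := xs0.
have JE : J2 (fun s => En (xs s)) (En (xs 0)) b beta d.
  by rewrite e0; apply: (J2_eq J) => // s; rewrite Es.
have JE' : J2 (fun s => En' (xs s)) (En' (xs 0)) b'^* beta'^* d'.
  by rewrite e0'; apply: (J2_eq (J2_conj J')) => // s; rewrite Es'.
have [b1 [beta1 [d1 [J1 hd1]]]] : exists b1 beta1 d1,
    J2 (fun s => ln (chi (En (xs s)))) (ln Y) b1 beta1 d1 /\ - 8 / (tau * Y ^+ 2) <= d1.
  by rewrite /Y -e0; apply: (logchi_J2 t1 _ _ JE); rewrite ?e0.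
have [b2 [beta2 [d2 [J2' hd2]]]] : exists b2 beta2 d2,
    J2 (fun s => ln (chi (En' (xs s)))) (ln Y') b2 beta2 d2 /\ - 8 / (tau * Y' ^+ 2) <= d2.
  by rewrite /Y' -e0'; apply: (logchi_J2 t1 _ _ JE'); rewrite ?e0' ?nm_conj.
have JS := pairS_J2 V W H H' (Ux N) (Uw N') (ne _ _ (Ux N) (Uw N')).
(* Up to the constant ln 4 this is ln M along the variation. The radius [T] below keeps both
   energies under [E1], so that the logarithms are those of positive numbers. *)
have JL := J2_add (J2_add (J2_scale (-1) JS) (J2_scale 2 J1)) (J2_scale 2 J2').
have [T1 T10 [K1 K10 h1]] := J2_lip JE; have [T2 T20 [K2 K20 h2]] := J2_lip JE'.
have lt_chi e : 0 <= e -> e < E1 -> 0 < chi e.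
  move=> g0 gE; rewrite subr_gt0 ltr_pdivrMr// mul1r -[tau]expRK ltr_ln ?posrE ?expR_gt0 ?ltr_wpDr//.
  by rewrite -ltrBrDl.
have lE1 e : 0 <= e -> ln (1 + e) < tau -> e < E1.
  by move=> g0 h; rewrite ltrBrDl -[1 + e]lnK ?posrE ?ltr_wpDr// ltr_expR.
have F1 : 0 < E1 - En x by rewrite subr_gt0 lE1.
have F2 : 0 < E1 - En' x by rewrite subr_gt0 lE1.
pose T := Num.min (Num.min D D') (Num.min (Num.min T1 T2) (Num.min ((E1 - En x) / K1) ((E1 - En' x) / K2))).
have T0 : 0 < T by rewrite !lt_min D0 D0' T10 T20 !divr_gt0.
have lnM4 y1 y2 y3 : 0 < y1 -> 0 < y2 -> 0 < y3 ->
    ln (4 / y1 * y2 ^+ 2 * y3 ^+ 2) = ln 4 + (-1 * ln y1 + 2 * ln y2 + 2 * ln y3) :> R.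
  move=> p1 p2 p3; rewrite !lnM ?posrE ?mulr_gt0 ?invr_gt0 ?exprn_gt0//.
  by rewrite lnV ?posrE//; ring.
have := J2_max_d T0 JL.
rewrite V1 W1 VW -/(S x) => dle.
have {dle} := dle _; rewrite /=.
have sq1 (y : R) : 0 < y -> y <= 1 -> 0 < y ^+ 2 <= 1 by move=> y0 y1; rewrite exprn_gt0// expr_le1// ltW.
have chi1 e : 0 <= e -> chi e <= 1.
  by move=> h; rewrite lerBlDr lerDl divr_ge0 ?(ltW t0)// ln_ge0// lerDl.
rewrite /M -/Y -/Y' !cut_pos ?(ltW Y0) ?(ltW Y0')// => dle.
apply: (cutoff_bound t0 (sq1 _ Y0 (chi1 _ En0)) (sq1 _ Y0' (chi1 _ En0')) _ hd1 hd2).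
have -> : (1 + 1) / 4 - 4 / S x / 2 = (1 + 1) / 4 + - (2 / S x) by field; rewrite gt_eqF.
apply: dle => s; rewrite !lt_min => /andP[/andP[sD sD'] /andP[/andP[s1 s2] /andP[s3 s4]]].
have Asx : A (xs s) by apply: Axs; rewrite lt_min sD.
have Ms : M (xs s) <= M x by apply: Mmax; rewrite inE.
have p1 : 0 < chi (En (xs s)).
  apply: lt_chi; first exact: energy_ge0.
  have [+ _] := h1 s s1; rewrite e0 ler_norml => /andP[_ h3].
  have : K1 * nm s < E1 - En x by rewrite mulrC -ltr_pdivlMr.
  lra.
have p2 : 0 < chi (En' (xs s)).
  apply: lt_chi; first exact: energy_ge0.
  have [+ _] := h2 s s2; rewrite e0' ler_norml => /andP[_ h3].
  have : K2 * nm s < E1 - En' x by rewrite mulrC -ltr_pdivlMr.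
  lra.
have Uxs : U (zz (xs s) N) by have [/exh_sub] := Ak _ N Asx.
have Uws : U' (ww (xs s) N') by have [_ /exh_sub] := Ak _ N' Asx.
have Ss0 : 0 < S (xs s) by rewrite pairS_gt0// ne.
have SE : S (xs s) = pairS f f' (zz x N + s * V) (ww x N' + s^* * W).
  by rewrite /S zs// ws// vN vN'.
rewrite -SE -(lerD2l (ln 4)) -!lnM4//.
have Mp y : 0 < chi (En y) -> 0 < chi (En' y) -> M y = 4 / S y * chi (En y) ^+ 2 * chi (En' y) ^+ 2.
  by move=> h3 h4; rewrite /M !cut_pos ?(ltW h3) ?(ltW h4).
by rewrite ler_ln ?posrE ?mulr_gt0 ?invr_gt0 ?exprn_gt0// -!Mp.
Qed.

End TheoremA.

(** * Rigidity at points of equality *)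

Section Equality.
Variable R : realType.
Local Notation C := R[i].
Local Notation re := (@complex.Re R).
Local Notation im := (@complex.Im R).
Implicit Types (z w h u v : C).

(** V = V' gives B = - A. Then A V^2 + B V'^2 = A (V - V') (V + V'), and with V - V' = 1 the sum V +
    V' is free; a large negative multiple of conj A makes the expression negative unless A = 0. *)
Lemma quad_rigid (A B : C) (r : R) :
  (forall V V', 0 <= re (A * V ^+ 2 + B * V' ^+ 2) + r * nm (V - V') ^+ 2) -> A = 0.
Proof.
move=> h; apply/eqP; rewrite -nm_eq0; apply/negPn/negP => A0.
have n0 : 0 < nm A by rewrite lt_def A0 nm_ge0.
have sq V : 0 <= re ((A + B) * V).
  have := h (sqrtc V) (sqrtc V).
  by rewrite subrr nm0 expr0n mulr0 addr0 -mulrDl sqr_sqrtc.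
have BA : B = - A.
  apply/eqP; rewrite -addr_eq0 addrC -nm_eq0 -sqrf_eq0 eq_le sqr_ge0 andbT.
  by have := sq (- (A + B)^*); rewrite mulrN mul_conj reN /= oppr_ge0.
pose m := - ((r + 1) / nm A ^+ 2)%:C * A^*.
have := h ((m + 1) / 2) ((m - 1) / 2).
have -> : (m + 1) / 2 - (m - 1) / 2 = 1 by field.
rewrite BA (_ : A * _ + _ = A * m); last by field.
rewrite nm1 expr1n mulr1 /m mulrCA mul_conj mulNr -rcM /= divfK; last by rewrite gt_eqF// exprn_gt0.
lra.
Qed.

Variables (U U' : set C) (f f' : C -> R) (p p' q q' : C -> C).
Hypotheses (H : hyp U f p q) (H' : hyp U' f' p' q').
Hypothesis dis : forall z, U z -> U' z -> False.
Hypothesis S4 : forall z w, U z -> U' w -> 4 <= pairS f f' z w.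

Let ne z w : U z -> U' w -> z != w.
Proof. by move=> Uz Uw; apply/negP => /eqP zw; apply: (dis Uz); rewrite zw. Qed.

Lemma lnS_min z w V W : U z -> U' w -> pairS f f' z w = 4 ->
  let b := 2^-1 * (p z * V + (p' w * W)^*) + (V / (z - w) + (- W / (z - w))^*) in
  let beta := 2^-1 * (q z * V ^+ 2 + (q' w * W ^+ 2)^*) - ((V / (z - w)) ^+ 2 + ((- W / (z - w)) ^+ 2)^*) in
  let d := (expR (f z) * nm V ^+ 2 + expR (f' w) * nm W ^+ 2) / 4 + 2 * re (V / (z - w) * (W / (z - w))) in
  b = 0 /\ 0 <= re beta + d.
Proof.
move=> Uz Uw Szw b beta d.
have J := J2_scale (-1) (pairS_J2 V W H H' Uz Uw (ne Uz Uw)).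
have [r r0 hr] := hyp_open H Uz; have [r' r0' hr'] := hyp_open H' Uw.
pose T := Num.min r r' / (nm V + nm W + 1).
have K0 : 0 < nm V + nm W + 1 by rewrite ltr_wpDl// addr_ge0 ?nm_ge0.
have T0 : 0 < T by rewrite divr_gt0// lt_min r0.
have [|b0 hb] := J2_max T0 J.
  move=> s; rewrite ltr_pdivlMr// lt_min => /andP[s1 s2].
  rewrite !mulN1r lerN2 Szw ler_ln ?posrE//.
    apply: S4.
      apply: hr; rewrite nmM (le_lt_trans _ s1)// ler_wpM2l ?nm_ge0//.
      by rewrite -addrA lerDl addr_ge0 ?nm_ge0.
    apply: hr'; rewrite nmM nm_conj (le_lt_trans _ s2)// ler_wpM2l ?nm_ge0//.
    by rewrite [nm V + _]addrC -addrA lerDl addr_ge0 ?nm_ge0.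
  rewrite (lt_le_trans _ (S4 _ _))//.
    apply: hr; rewrite nmM (le_lt_trans _ s1)// ler_wpM2l ?nm_ge0//.
    by rewrite -addrA lerDl addr_ge0 ?nm_ge0.
  apply: hr'; rewrite nmM nm_conj (le_lt_trans _ s2)// ler_wpM2l ?nm_ge0//.
  by rewrite [nm V + _]addrC -addrA lerDl addr_ge0 ?nm_ge0.
split.
  have : (-1)%:C * b = 0 := b0.
  by rewrite rcN rc1 mulN1r => /eqP; rewrite oppr_eq0 => /eqP.
have := hb 1; rewrite !expr1n nm1 expr1n !mulr1 -/beta -/d rcN rc1 mulN1r reN; lra.
Qed.

(** The gradient of ln S vanishes in each variable separately: W = 0 yields [p z] and V = 0 yields
    [p' w]. *)
Lemma critical z w : U z -> U' w -> pairS f f' z w = 4 ->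
  p z = - 2 / (z - w) /\ p' w = 2 / (z - w).
Proof.
move=> Uz Uw Szw; have l0 : z - w != 0 by rewrite subr_eq0 ne.
have c0 : (0 : C)^* = 0 by rewrite -rc0 cj_rc.
have [b1 _] := lnS_min 1 0 Uz Uw Szw; have [b2 _] := lnS_min 0 1 Uz Uw Szw.
split.
  move: b1; rewrite mulr1 mulr0 c0 oppr0 mul0r c0 !addr0 => b1.
  have -> : p z = 2 * (2^-1 * p z + 1 / (z - w)) - 2 / (z - w) by field.
  by rewrite b1 mulr0 add0r mulNr.
move: b2; rewrite mulr0 mulr1 add0r mul0r add0r => b2.
have -> : p' w = 2 * (2^-1 * (p' w)^* + (- 1 / (z - w))^*)^* + 2 / (z - w).
  rewrite cjD cjM !cjK (_ : (2^-1 : C)^* = 2^-1); first by field.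
  have two : 2^-1%:C = 2^-1 :> C by rewrite rcV (_ : 2%:C = 2)// rcD.
  by rewrite -two cj_rc.
by rewrite b2 c0 mulr0 add0r.
Qed.

Lemma critical_w z w : U z -> U' w -> pairS f f' z w = 4 ->
  p z != 0 /\ w = z + 2 / p z.
Proof.
move=> Uz Uw Szw; have l0 : z - w != 0 by rewrite subr_eq0 ne.
have [-> _] := critical Uz Uw Szw.
have n2 : (2 : C) != 0 by rewrite -nm_gt0 nm2.
by split; [rewrite mulf_neq0 ?invr_eq0 ?oppr_eq0|field; rewrite l0].
Qed.

(** In the Hessian inequality, W = - k conj V' with |k| = g / g' turns curvature and cross terms
    together into a multiple of |V - V'|^2. Then [quad_rigid] kills the coefficient of V^2, which is
    q - p^2/2. *)
Lemma schwarzian0 z w : U z -> U' w -> pairS f f' z w = 4 -> q z = p z ^+ 2 / 2.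
Proof.
move=> Uz Uw Szw; have l0 : z - w != 0 by rewrite subr_eq0 ne.
have [pz pw] := critical Uz Uw Szw; set l := z - w in l0 pz pw.
have n0 : 0 < nm l by rewrite nm_gt0.
pose A := q z - p z ^+ 2 / 2; pose B := q' w - p' w ^+ 2 / 2.
pose g := expR (f z / 2); pose g' := expR (f' w / 2).
have g0 : 0 < g := expR_gt0 _; have g0' : 0 < g' := expR_gt0 _.
have gg : g * g' * nm l ^+ 2 = 4.
  by rewrite -Szw /pairS -expRD; congr (expR _ * _); field.
have fE : expR (f z) = g ^+ 2 by rewrite expr2 -expRD; congr expR; field.
have fE' : expR (f' w) = g' ^+ 2 by rewrite expr2 -expRD; congr expR; field.
pose k := ((g / g') / nm l ^+ 2)%:C * l ^+ 2.
apply/eqP; rewrite -subr_eq0 -/A; apply/eqP.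
apply: (@quad_rigid A (B * k ^+ 2)^* (g ^+ 2 / 2)) => V V'.
have [_] := lnS_min V (- (k * V'^*)) Uz Uw Szw; rewrite -/l fE fE' => h.
have : 0 <= 2 * (re (2^-1 * (q z * V ^+ 2 + (q' w * (- (k * V'^*)) ^+ 2)^*) -
      ((V / l) ^+ 2 + ((- - (k * V'^*) / l) ^+ 2)^*)) +
      ((g ^+ 2 * nm V ^+ 2 + g' ^+ 2 * nm (- (k * V'^*)) ^+ 2) / 4 +
       2 * re (V / l * (- (k * V'^*) / l)))) by rewrite mulr_ge0.
congr (0 <= _).
have kE : nm k = g / g'.
  rewrite /k nmM nm_real ger0_norm; last by rewrite !divr_ge0 ?sqr_ge0 ?ltW.
  by rewrite nmX; field; rewrite !gt_eqF.
have vv : V / l * (- (k * V'^*) / l) = - (g ^+ 2 / 4)%:C * (V * V'^*).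
  have -> : g ^+ 2 / 4 = g / g' / nm l ^+ 2 by rewrite -gg; field; rewrite !gt_eqF.
  rewrite /k; move: ((g / g' / nm l ^+ 2)%:C : C) => kk.
  by field.
rewrite vv nmN nmM nm_conj kE (mulNr (g ^+ 2 / 4)%:C) (reN ((g ^+ 2 / 4)%:C * (V * V'^*))) reZ.
have two : 2^-1%:C = 2^-1 :> C by rewrite rcV (_ : 2%:C = 2)// rcD.
have e1 : 2^-1 * (q z * V ^+ 2 + (q' w * (- (k * V'^*)) ^+ 2)^*) - ((V / l) ^+ 2 + ((- - (k * V'^*) / l) ^+ 2)^*) =
   2^-1%:C * (A * V ^+ 2 + (B * k ^+ 2)^* * V' ^+ 2).
  have -> : (q' w * (- (k * V'^*)) ^+ 2)^* = (q' w)^* * k^* ^+ 2 * V' ^+ 2.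
    by rewrite sqrrN; move: (k) => kk; rewrite cjM cjX cjM cjK; ring.
  have -> : ((- - (k * V'^*) / l) ^+ 2)^* = k^* ^+ 2 * V' ^+ 2 / l^* ^+ 2.
    by rewrite opprK; move: (k) (l) => kk ll; rewrite cjX !cjM cjV cjK !exprMn exprVn.
  have -> : (B * k ^+ 2)^* = ((q' w)^* - 2 / l^* ^+ 2) * k^* ^+ 2.
    rewrite /B pw cjM cjX cjB; congr ((_ - _) * _).
    have -> : (2 / l) ^+ 2 / 2 = 2%:C / l ^+ 2 by rewrite (_ : 2%:C = 2) ?rcD//; field.
    by rewrite cjM cjV cjX cj_rc (_ : 2%:C = 2)// rcD.
  rewrite /A pz two; move: (k^*) => kk; field; rewrite l0 -nm_gt0 nm_conj n0//.
rewrite e1 reZ nm_sqr (_ : nm (V - V') ^+ 2 = (re V - re V') ^+ 2 + (im V - im V') ^+ 2); last first.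
  by rewrite nm_sqr; case: (V) => a b; case: (V') => c d.
have -> : (g / g' * nm V') ^+ 2 = (g / g') ^+ 2 * (re V' ^+ 2 + im V' ^+ 2) by rewrite exprMn nm_sqr.
have -> : re (V * V'^*) = re V * re V' + im V * im V'.
  by case: (V) => a b; case: (V') => c d /=; ring.
by field; rewrite gt_eqF.
Qed.

End Equality.

(** * Closed bounded sets, attained minima and the barrier function *)

Section Extrema.
Variable R : realType.
Local Notation C := R[i].
Local Notation re := (@complex.Re R).
Local Notation im := (@complex.Im R).
Implicit Types (z w u v c : C) (A B : set C).

Definition cbd A : Prop := (exists M : R, forall u, A u -> nm u <= M) /\
  forall u, (forall e : R, 0 < e -> exists2 v, A v & nm (v - u) < e) -> A u.

Lemma cbd_ball c (r : R) : cbd [set z | nm (z - c) <= r].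
Proof.
split.
  exists (r + nm c) => u /= h; rewrite -(subrK c u); apply: (le_trans (nmD _ _)).
  by rewrite lerD2r.
move=> u h /=; apply/ler_addgt0Pr => e /h [v vr ve].
have := nm_tri u v c; rewrite (nmBC u v) => t; move: vr => /= vr; lra.
Qed.

Lemma cbd_sphere c (r : R) : cbd [set z | nm (z - c) = r].
Proof.
have [[M hM] cl] := cbd_ball c r; split.
  by exists M => u /= h; apply: hM; rewrite /= h.
move=> u h /=; apply/eqP; rewrite eq_le; apply/andP; split.
  by apply: cl => e /h [v /= vr ve]; exists v => //=; rewrite vr.
apply/ler_addgt0Pr => e /h [v /= vr ve].
have := nm_tri v u c; lra.
Qed.

Lemma cbdI A B : cbd A -> cbd B -> cbd (A `&` B).
Proof.
move=> [[M hM] cA] [_ cB]; split; first by exists M => u [/hM].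
by move=> u h; split; [apply: cA|apply: cB] => e /h [v [vA vB] ve]; exists v.
Qed.

Lemma cbd_compact A : cbd A -> compact [set x : R * R | A (cplx x)].
Proof. by move=> [[M hM] cA]; exact: ball_compact hM cA. Qed.

Lemma cC_cplx (x : R * R) : cC (fun y : R * R => cplx y) x.
Proof. by split; [exact: cvg_fst|exact: cvg_snd]. Qed.

Lemma cC_fst (x : R * R * (R * R)) : cC (fun y : R * R * (R * R) => cplx y.1) x.
Proof.
by split; [apply: (@continuous_comp _ _ _ fst (@fst R R))|apply: (@continuous_comp _ _ _ fst (@snd R R))];
  [exact: cvg_fst|exact: cvg_fst|exact: cvg_fst|exact: cvg_snd].
Qed.

Lemma cC_snd (x : R * R * (R * R)) : cC (fun y : R * R * (R * R) => cplx y.2) x.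
Proof.
by split; [apply: (@continuous_comp _ _ _ snd (@fst R R))|apply: (@continuous_comp _ _ _ snd (@snd R R))];
  [exact: cvg_snd|exact: cvg_fst|exact: cvg_snd|exact: cvg_snd].
Qed.

Lemma cC_cst (X : topologicalType) (x : X) c : cC (fun=> c) x.
Proof. by split; exact: cvg_cst. Qed.

Lemma cC_D1 (X : topologicalType) (x : X) (g : X -> C) F a b :
  D1 F (g x) a b -> cC g x -> cC (fun y => F (g y)) x.
Proof.
move=> D cg.
have key (e : R) : 0 < e -> \forall y \near x, nm (F (g y) - F (g x)) < e.
  move=> e0; have [d d0 h] := D1_cont D e0.
  by have := cC_near cg d0; apply: filterS => y yd; have := h _ yd; rewrite (addrC (g x)) subrK.
split; apply/cvgrPdist_lt => e /key; apply: filterS => y; rewrite nmBC; apply: le_lt_trans.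
  by rewrite -reB; exact: re_le.
by apply: le_trans (im_le _); case: (F (g x)); case: (F (g y)).
Qed.

Lemma cont_eps (F : C -> R) u (e : R) :
  continuous_at (re u, im u) (fun x : R * R => F (cplx x)) -> 0 < e ->
  exists2 d : R, 0 < d & forall v, nm (v - u) < d -> `|F v - F u| < e.
Proof.
move=> /cvgrPdist_lt h /h {h} /nbhs_ballP [d d0 h]; exists d => // v vd.
have := h (re v, im v); rewrite !cplx_inv distrC; apply.
rewrite nmBC in vd; split; apply: le_lt_trans vd.
  by have := re_le (u - v); rewrite reB.
by apply: le_trans (im_le _); case: (u); case: (v).
Qed.

Lemma evt2 A B (F : C -> C -> R) : cbd A -> cbd B ->
  (forall x : R * R * (R * R), A (cplx x.1) -> B (cplx x.2) ->
     continuous_at x (fun x => F (cplx x.1) (cplx x.2))) ->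
  (exists2 z, A z & exists w, B w) ->
  exists z w, [/\ A z, B w & forall z' w', A z' -> B w' -> F z w <= F z' w'].
Proof.
move=> cA cB cF [z0 Az0 [w0 Bw0]].
pose K : set (R * R * (R * R)) := [set x | A (cplx x)] `*` [set x | B (cplx x)].
have cK : compact K by apply: compact_setX; exact: cbd_compact.
have cFK : {within K, continuous (fun x : R * R * (R * R) => F (cplx x.1) (cplx x.2))}.
  by apply: continuous_in_subspaceT => x; rewrite inE => -[]; exact: cF.
have [|x] := compact_EVT_min _ cK cFK.
  by exists ((re z0, im z0), (re w0, im w0)); split; rewrite /= cplx_inv.
rewrite inE => -[Ax Bx] h; exists (cplx x.1), (cplx x.2); split => // z' w' Az' Bw'.
have := h ((re z', im z'), (re w', im w')); rewrite /= !cplx_inv; apply.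
by rewrite inE; split; rewrite /= cplx_inv.
Qed.

Lemma evt2_pos A B (F : C -> C -> R) : cbd A -> cbd B ->
  (forall x : R * R * (R * R), A (cplx x.1) -> B (cplx x.2) ->
     continuous_at x (fun x => F (cplx x.1) (cplx x.2))) ->
  (forall z w, A z -> B w -> 0 < F z w) ->
  exists2 m : R, 0 < m & forall z w, A z -> B w -> m <= F z w.
Proof.
move=> cA cB cF F0; case: (pselect (exists2 z, A z & exists w, B w)).
  move=> /(evt2 cA cB cF) [z [w [Az Bw h]]]; exists (F z w); first exact: F0.
  by move=> z' w'; exact: h.
by move=> n; exists 1 => // z w Az Bw; case: n; exists z => //; exists w.
Qed.

(** The usual barrier of Hopf's lemma: it is strictly subharmonic where al |l|^2 > 1. *)
Lemma barrier_J2 (al : R) (l V : C) : let E := expR (- al * nm l ^+ 2) in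
  exists beta : C, J2 (fun s => expR (- al * nm (l + s * V) ^+ 2)) E
    (- (E * al)%:C * (l^* * V)) beta
    (E * nm V ^+ 2 * (al ^+ 2 * nm l ^+ 2 - al)).
Proof.
move=> E.
have c0 : (0 : C)^* = 0 by rewrite -rc0 cj_rc.
have J := J2_exp _ (J2_scale (- al) (J2_normsq l V 0)).
have {}J := J _; eexists; apply: (J2_cast (J _)) => //.
- by rewrite mulr0 mul0r !addr0.
- by move=> s /=; rewrite mulr0 addr0.
- by rewrite c0 mulr0 addr0 -/E rcN rcM; ring.
rewrite -/E c0 mulr0 addr0 nm0 expr0n addr0 nmZ normrN nmM nm_conj.
rewrite exprMn real_normK ?num_real//; ring.
Qed.

End Extrema.

(** * Openness of the equality set *)

Section Hopf.
Variable R : realType.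
Local Notation C := R[i].
Local Notation re := (@complex.Re R).
Local Notation im := (@complex.Im R).
Implicit Types (z w h u v : C).

(** From al Rr^2 >= 8 and l >= Rr / 2 one gets al^2 l^2 - al >= al >= rho. So the barrier term is at
    least eps E, which beats (1 - 4/S) / 2. *)
Lemma hopf_numeric (al Rr l E eps nV rho S : R) : 0 < eps -> 0 < E -> 0 < Rr ->
  Rr / 2 <= l -> 0 < rho -> al = 8 / Rr ^+ 2 + rho -> 1 <= rho * nV ^+ 2 ->
  1 - 4 / S < eps * E ->
  -1 * ((1 + 1) / 4 - 2 / S) + eps * (E * nV ^+ 2 * (al ^+ 2 * l ^+ 2 - al)) <= 0 -> False.
Proof.
move=> e0 E0 R0 lR r0 alE rn hS hd.
have al0 : 0 < al by rewrite alE addr_gt0// divr_gt0// exprn_gt0.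
have l2 : Rr ^+ 2 / 4 <= l ^+ 2.
  rewrite (_ : Rr ^+ 2 / 4 = (Rr / 2) ^+ 2); last by field.
  by rewrite ler_sqr ?nnegrE// ?divr_ge0 ?(ltW R0)// (le_trans _ lR)// divr_ge0// ltW.
have aR : 8 <= al * Rr ^+ 2 by rewrite alE mulrDl divfK ?gt_eqF ?exprn_gt0// lerDl mulr_ge0 ?sqr_ge0// ltW.
have a1 : al <= al ^+ 2 * l ^+ 2 - al.
  have : al ^+ 2 * (Rr ^+ 2 / 4) <= al ^+ 2 * l ^+ 2 by rewrite ler_wpM2l ?sqr_ge0.
  have : 8 * al <= al * Rr ^+ 2 * al by rewrite ler_wpM2r// ltW.
  have -> : al ^+ 2 * (Rr ^+ 2 / 4) = al * Rr ^+ 2 * al / 4 by field.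
  lra.
have ra : rho <= al by rewrite alE lerDr divr_ge0// sqr_ge0.
have h1 : 1 <= nV ^+ 2 * (al ^+ 2 * l ^+ 2 - al).
  apply: (le_trans rn); rewrite mulrC ler_wpM2l ?sqr_ge0//; exact: le_trans ra a1.
have eE : 0 < eps * E by rewrite mulr_gt0.
have : eps * E <= eps * (E * nV ^+ 2 * (al ^+ 2 * l ^+ 2 - al)).
  rewrite (_ : eps * (E * _ * _) = eps * E * (nV ^+ 2 * (al ^+ 2 * l ^+ 2 - al))); last by ring.
  by rewrite ler_peMr// ltW.
move: hS hd; have -> : 2 / S = 4 / S / 2 by move: (S^-1) => x; rewrite mulrAC; congr (_ * _); field.
lra.
Qed.

Variables (U U' : set C) (f f' : C -> R) (p p' q q' : C -> C).
Hypotheses (H : hyp U f p q) (H' : hyp U' f' p' q').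
Hypothesis dis : forall z, U z -> U' z -> False.
Hypothesis S4 : forall z w, U z -> U' w -> 4 <= pairS f f' z w.

Let ne z w : U z -> U' w -> z != w.
Proof. by move=> Uz Uw; apply/negP => /eqP zw; apply: (dis Uz); rewrite zw. Qed.

Lemma hyp_ball (U0 : set C) (g : C -> R) a b z : hyp U0 g a b -> U0 z -> exists2 d : R, 0 < d &
  forall v, nm (v - z) <= d -> U0 v /\ g v <= g z + 1.
Proof.
move=> HH Uz; have [d d0 hd] := hyp_open HH Uz; have [d' d0' hd'] := hyp_fcont HH Uz ltr01.
exists (Num.min d d' / 2); first by rewrite divr_gt0// lt_min d0.
move=> v vz; have vz' : nm (v - z) < Num.min d d'.
  apply: (le_lt_trans vz); have : 0 < Num.min d d' by rewrite lt_min d0.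
  lra.
move: vz'; rewrite lt_min => /andP[v1 v2].
have := hd _ v1; have := hd' _ v2; rewrite !(addrC z) !subrK => h1 h2; split => //.
by have := ler_norm (g v - g z); lra.
Qed.

(** By [critical_w] the only possible partner of [z], so that equality becomes a condition on [z]
    alone. *)
Definition Wp z : C := z + 2 / p z.

Lemma Wp_D1 z : U z -> p z != 0 -> exists a b, D1 Wp z a b.
Proof.
move=> Uz pz; do 2 eexists.
exact: D1_add (D1_id z) (D1_mulc 2 (D1_inv (hyp_p H Uz) pz)).
Qed.

(** F = ln (S/4) is compared with eps times a barrier that is positive inside the disc. A negative
    minimum of the difference would be interior, and there 1 - 4/S <= ln (S/4) < eps E contradicts
    the second-order condition. So the difference is nonnegative and vanishes at (z2, w2), where the
    gradient of F is 0 but that of the barrier is not. *)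
Lemma hopf_touch z1 z2 w2 (Rr r0 : R) : U z2 -> U' w2 -> pairS f f' z2 w2 = 4 ->
  nm (z2 - z1) = Rr -> 0 < Rr -> 0 < r0 ->
  (forall z w, nm (z - z2) <= r0 -> U z -> U' w -> nm (z - z1) <= Rr ->
     pairS f f' z w = 4 -> z = z2) -> False.
Proof.
move=> Uz2 Uw2 S2 zR R0 r00 uniq.
have [r' r0' hr'] := hyp_ball H' Uw2.
have [d1 d10 hd1] := hyp_ball H Uz2.
have [pz w2E] := critical_w H H' dis S4 Uz2 Uw2 S2.
have [a [b DW]] := Wp_D1 Uz2 pz.
have [d2 d20 hd2] := D1_cont DW r0'.
(* Rr / 2 keeps the region away from the centre [z1], where the barrier is not subharmonic; d2 / 2
   keeps the partners [Wp z] within r' of [w2]. *)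
pose r := Num.min (Num.min r0 d1) (Num.min (d2 / 2) (Rr / 2)).
have rr : 0 < r by rewrite !lt_min r00 d10 !divr_gt0.
have [rr0 rd1 rd2 rR] : [/\ r <= r0, r <= d1, r <= d2 / 2 & r <= Rr / 2].
  by rewrite /r !ge_min !lexx ?orbT.
pose F z w := ln (pairS f f' z w) - ln 4.
pose rho := expR (f z2 + 1); pose al := 8 / Rr ^+ 2 + rho.
have rho0 : 0 < rho := expR_gt0 _.
have al0 : 0 < al by rewrite addr_gt0// divr_gt0// exprn_gt0.
have UU z : nm (z - z2) <= r -> U z by move=> h; apply: (hd1 z _).1; apply: le_trans rd1.
have UU' w : nm (w - w2) <= r' -> U' w by move=> h; apply: (hr' w _).1.
have F_cont (x : R * R * (R * R)) : nm (cplx x.1 - z2) <= r -> nm (cplx x.2 - w2) <= r' ->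
    continuous_at x (fun x => F (cplx x.1) (cplx x.2)).
  move=> /UU Ux /UU' Uw; apply: cvgB; last exact: cvg_cst.
  have c := @cont_pairS R _ f f' _ _ (fun x : R * R * (R * R) => cplx x.1)
    (fun x : R * R * (R * R) => cplx x.2) x (hyp_f H Ux) (hyp_f H' Uw) (cC_fst x) (cC_snd x).
  apply: (@continuous_comp _ _ _ (fun x : R * R * (R * R) => pairS f f' (cplx x.1) (cplx x.2)) (@ln R)) => //.
  by apply: continuous_ln; rewrite pairS_gt0// ne.
have F_ge0 z w : U z -> U' w -> 0 <= F z w.
  by move=> Uz Uw; rewrite subr_ge0 ler_ln ?posrE// ?pairS_gt0 ?ne// S4.
have F_gt0 z w : U z -> U' w -> pairS f f' z w != 4 -> 0 < F z w.
  move=> Uz Uw s; rewrite subr_gt0 ltr_ln ?posrE// ?pairS_gt0 ?ne//.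
  by rewrite lt_def s S4.
have z2w2 z w : nm (z - z2) <= r -> U' w -> pairS f f' z w = 4 -> nm (w - w2) < r'.
  move=> zr Uw sw; have [_ ->] := critical_w H H' dis S4 (UU _ zr) Uw sw.
  rewrite w2E -/(Wp z) -/(Wp z2).
  have := hd2 (z - z2); rewrite (addrC z2) subrK; apply; lra.
have [m1 m10 hm1] : exists2 m : R, 0 < m & forall z w, nm (z - z2) = r /\ nm (z - z1) <= Rr ->
    nm (w - w2) <= r' -> m <= F z w.
  apply: (@evt2_pos R [set z | nm (z - z2) = r /\ nm (z - z1) <= Rr] [set w | nm (w - w2) <= r']).
  - by apply: (cbdI (cbd_sphere z2 r)); exact: cbd_ball.
  - exact: cbd_ball.
  - by move=> x /= [xr _] xw; apply: F_cont => //; rewrite xr.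
  move=> z w /= [zr zR1] wr; have zr' : nm (z - z2) <= r by rewrite zr.
  apply: F_gt0; [exact: UU|exact: UU'|]; apply/eqP => s4.
  have zz : z = z2 by apply: (uniq z w) => //; [exact: le_trans rr0|exact: UU|exact: UU'].
  by move: rr; rewrite -zr zz subrr nm0 ltxx.
have [m2 m20 hm2] : exists2 m : R, 0 < m & forall z w, nm (z - z2) <= r ->
    nm (w - w2) = r' -> m <= F z w.
  apply: (@evt2_pos R [set z | nm (z - z2) <= r] [set w | nm (w - w2) = r']).
  - exact: cbd_ball.
  - exact: cbd_sphere.
  - by move=> x /= xr xw; apply: F_cont => //; rewrite xw.
  move=> z w /= zr wr; have wr' : nm (w - w2) <= r' by rewrite wr.
  apply: F_gt0; [exact: UU|exact: UU'|]; apply/eqP => s4.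
  by have := z2w2 z w zr (UU' _ wr') s4; rewrite wr ltxx.
pose eps := Num.min m1 m2 / 2.
have eps0 : 0 < eps by rewrite divr_gt0// lt_min m10.
have em1 : eps < m1.
  have : Num.min m1 m2 <= m1 by rewrite ge_min lexx.
  rewrite /eps; move: eps0; rewrite /eps; lra.
have em2 : eps < m2.
  have : Num.min m1 m2 <= m2 by rewrite ge_min lexx orbT.
  rewrite /eps; move: eps0; rewrite /eps; lra.
pose be z := expR (- al * nm (z - z1) ^+ 2) - expR (- al * Rr ^+ 2).
have be_lt1 z : be z < 1.
  have : expR (- al * nm (z - z1) ^+ 2) <= 1.
    by rewrite -[leRHS]expR0 ler_expR mulNr oppr_le0 mulr_ge0 ?sqr_ge0// ltW.
  by have := expR_gt0 (- al * Rr ^+ 2); rewrite /be; lra.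
have be_gt0 z : 0 < be z -> nm (z - z1) < Rr.
  rewrite subr_gt0 ltr_expR !mulNr ltrN2 ltr_pM2l// ltr_sqr ?nnegrE ?nm_ge0//.
  exact: ltW.
pose Phi z w := F z w - eps * be z.
have [z3 [w3 [z3r w3r hmin]]] : exists z3 w3, [/\ nm (z3 - z2) <= r, nm (w3 - w2) <= r' &
   forall z w, nm (z - z2) <= r -> nm (w - w2) <= r' -> Phi z3 w3 <= Phi z w].
  apply: (@evt2 R [set z | nm (z - z2) <= r] [set w | nm (w - w2) <= r']).
  - exact: cbd_ball.
  - exact: cbd_ball.
  - move=> x /= xr xw; apply: cvgB; first exact: F_cont.
    apply: cvgM; first exact: cvg_cst.
    apply: cvgB; last exact: cvg_cst.
    apply: (@cont_exp R _ (fun x : R * R * (R * R) => - al * nm (cplx x.1 - z1) ^+ 2)).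
    apply: cvgM; first exact: cvg_cst.
    exact: (cC_normsq (cC_fst x) (cC_cst x z1)).
  by exists z2; [rewrite /= subrr nm0 ltW|exists w2; rewrite /= subrr nm0 ltW].
have Uz3 := UU _ z3r; have Uw3 := UU' _ w3r.
have [neg|pos] := ltP (Phi z3 w3) 0.
  have F3 := F_ge0 _ _ Uz3 Uw3.
  have b3 : 0 < be z3.
    rewrite ltNge; apply/negP => b0; have : eps * be z3 <= 0 by rewrite pmulr_rle0.
    by move: neg; rewrite /Phi; lra.
  have z3R := be_gt0 _ b3.
  have eb : eps * be z3 < eps by rewrite gtr_pMr.
  have z3r1 : nm (z3 - z2) < r.
    rewrite lt_neqAle z3r andbT; apply/negP => /eqP e.
    have := hm1 z3 w3 (conj e (ltW z3R)) w3r; move: neg; rewrite /Phi; lra.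
  have w3r1 : nm (w3 - w2) < r'.
    rewrite lt_neqAle w3r andbT; apply/negP => /eqP e.
    have := hm2 z3 w3 z3r e; move: neg; rewrite /Phi; lra.
  have [V [W [V1 W1 VW]]] := good_dirs f f' (ne Uz3 Uw3).
  have [beta Jb] := barrier_J2 al (z3 - z1) V.
  have J := J2_add (J2_scale (-1) (pairS_J2 V W H H' Uz3 Uw3 (ne Uz3 Uw3))) (J2_scale eps Jb).
  pose D := Num.min (r - nm (z3 - z2)) (r' - nm (w3 - w2)) / (nm V + nm W + 1).
  have K0 : 0 < nm V + nm W + 1 by rewrite ltr_wpDl// addr_ge0 ?nm_ge0.
  have D0 : 0 < D by rewrite divr_gt0// lt_min !subr_gt0 z3r1.
  have := J2_max_d D0 J; rewrite V1 W1 VW => hd.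
  apply: (@hopf_numeric al Rr (nm (z3 - z1)) (expR (- al * nm (z3 - z1) ^+ 2)) eps (nm V) rho (pairS f f' z3 w3)) => //.
  - exact: expR_gt0.
  - have := nm_tri z2 z3 z1; rewrite zR (nmBC z2 z3); lra.
  - rewrite -V1 ler_wpM2r ?sqr_ge0// ler_expR.
    by have [] := hd1 z3 (le_trans z3r rd1).
  - have S3 := pairS_gt0 f f' (ne Uz3 Uw3).
    have := @le_ln1Dx R (4 / pairS f f' z3 w3 - 1).
    rewrite (addrC 1) subrK ln_div ?posrE// => /(_ _).
    have S3' : 0 < 4 / pairS f f' z3 w3 by rewrite divr_gt0.
    have h1 : -1 < 4 / pairS f f' z3 w3 - 1 by lra.
    move=> /(_ h1).
    have : eps * be z3 <= eps * expR (- al * nm (z3 - z1) ^+ 2).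
      by apply: (ler_wpM2l (ltW eps0)); rewrite /be gerBl expR_ge0.
    move: neg; rewrite /Phi /F; lra.
  apply: hd => s; rewrite ltr_pdivlMr// lt_min => /andP[s1 s2].
  have := hmin (z3 + s * V) (w3 + s^* * W); rewrite /Phi /F /be.
  rewrite (_ : z3 + s * V - z1 = z3 - z1 + s * V); last by ring.
  have b1 : nm (z3 + s * V - z2) <= r.
    rewrite addrAC (le_trans (nmD _ _))// nmM -lerBrDl (le_trans _ (ltW s1))//.
    by rewrite ler_wpM2l ?nm_ge0// -addrA lerDl addr_ge0 ?nm_ge0.
  have b2 : nm (w3 + s^* * W - w2) <= r'.
    rewrite addrAC (le_trans (nmD _ _))// nmM nm_conj -lerBrDl (le_trans _ (ltW s2))//.
    by rewrite ler_wpM2l ?nm_ge0// [nm V + _]addrC -addrA lerDl addr_ge0 ?nm_ge0.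
  move=> /(_ b1 b2); lra.
have [beta Jb] := barrier_J2 al (z2 - z1) 1.
have J := J2_add (J2_scale (-1) (pairS_J2 1 0 H H' Uz2 Uw2 (ne Uz2 Uw2))) (J2_scale eps Jb).
have [|b0 _] := J2_max rr J.
  move=> s sr; have := hmin (z2 + s * 1) (w2 + s^* * 0).
  have b1 : nm (z2 + s * 1 - z2) <= r by rewrite mulr1 addrC addKr ltW.
  have b2 : nm (w2 + s^* * 0 - w2) <= r' by rewrite mulr0 addr0 subrr nm0 ltW.
  move=> /(_ b1 b2); rewrite /Phi /F /be S2 zR.
  rewrite (_ : z2 + s * 1 - z1 = z2 - z1 + s * 1); last by ring.
  move: pos; rewrite /Phi /F /be; lra.
move: b0; have [-> _] := lnS_min H H' dis S4 1 0 Uz2 Uw2 S2.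
rewrite mulr0 add0r mulr1 => /eqP; apply/negP.
rewrite -nm_eq0 nmM nmM nmN !nm_real nm_conj zR.
have E0 : 0 < expR (- al * Rr ^+ 2) := expR_gt0 _.
rewrite (gtr0_norm eps0) (gtr0_norm (mulr_gt0 E0 al0)) gt_eqF//.
exact: mulr_gt0 eps0 (mulr_gt0 (mulr_gt0 E0 al0) R0).
Qed.

(* Hopf's lemma, where a disc free of equality touches the equality set. *)
Lemma equality_open z0 w0 : U z0 -> U' w0 -> pairS f f' z0 w0 = 4 ->
  exists2 d : R, 0 < d & forall z, nm (z - z0) < d ->
    [/\ U z, p z != 0, U' (Wp z) & pairS f f' z (Wp z) = 4].
Proof.
move=> Uz0 Uw0 S0.
have [pz w0E] := critical_w H H' dis S4 Uz0 Uw0 S0.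
have [a [b DW]] := Wp_D1 Uz0 pz.
have [d1 d10 hd1] := hyp_ball H Uz0.
have [d2 d20 hd2] := D1_cont (hyp_p H Uz0) (etrans (nm_gt0 _) pz).
have [r' r0' hr'] := hyp_ball H' Uw0.
have [d3 d30 hd3] := D1_cont DW r0'.
pose d := Num.min d1 (Num.min d2 d3).
have d0 : 0 < d by rewrite !lt_min d10 d20.
have near z : nm (z - z0) < d -> [/\ U z, p z != 0 & U' (Wp z)].
  rewrite !lt_min => /and3P[h1 h2 h3]; split.
  - by apply: (hd1 z _).1; exact: ltW.
  - have := hd2 _ h2; rewrite (addrC z0) subrK.
    by apply: contraTneq => ->; rewrite sub0r nmN ltxx.
  by apply: (hr' _ _).1; rewrite w0E; have := hd3 _ h3; rewrite (addrC z0) subrK => /ltW.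
exists (d / 2); first by rewrite divr_gt0.
move=> z' zd.
have zd' : nm (z' - z0) < d by lra.
have [Uz' pz' Uw'] := near _ zd'; split => //.
apply/eqP/negPn/negP => /eqP n4.
pose rho := nm (z' - z0).
pose G z := pairS f f' z (Wp z).
have ball_d z : nm (z - z') <= rho -> nm (z - z0) < d.
  move=> h; apply: le_lt_trans (nm_tri z z' z0) _.
  by rewrite /rho in h *; lra.
have cG (x : R * R) : nm (cplx x - z0) < d -> continuous_at x (fun x => G (cplx x)).
  move=> xd; have [Ux px Uwx] := near _ xd.
  have [a' [b' D']] := Wp_D1 Ux px.
  apply: (@cont_pairS R _ f f' _ _ (fun x : R * R => cplx x) (fun x : R * R => Wp (cplx x)) x
    (hyp_f H Ux) (hyp_f H' Uwx) (cC_cplx x)).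
  exact: cC_D1 D' (cC_cplx x).
have cK : cbd [set z | nm (z - z') <= rho /\ G z = 4].
  split; first by have [[M hM] _] := cbd_ball z' rho; exists M => u [/hM].
  move=> u hu; have ur : nm (u - z') <= rho.
    by apply: (cbd_ball z' rho).2 => e /hu [v [vr _] ve]; exists v.
  split => //; apply/eqP/negPn/negP => /eqP G4.
  have e0 : 0 < `|G u - 4| by rewrite normr_gt0 subr_eq0; apply/eqP.
  have [|e e1 he] := @cont_eps R G u _ _ e0.
    by apply: cG; rewrite cplx_inv; exact: ball_d.
  have [v [_ v4] vu] := hu e e1.
  by have := he v vu; rewrite v4 distrC ltxx.
(* The equality point nearest to [z']. The singleton of 0 is a dummy second factor, since [evt2]
   minimises over pairs. *)
have [z2 [w2 [[z2r G2] _ hmin]]] : exists z w, [/\ nm (z - z') <= rho /\ G z = 4, w = 0 :> C &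
    forall u v, nm (u - z') <= rho /\ G u = 4 -> v = 0 :> C -> nm (z - z') ^+ 2 <= nm (u - z') ^+ 2].
  apply: (@evt2 R [set z | nm (z - z') <= rho /\ G z = 4] [set 0 : C]
            (fun z _ => nm (z - z') ^+ 2) cK).
  - split; first by exists 0 => u /= ->; rewrite nm0.
    move=> u h; apply/eqP; rewrite -nm_eq0 eq_le nm_ge0 andbT.
    apply/ler_addgt0Pr => e /h [v /= ->]; rewrite sub0r nmN add0r; exact: ltW.
  - by move=> x _ _; exact: (cC_normsq (cC_fst x) (cC_cst x z')).
  exists z0; last by exists 0.
  by split; rewrite /= ?(nmBC z0)// /G /Wp -w0E.
have {}hmin u : nm (u - z') <= nm (z2 - z') -> G u = 4 -> nm (u - z') = nm (z2 - z').
  move=> h1 h2; apply/eqP; rewrite eq_le h1 -ler_sqr ?nnegrE ?nm_ge0//.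
  by apply: (hmin u 0) => //; split => //; exact: le_trans z2r.
have z2z : z2 != z' by apply/eqP => e; apply: n4; rewrite -e.
have [Uz2 pz2 Uw2] := near _ (ball_d _ z2r).
(* The disc around [z'] may carry several nearest equality points on its boundary. The disc of half
   the radius, internally tangent at [z2], meets the equality set only there; the parallelogram
   identity [par] gives this uniqueness. *)
pose z1 := (z' + z2) / 2; pose c := (z2 - z') / 2.
have c0 : 0 < nm c.
  by rewrite nm_gt0 mulf_neq0 ?subr_eq0// invr_eq0 -nm_gt0 nm2.
have z21 : z2 - z1 = c by rewrite /c /z1; field.
have z11 : z1 - z' = c by rewrite /c /z1; field.
have z2c : nm (z2 - z') = 2 * nm c by rewrite -nm2 -nmM /c; congr nm; field.
apply: (@hopf_touch z1 z2 (Wp z2) (nm c) 1 Uz2 Uw2 G2 _ c0 ltr01); first by rewrite z21.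
move=> z w _ Uz Uw zc s4.
have zz' : nm (z - z') <= nm (z2 - z').
  by rewrite (le_trans (nm_tri z z1 z'))// z11 z2c; lra.
have wE : w = Wp z by have [_] := critical_w H H' dis S4 Uz Uw s4.
have := hmin z zz'; rewrite /G -wE => /(_ s4).
rewrite z2c => e; apply/eqP; rewrite -subr_eq0 -nm_eq0 -sqrf_eq0.
have par (a1 b1 : C) : nm (a1 - b1) ^+ 2 = 2 * nm a1 ^+ 2 + 2 * nm b1 ^+ 2 - nm (a1 + b1) ^+ 2.
  by rewrite !nm_sqr; case: (a1) => x y; case: (b1) => x1 y1 /=; ring.
rewrite (_ : z - z2 = (z - z1) - c); last by rewrite -z21; ring.
rewrite par (_ : z - z1 + c = z - z'); last by rewrite -z11; ring.
have z1c : nm (z - z1) ^+ 2 <= nm c ^+ 2 by rewrite ler_sqr ?nnegrE ?nm_ge0.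
rewrite e eq_le; apply/andP; split; first by rewrite exprMn; lra.
by rewrite -e (_ : z - z' = z - z1 + c) -?par ?sqr_ge0// -z11; ring.
Qed.

End Hopf.

(** * Metrics given by a Hermitian form *)

Section Round.
Variable R : realType.
Local Notation C := R[i].
Local Notation re := (@complex.Re R).
Local Notation im := (@complex.Im R).
Implicit Types (z w h u v b : C).

Lemma real_nz (x : R) : x != 0 -> x%:C != 0 :> C.
Proof. by rewrite -rc0 (inj_eq (@rc_inj R)). Qed.

Lemma D1_zero_cst F z0 (d : R) : (forall z, nm (z - z0) < d -> D1 F z 0 0) ->
  forall z, nm (z - z0) < d -> F z = F z0.
Proof.
move=> h z zd; apply/eqP; rewrite -subr_eq0 -nm_eq0 eq_le nm_ge0 andbT.
have := @D1_mvt R F z0 (z - z0) (fun=> 0) (fun=> 0) 0.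
rewrite (addrC z0) subrK !mulr0 mul0r; apply => t /andP[t0 t1]; rewrite nm0 addr0 lexx; split => //.
apply: h; rewrite addrAC subrr add0r nmZ ger0_norm// (le_lt_trans _ zd)//.
by rewrite ler_piMl ?nm_ge0.
Qed.

Lemma exp_half_DR (g : C -> R) z a : DR g z a ->
  DR (fun x => expR (- (g x / 2))) z ((- (expR (- (g z / 2)) / 2))%:C * a).
Proof.
move=> D; apply: (@DR_comp R (fun x => expR (- (x / 2)))) => //.
apply: is_derive_eq.
by rewrite !scaler0 add0r /GRing.scale /= mulr1 mulrN.
Qed.

Lemma D1_zero_lim F z a b : D1 F z a b ->
  (forall e : R, 0 < e -> exists2 v, nm (v - z) < e & F v = 0) -> F z = 0.
Proof.
move=> D lim; apply/eqP/negPn/negP; rewrite -nm_gt0 => n0.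
have [d d0 h] := D1_cont D n0; have [v vd v0] := lim d d0.
by have := h _ vd; rewrite (addrC z) subrK v0 sub0r nmN ltxx.
Qed.

(* hform is the candidate for e^(-f/2), hpol its z-derivative and refl the
   reflection in the circle where it vanishes. *)
Definition hform (al : R) b (c : R) z : R := al * nm z ^+ 2 + 2 * re (b * z) + c.
Definition hpol (al : R) b z : C := al%:C * z^* + b.
Definition refl (al : R) b (c : R) z : C := - (b^* * z^* + c%:C) / hpol al b z.

Lemma form_DR (al : R) b (c : R) z : DR (hform al b c) z (hpol al b z).
Proof.
apply/DR_small; apply: (@small_powS R 1 _ `|al| 1 ltr01) => h _.
suff -> : hform al b c (z + h) - hform al b c z - 2 * re (hpol al b z * h) = al * nm h ^+ 2.
  by rewrite normrM (ger0_norm (sqr_ge0 _)).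
rewrite /hform /hpol !nm_sqr; case: (z) => a1 a2; case: h => h1' h2; case: (b) => b1 b2 /=. ring.
Qed.

Lemma polar_D1 (al : R) b z : D1 (hpol al b) z 0 al%:C.
Proof.
have D := D1_add (D1_mulc al%:C (D1_conj (D1_id z))) (D1_holo_cst b z).
apply: (@D1_eq R _ _ _ _ _ 1 ltr01 _ (eq_ind _ (D1 _ z ^~ _) (eq_ind _ (D1 _ z _) D _ _) _ _)) => //.
  by rewrite -rc1 cj_rc rc1 mulr1 addr0.
by rewrite -rc0 cj_rc rc0 mulr0 addr0.
Qed.

Lemma refl_D1 (al : R) b (c : R) z : hpol al b z != 0 -> exists A B, D1 (refl al b c) z A B.
Proof.
move=> P0; do 2 eexists.
apply: (D1_mul (F := fun z => - (b^* * z^* + c%:C))).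
  apply: (@D1_eq R (fun z => -1 * (b^* * z^* + c%:C)) _ _ _ _ 1 ltr01); first by move=> h _; rewrite mulN1r.
  exact: D1_mulc (D1_add (D1_mulc _ (D1_conj (D1_id z))) (D1_holo_cst _ z)).
exact: D1_inv (polar_D1 al b z) P0.
Qed.

(** The curvature equation for y = e^(-f/2), with t = y and P0 = y_z: it reads y times y_{z conj z}
    = |y_z|^2 - 1/4. *)
Lemma AL_identity (P0 pz : C) (t : R) : t != 0 -> pz = - (2 * P0 / t%:C) ->
  - (2^-1) * (P0^* * pz + t%:C * (t^-1 ^+ 2 / 2)%:C) = ((nm P0 ^+ 2 - 4^-1) / t)%:C.
Proof.
move=> t0 ->; have two : 2%:C = 2 :> C by rewrite rcD.
have -> : - (2^-1) = (- 2^-1)%:C :> C by rewrite rcN rcV two.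
have -> : P0^* * - (2 * P0 / t%:C) = (- (2 * nm P0 ^+ 2 / t))%:C.
  rewrite rcN rcM rcV (rcM 2) -mul_conj two.
  by have := real_nz t0; move: (t%:C : C) => x x0; field.
by rewrite -rcM -rcD -rcM; congr _%:C; field.
Qed.

Variables (U U' : set C) (f f' : C -> R) (p p' q q' : C -> C).

(** The equation for [p] is p = - 2 y_z / y for y = e^(-f/2). The last one is S = 4 solved for
    e^(f'/2), given e^(f/2) = 1/Y and |z - w| = Y / |P|. *)
Definition good (al : R) b (c : R) z := [/\ U z, expR (- (f z / 2)) = hform al b c z,
  p z * (hform al b c z)%:C = - 2 * hpol al b z, hpol al b z != 0 & U' (refl al b c z) /\
  expR (f' (refl al b c z) / 2) = 4 * nm (hpol al b z) ^+ 2 / hform al b c z].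

Lemma formC (al : R) b (c : R) z :
  (hform al b c z)%:C = al%:C * z * z^* + b * z + b^* * z^* + c%:C.
Proof.
rewrite /hform !rcD (rcM 2) -(mulrA al%:C) mul_conj !rcM -addrA -[RHS]addrA -[RHS]addrA.
by congr (_ + _); rewrite addrA; congr (_ + _); rewrite -rcM -add_conj cjM.
Qed.

(** The normalisation |b|^2 - al c = 1/4 expresses that |dz|^2 / Y^2 has curvature -1. *)
Lemma form_polar (al : R) b (c : R) z : nm b ^+ 2 - al * c = 4^-1 ->
  nm (hpol al b z) ^+ 2 - 4^-1 = al * hform al b c z.
Proof.
move=> rel; rewrite -rel; apply: rc_inj; rewrite rcB rcB rcM rcM formC -!mul_conj /hpol.
rewrite cjD cjM cjK cj_rc; ring.
Qed.

Lemma refl_sub (al : R) b (c : R) z : hpol al b z != 0 ->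
  z - refl al b c z = (hform al b c z)%:C / hpol al b z.
Proof.
move=> P0; rewrite formC /refl; move: P0; rewrite /hpol; set P := _ + _ => P0.
by apply: (mulIf P0); rewrite mulrBl !divfK// /P; ring.
Qed.

Lemma nm_refl_sub (al : R) b (c : R) z z' : nm b ^+ 2 - al * c = 4^-1 ->
  hpol al b z != 0 -> hpol al b z' != 0 ->
  nm (refl al b c z - refl al b c z') = nm (z - z') / (4 * nm (hpol al b z) * nm (hpol al b z')).
Proof.
move=> rel P0 P0'.
have -> : refl al b c z - refl al b c z' = - ((4^-1)%:C * (z - z')^*) / (hpol al b z * hpol al b z').
  have relC : (4^-1)%:C = b * b^* - al%:C * c%:C by rewrite -rel rcB rcM mul_conj.
  apply: (mulIf (mulf_neq0 P0 P0')); rewrite divfK ?mulf_neq0// /refl.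
  transitivity (- (b^* * z^* + c%:C) * hpol al b z' + (b^* * z'^* + c%:C) * hpol al b z).
    by field; rewrite P0 P0'.
  by rewrite relC cjB /hpol; ring.
rewrite nmM nmN nmZ nm_conj nmV nmM ger0_norm//.
by field; rewrite !nm_eq0 P0 P0'.
Qed.

Hypotheses (H : hyp U f p q) (H' : hyp U' f' p' q').
Hypothesis dis : forall z, U z -> U' z -> False.
Hypothesis S4 : forall z w, U z -> U' w -> 4 <= pairS f f' z w.

Section Good.
Variables (al : R) (b : C) (c : R).
Hypothesis rel : nm b ^+ 2 - al * c = 4^-1.
Local Notation Y := (hform al b c).
Local Notation P := (hpol al b).
Local Notation Rf := (refl al b c).

Lemma pairS_refl z : P z != 0 -> expR (- (f z / 2)) = Y z ->
  expR (f' (Rf z) / 2) = 4 * nm (P z) ^+ 2 / Y z -> pairS f f' z (Rf z) = 4.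
Proof.
move=> P0 y0 e; have Y0 : 0 < Y z by rewrite -y0 expR_gt0.
rewrite /pairS mulrDl expRD e refl_sub// nmM nmV nm_real gtr0_norm//.
have -> : expR (f z / 2) = (Y z)^-1 by rewrite -y0 -expRN opprK.
by field; rewrite nm_eq0 P0 gt_eqF.
Qed.

Lemma good_S z : good al b c z -> pairS f f' z (Rf z) = 4.
Proof. by move=> [Uz y0 _ P0 [_ e]]; exact: pairS_refl. Qed.

Lemma good_pos z : good al b c z -> 0 < Y z.
Proof. by move=> [_ <- _ _ _]; exact: expR_gt0. Qed.

Lemma good_eq z : U z -> U' (Rf z) -> P z != 0 -> expR (- (f z / 2)) = Y z ->
  pairS f f' z (Rf z) = 4 -> good al b c z.
Proof.
move=> Uz Uw P0 y0 s4; have Y0 : 0 < Y z by rewrite -y0 expR_gt0.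
have nP : 0 < nm (P z) by rewrite nm_gt0.
split => //.
  have [-> _] := critical H H' dis S4 Uz Uw s4.
  rewrite refl_sub// invf_div mulrA divfK//; exact: real_nz (lt0r_neq0 Y0).
split => //; move: s4; rewrite /pairS mulrDl expRD.
have -> : expR (f z / 2) = (Y z)^-1 by rewrite -y0 -expRN opprK.
rewrite refl_sub// nmM nmV nm_real gtr0_norm// => <-.
by field; rewrite !gt_eqF.
Qed.

(** The equations for [f] and [f'] are vanishing conditions on functions differentiable at [z],
    hence pass to the limit. They give S = 4, and the equation for [p] then comes from
    [critical]. *)
Lemma good_lim z : U z -> U' (Rf z) -> 0 < Y z -> P z != 0 ->
  (forall e : R, 0 < e -> exists2 v, nm (v - z) < e & good al b c v) -> good al b c z.
Proof.
move=> Uz Uw Y0 P0 lim.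
have fE : expR (- (f z / 2)) = Y z.
  apply/eqP; rewrite -subr_eq0 -(inj_eq (@rc_inj R)) rcB; apply/eqP.
  have D := D1_add (exp_half_DR (hyp_f H Uz)) (D1_mulc (-1) (form_DR al b c z)).
  rewrite -[- (Y z)%:C]mulN1r; apply: (D1_zero_lim D) => e /lim [v vz [_ fv _ _ _]]; exists v => //.
  by rewrite fv mulN1r subrr.
have gE : expR (- (f' (Rf z) / 2)) * (4 * nm (P z) ^+ 2) - Y z = 0.
  apply: rc_inj; rewrite rcB rcM (rcM 4) -mul_conj -[- (Y z)%:C]mulN1r.
  have [A [B DRf]] := refl_D1 c P0.
  have D := D1_comp (exp_half_DR (hyp_f H' Uw)) DRf.
  have DP := D1_mulc 4%:C (D1_mul (polar_D1 al b z) (D1_conj (polar_D1 al b z))).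
  apply: (D1_zero_lim (D1_add (D1_mul D DP) (D1_mulc (-1) (form_DR al b c z)))) => e /lim [v vz gv].
  exists v => //=; have Yv := good_pos gv; have [_ _ _ Pv [_ e1]] := gv.
  rewrite mul_conj -rcM -rcM mulN1r -rcB expRN e1 -rc0; congr _%:C.
  by field; rewrite nm_eq0 Pv gt_eqF.
apply: good_eq => //; apply: pairS_refl => //.
apply: (mulIf (lt0r_neq0 (expR_gt0 (- (f' (Rf z) / 2))))).
rewrite -expRD subrr expR0 mulrC mulrA; move/eqP: gE; rewrite subr_eq0 => /eqP ->.
by rewrite divff// gt_eqF.
Qed.

End Good.

(** With y = e^(-f/2) and [PP] = y_z, the numbers [AL], [BB], [CC] are the coefficients of the form
    that agrees with y at [z] in value, gradient and mixed second derivative; the latter is [AL], by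
    the curvature equation. *)
Let yy z : R := expR (- (f z / 2)).
Let PP z : C := (- (yy z / 2))%:C * p z.
Let AL z : R := (nm (PP z) ^+ 2 - 4^-1) / yy z.
Let BB z : C := PP z - (AL z)%:C * z^*.
Let CC z : R := yy z - AL z * nm z ^+ 2 - 2 * re (BB z * z).

Lemma good_coef al b c z : nm b ^+ 2 - al * c = 4^-1 -> good al b c z -> [/\ AL z = al, BB z = b & CC z = c].
Proof.
move=> rel gz; have Y0 := good_pos gz; have [Uz y0 pY P0 _] := gz.
have yE : yy z = hform al b c z by [].
have PE : PP z = hpol al b z.
  rewrite /PP yE rcN mulNr mulrC rcM mulrA pY rcV (_ : 2%:C = 2) ?rcD//.
  by field.
have AE : AL z = al.
  by rewrite /AL PE (form_polar z rel) yE mulfK// gt_eqF.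
have BE : BB z = b by rewrite /BB PE AE /hpol addrC addKr.
by split => //; rewrite /CC yE AE BE /hform; ring.
Qed.

Lemma coef_good z : U z -> p z != 0 -> U' (Wp p z) -> pairS f f' z (Wp p z) = 4 ->
  nm (BB z) ^+ 2 - AL z * CC z = 4^-1 /\ good (AL z) (BB z) (CC z) z.
Proof.
move=> Uz pz Uw s4; have y0 : 0 < yy z := expR_gt0 _.
have FE : hform (AL z) (BB z) (CC z) z = yy z by rewrite /hform /CC; ring.
have PE : hpol (AL z) (BB z) z = PP z by rewrite /hpol /BB addrC subrK.
have P0 : PP z != 0.
  by rewrite mulf_neq0// real_nz// oppr_eq0 mulf_neq0// ?gt_eqF.
have RE : refl (AL z) (BB z) (CC z) z = Wp p z.
  have := @refl_sub (AL z) (BB z) (CC z) z; rewrite PE FE => /(_ P0) e.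
  have -> : refl (AL z) (BB z) (CC z) z = z - (z - refl (AL z) (BB z) (CC z) z) by ring.
  rewrite e /Wp /PP; congr (_ + _); rewrite rcN rcM rcV (_ : 2%:C = 2) ?rcD//.
  by move: (real_nz (lt0r_neq0 y0)); move: ((yy z)%:C : C) => t t0; field; rewrite t0 pz.
split.
  have relz : nm (hpol (AL z) (BB z) z) ^+ 2 - AL z * hform (AL z) (BB z) (CC z) z =
      nm (BB z) ^+ 2 - AL z * CC z.
    apply: rc_inj; rewrite rcB (rcB (nm (BB z) ^+ 2)) rcM rcM formC -!mul_conj /hpol.
    by rewrite cjD cjM cjK cj_rc; ring.
  by rewrite -relz PE FE /AL; field; rewrite gt_eqF.
by apply: good_eq; rewrite ?RE ?PE ?FE.
Qed.

(** q = p^2/2 says that y_zz = 0, so the only derivative of y_z is the antiholomorphic one, [AL].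
    Differentiating the definitions of the three coefficients then gives 0. *)
Lemma coef_D1 z : U z -> q z = p z ^+ 2 / 2 ->
  [/\ D1 (fun x => (AL x)%:C) z 0 0, D1 BB z 0 0 & D1 (fun x => (CC x)%:C) z 0 0].
Proof.
move=> Uz qE; have y0 : 0 < yy z := expR_gt0 _.
have y0C := real_nz (lt0r_neq0 y0).
have n2 : (2 : C) != 0 by rewrite -nm_gt0 nm2.
have two : 2%:C = 2 :> C by rewrite rcD.
have PE : PP z = - ((yy z)%:C * p z / 2) by rewrite /PP rcN rcM rcV two; ring.
have Dy : D1 (fun x => (yy x)%:C) z (PP z) (PP z)^* by exact: exp_half_DR (hyp_f H Uz).
have DP : D1 PP z 0 (AL z)%:C.
  have D0 : D1 (fun x => - (2^-1) * ((yy x)%:C * p x)) z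
       (- (2^-1) * (PP z * p z + (yy z)%:C * q z))
       (- (2^-1) * ((PP z)^* * p z + (yy z)%:C * (expR (f z) / 2)%:C)).
    exact: D1_mulc (D1_mul Dy (hyp_p H Uz)).
  apply: (@D1_eq R (fun x => - (2^-1) * ((yy x)%:C * p x)) _ _ _ _ 1 ltr01).
    by move=> h _; rewrite /PP rcN rcM rcV two; ring.
  have e1 : - (2^-1) * (PP z * p z + (yy z)%:C * q z) = 0 by rewrite PE qE; field.
  suff e2 : - (2^-1) * ((PP z)^* * p z + (yy z)%:C * (expR (f z) / 2)%:C) = (AL z)%:C.
    by rewrite -e1 -e2.
  have ef : expR (f z) = (yy z)^-1 ^+ 2.
    by rewrite /yy -expRN expr2 -expRD; congr expR; field.
  by rewrite ef; apply: AL_identity; rewrite ?gt_eqF// PE; move: y0C; move: ((yy z)%:C : C) => t t0; field.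
have c0 : (0 : C)^* = 0 by rewrite -rc0 cj_rc.
have DA : D1 (fun x => (AL x)%:C) z 0 0.
  have D0 := D1_mul (D1_add (D1_mul DP (D1_conj DP)) (D1_holo_cst (- 4^-1%:C) z)) (D1_inv Dy y0C).
  apply: (@D1_eq R _ _ _ _ _ 1 ltr01 _ (eq_ind _ (D1 _ z ^~ _) (eq_ind _ (D1 _ z _) D0 _ _) _ _)).
  - by move=> h _; rewrite /AL rcM rcB (rcV (yy _)) -mul_conj.
  - rewrite ?c0 ?(cj_rc (AL z)) /AL rcM rcB (rcV (yy z)) -mul_conj.
    by move: y0C; move: ((yy z)%:C : C) (4^-1%:C : C) => t k t0; field.
  rewrite ?c0 ?(cj_rc (AL z)) /AL rcM rcB (rcV (yy z)) -mul_conj.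
  by move: y0C; move: ((yy z)%:C : C) (4^-1%:C : C) => t k t0; field.
have c1 : (1 : C)^* = 1 by rewrite -rc1 cj_rc.
have DB : D1 BB z 0 0.
  have D0 := D1_add DP (D1_mulc (-1) (D1_mul DA (D1_conj (D1_id z)))).
  apply: (@D1_eq R _ _ _ _ _ 1 ltr01 _ (eq_ind _ (D1 _ z ^~ _) (eq_ind _ (D1 _ z _) D0 _ _) _ _)).
  - by move=> h _; rewrite mulN1r.
  - by rewrite ?c0 ?c1; ring.
  by rewrite ?c0 ?c1; ring.
have DC : D1 (fun x => (CC x)%:C) z 0 0.
  have D0 := D1_add (D1_add Dy (D1_mulc (-1) (D1_mul DA (D1_mul (D1_id z) (D1_conj (D1_id z))))))
     (D1_mulc (-1) (D1_add (D1_mul DB (D1_id z)) (D1_conj (D1_mul DB (D1_id z))))).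
  apply: (@D1_eq R _ _ _ _ _ 1 ltr01 _ (eq_ind _ (D1 _ z ^~ _) (eq_ind _ (D1 _ z _) D0 _ _) _ _)).
  - by move=> h _; rewrite add_conj mul_conj /CC rcB rcB rcM; ring.
  - have BE : BB z = PP z - (AL z)%:C * z^* by [].
    by rewrite BE; move: (PP z) (AL z) => P0 a0; rewrite ?c0 ?c1 !(cjM, cjD, cjN) ?cjK ?cj_rc ?c0 ?c1; ring.
  have BE : BB z = PP z - (AL z)%:C * z^* by [].
  by rewrite BE; move: (PP z) (AL z) => P0 a0; rewrite ?c0 ?c1 !(cjM, cjD, cjN) ?cjK ?cj_rc ?c0 ?c1; ring.
by [].
Qed.

(** All points near [z] are equality points, so the Schwarzian vanishes on a disc, and by [coef_D1]
    the coefficients keep their values there. *)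
Lemma good_open al b c z : nm b ^+ 2 - al * c = 4^-1 -> good al b c z -> exists2 d : R, 0 < d &
  forall v, nm (v - z) < d -> good al b c v.
Proof.
move=> rel gz; have [Uz y0 pY P0 [Uw _]] := gz.
have [d d0 hd] := equality_open H H' dis S4 Uz Uw (good_S gz).
exists d => // v vd; have [Uv pv Uwv s4] := hd v vd.
have [_] := coef_good Uv pv Uwv s4.
have D x : nm (x - z) < d -> [/\ D1 (fun x => (AL x)%:C) x 0 0, D1 BB x 0 0 & D1 (fun x => (CC x)%:C) x 0 0].
  by move=> /hd [Ux px Uwx s4x]; apply: coef_D1 => //; exact: (schwarzian0 H H' dis S4 Ux Uwx s4x).
have [<- <- <-] := good_coef rel gz.
have /rc_inj -> := @D1_zero_cst (fun x => (AL x)%:C) z d (fun x xd => let: And3 h _ _ := D x xd in h) v vd.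
have -> := @D1_zero_cst BB z d (fun x xd => let: And3 _ h _ := D x xd in h) v vd.
by have /rc_inj -> := @D1_zero_cst (fun x => (CC x)%:C) z d (fun x xd => let: And3 _ _ h := D x xd in h) v vd.
Qed.

Lemma good_start z w : U z -> U' w -> pairS f f' z w = 4 ->
  exists al b c, nm b ^+ 2 - al * c = 4^-1 /\ good al b c z.
Proof.
move=> Uz Uw s4; have [pz wE] := critical_w H H' dis S4 Uz Uw s4.
by have := @coef_good z Uz pz; rewrite /Wp -wE => /(_ Uw s4) [rel g]; do 3 eexists; split; [exact: rel|exact: g].
Qed.

End Round.

(** * Continuation along segments *)

Section Extension.
Variable R : realType.
Local Notation C := R[i].
Local Notation re := (@complex.Re R).
Local Notation im := (@complex.Im R).
Implicit Types (z w h u v b : C).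

Lemma geom_small (K e : R) : 0 < e -> exists N, forall n, (N <= n)%N -> K * (2 / 3) ^+ n < e.
Proof.
move=> e0; have r1 : `|2 / 3 : R| < 1 by rewrite ger0_norm; lra.
have /cvgrPdist_lt h := cvg_expr r1.
have K0 : 0 < `|K| + 1 by rewrite ltr_wpDl.
have [N _ hN] := h (e / (`|K| + 1)) (divr_gt0 e0 K0).
exists N => n /hN /=; rewrite sub0r normrN normrX ger0_norm// ltr_pdivlMr// => hn.
apply: le_lt_trans hn; rewrite mulrC ler_wpM2l ?exprn_ge0//.
by have := ler_norm K; lra.
Qed.

Lemma complete_lim (U : set C) f s z (A K : R) : complete U f ->
  (forall n, exists2 l, l <= A * (2 / 3) ^+ n & chain U f (s n) (s n.+1) l) ->
  (forall n, nm (s n - z) <= K * (2 / 3) ^+ n) -> U z.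
Proof.
move=> cU /cU [z' Uz' h] hz; suff -> : z = z' by [].
apply/eqP; rewrite -subr_eq0 -nm_eq0 eq_le nm_ge0 andbT; apply/ler_addgt0Pr => e e0.
have e2 : 0 < e / 2 by rewrite divr_gt0.
have [N hN] := h _ e2; have [N' hN'] := geom_small K e2.
have := hN _ (leq_maxl N N'); have := hN' _ (leq_maxr N N').
have := hz (maxn N N'); have := nm_tri z (s (maxn N N')) z'; rewrite (nmBC z (s _)).
lra.
Qed.

Lemma segB u v (a c : R) : seg u v c - seg u v a = (c - a)%:C * (v - u).
Proof. by rewrite /seg rcB; ring. Qed.

Lemma seg_seg u v (a c t : R) : seg (seg u v a) (seg u v c) t = seg u v (a + t * (c - a)).
Proof. by rewrite /seg rcD rcM rcB; ring. Qed.

Lemma conv_between (a c t : R) : 0 <= t <= 1 -> Num.min a c <= a + t * (c - a) <= Num.max a c.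
Proof.
move=> /andP[t0 t1]; case: (leP a c) => ac; apply/andP; split.
- by rewrite lerDl mulr_ge0// subr_ge0.
- have : t * (c - a) <= c - a by rewrite ler_piMl// subr_ge0.
  lra.
- have : t * (a - c) <= a - c by rewrite ler_piMl// subr_ge0 ltW.
  by rewrite (_ : t * (c - a) = - (t * (a - c))); [lra|ring].
by rewrite gerDl mulr_ge0_le0// subr_le0 ltW.
Qed.

Variables (U U' : set C) (f f' : C -> R) (p p' q q' : C -> C).
Hypotheses (H : hyp U f p q) (H' : hyp U' f' p' q').
Hypothesis dis : forall z, U z -> U' z -> False.
Hypothesis S4 : forall z w, U z -> U' w -> 4 <= pairS f f' z w.
Hypotheses (cU : complete U f) (cU' : complete U' f').
Variables (al : R) (b : C) (c : R).
Hypothesis rel : nm b ^+ 2 - al * c = 4^-1.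
Local Notation Y := (hform al b c).
Local Notation P := (hpol al b).
Local Notation Rf := (refl al b c).
Local Notation gd := (good U U' f f' p al b c).

(** Good parameters form an open set by [good_open]. It is closed because the explicit densities
    bounded by A and A' make both the point and its reflection Cauchy, and completeness keeps the
    limits in U and U'. Chains are polygonal, so the reflected path must be straight up to
    reparametrisation, as the last hypothesis says. *)
Lemma extend u v (A A' L : R) : gd u -> 0 <= L ->
  (forall t : R, 0 <= t <= 1 -> [/\ 0 < Y (seg u v t), P (seg u v t) != 0,
      (Y (seg u v t))^-1 <= A & 4 * nm (P (seg u v t)) ^+ 2 / Y (seg u v t) <= A']) ->
  (forall t s : R, 0 <= t <= 1 -> 0 <= s <= 1 ->
      nm (Rf (seg u v t) - Rf (seg u v s)) <= L * `|t - s|) ->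
  (forall t s r : R, 0 <= t <= 1 -> 0 <= s <= 1 -> 0 <= r <= 1 ->
      exists2 x : R, 0 <= x <= Num.max t s & seg (Rf (seg u v t)) (Rf (seg u v s)) r = Rf (seg u v x)) ->
  forall t : R, 0 <= t <= 1 -> gd (seg u v t).
Proof.
move=> gu L0 hY hL hc.
pose B := [set t : R | 0 <= t <= 1 /\ ~ gd (seg u v t)].
move=> t1 t1I; apply: contrapT => bad.
have hB : has_inf B.
  by split; [exists t1|exists 0 => t [/andP[]]].
pose T := inf B.
have T0 : 0 <= T by apply: lb_le_inf; [exists t1|move=> t [/andP[]]].
have T1 : T <= 1.
  by apply: le_trans (_ : T <= t1) _; [apply: ge_inf; [exact: hB.2|]|case/andP: t1I].
have TI : 0 <= T <= 1 by rewrite T0.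
have before s : 0 <= s < T -> gd (seg u v s).
  move=> /andP[s0 sT]; apply: contrapT => ns.
  have : T <= s.
    by apply: ge_inf; [exact: hB.2|split => //; rewrite s0 (le_trans (ltW sT))].
  by rewrite leNgt sT.
have A0 : 0 <= A.
  have [Y0 _ h _] := hY 0 (introT andP (conj (lexx _) ler01)).
  by apply: le_trans h; rewrite invr_ge0 ltW.
have A0' : 0 <= A'.
  have [Y0 _ _ h] := hY 0 (introT andP (conj (lexx _) ler01)).
  by apply: le_trans h; apply: divr_ge0 (ltW Y0); rewrite mulr_ge0 ?sqr_ge0.
have gT : gd (seg u v T).
  have [T00|Tn0] := eqVneq T 0; first by rewrite T00 seg0.
  have Tp : 0 < T by rewrite lt_def Tn0.
  (* Approach to [T] at the geometric rate that [complete] accepts. *)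
  pose t n : R := T * (1 - (2 / 3) ^+ n).
  have r1 n : 0 < (2 / 3 : R) ^+ n <= 1.
    by rewrite exprn_gt0/=; [rewrite exprn_ile1; lra|lra].
  have tI n : 0 <= t n < T.
    have := r1 n; rewrite /t => /andP[a1 a2]; rewrite mulr_ge0/=; [|lra|lra].
    by rewrite gtr_pMr//; lra.
  have tI1 n : 0 <= t n <= 1 by case/andP: (tI n) => -> /ltW /le_trans ->.
  have dt n : `|t n.+1 - t n| <= (2 / 3) ^+ n.
    have e : t n.+1 - t n = T * (2 / 3) ^+ n / 3 by rewrite /t exprS; field.
    have /andP[a1 a2] := r1 n.
    rewrite e ger0_norm ?divr_ge0 ?mulr_ge0 ?(ltW a1)//.
    have : T * (2 / 3) ^+ n <= (2 / 3) ^+ n by rewrite ler_piMl// ltW.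
    lra.
  have dT n : `|t n - T| <= (2 / 3) ^+ n.
    have e : t n - T = - (T * (2 / 3) ^+ n) by rewrite /t; ring.
    have /andP[a1 a2] := r1 n.
    by rewrite e normrN ger0_norm ?mulr_ge0 ?(ltW a1)// ler_piMl// ltW.
  have Uz : U (seg u v T).
    apply: (@complete_lim U f (fun n => seg u v (t n)) _ (A * nm (v - u)) (nm (v - u)) cU) => n.
      exists (A * nm (seg u v (t n.+1) - seg u v (t n))).
        by rewrite segB nmZ (mulrC `|_|) mulrA ler_wpM2l// mulr_ge0 ?nm_ge0.
      apply: chain_seg => s sI; rewrite seg_seg.
      have /andP[b1 b2] := conv_between (t n) (t n.+1) sI.
      have bI : 0 <= t n + s * (t n.+1 - t n) < T.
        rewrite (le_trans _ b1) ?(le_lt_trans b2)//= ?le_min ?gt_max.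
          by case/andP: (tI n) => _ ->; case/andP: (tI n.+1).
        by case/andP: (tI n) => ->; case/andP: (tI n.+1).
      have [Ux y0 _ _ _] := before _ bI; split => //.
      have bI1 : 0 <= t n + s * (t n.+1 - t n) <= 1.
        by case/andP: bI => -> /ltW /le_trans ->.
      have [_ _ + _] := hY _ bI1; rewrite -y0 -expRN opprK//.
    by rewrite segB nmZ mulrC ler_wpM2l ?nm_ge0.
  have Uw : U' (Rf (seg u v T)).
    apply: (@complete_lim U' f' (fun n => Rf (seg u v (t n))) _ (A' * L) L cU') => n.
      exists (A' * nm (Rf (seg u v (t n.+1)) - Rf (seg u v (t n)))).
        rewrite -mulrA ler_wpM2l// (le_trans (hL _ _ (tI1 _) (tI1 _)))//.
        by rewrite ler_wpM2l.
      apply: chain_seg => s sI.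
      have [x xI ->] := hc _ _ _ (tI1 n) (tI1 n.+1) sI.
      have xT : 0 <= x < T.
        case/andP: xI => -> /= xI; apply: (le_lt_trans xI); rewrite gt_max.
        by case/andP: (tI n) => _ ->; case/andP: (tI n.+1).
      have [_ _ _ _ [Ux ex]] := before _ xT; split => //.
      have xI1 : 0 <= x <= 1 by case/andP: xT => -> /ltW /le_trans ->.
      by rewrite ex; have [] := hY _ xI1.
    by rewrite (le_trans (hL _ _ (tI1 _) TI))// ler_wpM2l.
  have [Y0 P0 _ _] := hY _ TI.
  apply: (good_lim H H' dis S4 Uz Uw Y0 P0) => e e0.
  have [N hN] := geom_small (nm (v - u)) e0.
  exists (seg u v (t N)); last exact: before.
  apply: le_lt_trans (hN N (leqnn _)).
  by rewrite segB nmZ mulrC ler_wpM2l ?nm_ge0.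
have [d d0 hd] := good_open H H' dis S4 rel gT.
have e0 : 0 < d / (nm (v - u) + 1) by rewrite divr_gt0// ltr_wpDl ?nm_ge0.
have [x [xI xb] xT] := inf_adherent e0 hB.
have Tx : 0 <= x - T by rewrite subr_ge0; apply: ge_inf => //; exact: hB.2.
apply: xb; apply: hd; rewrite segB nmZ (ger0_norm Tx).
apply: le_lt_trans (_ : (x - T) * (nm (v - u) + 1) < d).
  by rewrite (ler_wpM2l Tx)// lerDl.
by rewrite -ltr_pdivlMr ?ltr_wpDl ?nm_ge0// ltrBlDl.
Qed.

End Extension.

(** * Impossibility of a form positive near infinity *)

Section NoPos.
Variable R : realType.
Local Notation C := R[i].
Local Notation re := (@complex.Re R).
Local Notation im := (@complex.Im R).
Implicit Types (z w h u v b : C).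

(** On a ray from the centre the reflection inverts the radius ([refl_ctr]), so points of a
    reflected segment correspond to intermediate values of 1 / (1 + t). *)
Lemma inv_between (t s r : R) : 0 <= t <= 1 -> 0 <= s <= 1 -> 0 <= r <= 1 ->
  exists2 x : R, 0 <= x <= Num.max t s & (1 + x)^-1 = (1 + t)^-1 + r * ((1 + s)^-1 - (1 + t)^-1).
Proof.
move=> /andP[ta tb] /andP[sa sb] rI.
have t1 : 0 < 1 + t by lra.
have s1 : 0 < 1 + s by lra.
have := conv_between (1 + t)^-1 (1 + s)^-1 rI; move: (_ + r * _) => m /andP[m1 m2].
have m0 : 0 < m by apply: lt_le_trans m1; rewrite lt_min !invr_gt0 t1.
have M1 : 0 < 1 + Num.max t s by apply: (lt_le_trans t1); rewrite lerD2l le_max lexx.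
exists (m^-1 - 1); last by rewrite addrC subrK invrK.
rewrite subr_ge0 lerBlDl -[X in _ && X](@lef_pV2 R) ?posrE ?invr_gt0// invrK; apply/andP; split.
  rewrite invf_ge1//; apply: (le_trans m2); rewrite ge_max !invf_le1//; apply/andP; split; lra.
apply: le_trans m1; rewrite le_min; apply/andP; split; rewrite lef_pV2 ?posrE// lerD2l le_max lexx ?orbT//.
Qed.

Section Inversion.
Variables (al : R) (b : C) (c : R).
Hypothesis rel : nm b ^+ 2 - al * c = 4^-1.
Hypothesis al0 : 0 < al.
Let ctr : C := - b^* / al%:C.

Let alC : al%:C != 0 :> C. Proof. exact: real_nz (lt0r_neq0 al0). Qed.

Lemma hpol_ctr d (s : R) : hpol al b (ctr + s%:C * d) = (al * s)%:C * d^*.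
Proof.
rewrite /hpol /ctr cjD !cjM cjV cjN cjK !cj_rc rcM.
by move: alC; move: (al%:C : C) => a a0; field.
Qed.

Lemma hform_ctr d (s : R) : hform al b c (ctr + s%:C * d) = al * s ^+ 2 * nm d ^+ 2 - (4 * al)^-1.
Proof.
apply: (mulfI (lt0r_neq0 al0)); rewrite -form_polar// hpol_ctr nmM nm_conj nm_real exprMn.
rewrite real_normK ?num_real//; field; exact: lt0r_neq0.
Qed.

Lemma refl_ctr d (s : R) : d != 0 -> s != 0 ->
  refl al b c (ctr + s%:C * d) = ctr + s^-1%:C * ((4 * al ^+ 2)^-1%:C / d^*).
Proof.
move=> d0 s0; have dc : d^* != 0 by rewrite -nm_gt0 nm_conj nm_gt0.
have sC := real_nz s0.
have P0 : hpol al b (ctr + s%:C * d) != 0 by rewrite hpol_ctr mulf_neq0// real_nz// mulf_neq0// gt_eqF.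
have := refl_sub c P0; rewrite hpol_ctr hform_ctr => e.
rewrite -[LHS](subKr (ctr + s%:C * d)) e -addrA; congr (_ + _).
have four : (4%:C : C) = 4 by exact: rmorph_nat.
rewrite rcB (rcM (al * s ^+ 2)) (rcM al (s ^+ 2)) -mul_conj (rcX s) !rcV (rcM 4 al) (rcM 4 (al ^+ 2)) rcX four (rcM al s).
by move: alC sC dc; move: (al%:C : C) (s%:C : C) (d^*) => a s' d' a0 s0' d0'; field; rewrite a0 s0' d0'.
Qed.

End Inversion.

Variables (U U' : set C) (f f' : C -> R) (p p' q q' : C -> C).
Hypotheses (H : hyp U f p q) (H' : hyp U' f' p' q').
Hypothesis dis : forall z, U z -> U' z -> False.
Hypothesis S4 : forall z w, U z -> U' w -> 4 <= pairS f f' z w.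
Hypotheses (cU : complete U f) (cU' : complete U' f').

Section Coef.
Variables (al : R) (b : C) (c : R).
Hypothesis rel : nm b ^+ 2 - al * c = 4^-1.
Local Notation gd := (good U U' f f' p al b c).

(* The ray from the centre of the circle through z has finite length. *)
Lemma no_pos z : 0 < al -> gd z -> False.
Proof.
move=> al0 gz; pose ctr : C := - b^* / al%:C; pose d := z - ctr.
have alC : al%:C != 0 :> C := real_nz (lt0r_neq0 al0).
have zE (s : R) : s = 1 -> z = ctr + s%:C * d by move=> ->; rewrite mul1r addrC subrK.
have d0 : d != 0.
  have [_ _ _ + _] := gz; rewrite (zE 1 erefl) hpol_ctr// mulr1.
  by apply: contra => /eqP ->; rewrite -rc0 cj_rc mulr0.
have nd : 0 < nm d by rewrite nm_gt0.
pose k := al * nm d ^+ 2 - (4 * al)^-1.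
have k0 : 0 < k.
  by have := good_pos gz; rewrite (zE 1 erefl) hform_ctr// expr1n mulr1.
have Yge (s : R) : 1 <= s -> k * s ^+ 2 <= hform al b c (ctr + s%:C * d).
  move=> s1; rewrite hform_ctr//.
  have : (4 * al)^-1 <= (4 * al)^-1 * s ^+ 2.
    by rewrite ler_peMr ?invr_ge0 ?mulr_ge0 ?(ltW al0)// exprn_ege1.
  rewrite /k mulrBl (_ : al * nm d ^+ 2 * s ^+ 2 = al * s ^+ 2 * nm d ^+ 2); last by ring.
  lra.
(* Doubling the radius: the n-th step has Euclidean length 2^n |d| and density at most 1 / (k 4^n),
   so its length is at most |d| / (k 2^n). *)
pose x n : C := ctr + (2 ^+ n)%:C * d.
have p1 n : 1 <= 2 ^+ n :> R by rewrite exprn_ege1// ler1n.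
have p0 n : 0 < 2 ^+ n :> R by rewrite exprn_gt0.
have segx n (t : R) : seg (x n) (x n.+1) t = ctr + (2 ^+ n * (1 + t))%:C * d.
  by rewrite /seg /x exprS !rcM !rcD; ring.
have sg n (t : R) : 0 <= t <= 1 -> 2 ^+ n <= 2 ^+ n * (1 + t) :> R.
  by move=> /andP[t0 _]; rewrite ler_peMr ?(ltW (p0 n))// lerDl.
pose A n : R := (k * (2 ^+ n) ^+ 2)^-1.
have invA n (t : R) : 0 <= t <= 1 -> (hform al b c (seg (x n) (x n.+1) t))^-1 <= A n.
  move=> tI; rewrite segx; have s1 := le_trans (p1 n) (sg n t tI).
  have kp : 0 < k * (2 ^+ n) ^+ 2 by rewrite mulr_gt0// exprn_gt0.
  have le : k * (2 ^+ n) ^+ 2 <= hform al b c (ctr + (2 ^+ n * (1 + t))%:C * d).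
    apply: le_trans (Yge _ s1); rewrite (ler_wpM2l (ltW k0))// lerXn2r ?nnegrE ?(ltW (p0 n))//.
      by rewrite (le_trans _ s1).
    exact: sg.
  by rewrite lef_pV2 ?posrE// (lt_le_trans kp).
have step n : gd (x n) -> forall t : R, 0 <= t <= 1 -> gd (seg (x n) (x n.+1) t).
  move=> gx; apply: (@extend R U U' f f' p p' q q' H H' dis S4 cU cU' al b c rel (x n) (x n.+1) (A n)
    (4 * al ^+ 2 * nm d ^+ 2 / k) (2 ^+ n * nm d / (4 * (al * nm d) * (al * nm d)))) => //.
  - by rewrite divr_ge0 ?mulr_ge0 ?(ltW al0) ?(ltW nd) ?(ltW (p0 n)).
  - move=> t tI; have s1 := le_trans (p1 n) (sg n t tI).
    have s0 := lt_le_trans ltr01 s1.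
    have ks : 0 < k * (2 ^+ n * (1 + t)) ^+ 2 by rewrite mulr_gt0// exprn_gt0.
    have Yp := lt_le_trans ks (Yge _ s1).
    split; [by rewrite segx| |exact: invA|].
      rewrite segx hpol_ctr// -nm_gt0 nmM nm_conj nm_real (gtr0_norm (mulr_gt0 al0 s0)).
      exact: mulr_gt0 (mulr_gt0 al0 s0) nd.
    rewrite segx hpol_ctr// nmM nm_conj nm_real (gtr0_norm (mulr_gt0 al0 s0)).
    have w0 : 0 <= 4 * al ^+ 2 * nm d ^+ 2 by rewrite mulr_ge0 ?sqr_ge0// mulr_ge0 ?sqr_ge0.
    rewrite ler_pdivrMr// [leRHS]mulrAC ler_pdivlMr//.
    apply: le_trans (ler_wpM2l w0 (Yge _ s1)); apply: eqle.
    by move: (2 ^+ n * (1 + t)) => s; ring.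
  - move=> t s tI sI; rewrite !segx.
    have t1 := le_trans (p1 n) (sg n t tI); have s1 := le_trans (p1 n) (sg n s sI).
    have t0 := lt_le_trans ltr01 t1; have s0 := lt_le_trans ltr01 s1.
    have dc : d^* != 0 by rewrite -nm_gt0 nm_conj.
    have hP r : 1 <= r -> al * nm d <= nm (hpol al b (ctr + r%:C * d)).
      move=> r1; rewrite hpol_ctr// nmM nm_conj nm_real ger0_norm ?mulr_ge0 ?(ltW al0) ?(le_trans _ r1)//.
      by rewrite ler_wpM2r ?(ltW nd)// ler_peMr ?(ltW al0).
    have hP0 r : 1 <= r -> hpol al b (ctr + r%:C * d) != 0.
      by move=> /hP; rewrite -nm_gt0; apply: lt_le_trans; rewrite mulr_gt0.
    rewrite nm_refl_sub ?hP0//.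
    rewrite (_ : _ - _ = (2 ^+ n * (t - s))%:C * d); last by rewrite !rcM !rcD rcN; ring.
    rewrite nmM nm_real normrM (ger0_norm (ltW (p0 n))).
    rewrite [leRHS]mulrAC [2 ^+ n * nm d * `|t - s|]mulrAC.
    have ad : 0 < al * nm d by rewrite mulr_gt0.
    rewrite ler_wpM2l ?mulr_ge0 ?nm_ge0 ?(ltW (p0 n))// lef_pV2 ?posrE.
    + by apply: ler_pM; rewrite ?hP ?(ltW ad)//; [rewrite mulr_ge0// ltW|rewrite ler_wpM2l ?hP].
    + by rewrite !mulr_gt0// ?(lt_le_trans ad) ?hP.
    by rewrite !mulr_gt0.
  move=> t s r tI sI rI; rewrite !segx.
  have t1 := le_trans (p1 n) (sg n t tI); have s1 := le_trans (p1 n) (sg n s sI).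
  have t0 := lt_le_trans ltr01 t1; have s0 := lt_le_trans ltr01 s1.
  pose K : C := (4 * al ^+ 2)^-1%:C / d^*.
  have rE (y : R) : 0 < y -> refl al b c (ctr + y%:C * d) = ctr + y^-1%:C * K.
    by move=> y0; apply: refl_ctr => //; rewrite gt_eqF.
  rewrite (rE _ t0) (rE _ s0).
  have [y yI yE] := inv_between tI sI rI; exists y => //.
  have y1 : 0 < 1 + y by case/andP: yI => y0 _; lra.
  rewrite segx rE; last by rewrite mulr_gt0.
  rewrite (invfM _ (1 + y)) yE !invfM !rcM rcD rcM rcB /seg.
  ring.
have gx n : gd (x n).
  elim: n => [|n IH]; first by rewrite /x expr0 -(zE 1).
  by have := step n IH 1; rewrite ler01 lexx seg1; apply.
have [|z1 _ hz] := cU (s := x) (A := nm d / k).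
  move=> n; exists (A n * nm (x n.+1 - x n)).
    have -> : x n.+1 - x n = (2 ^+ n)%:C * d by rewrite /x exprS rcM rcD; ring.
    rewrite nmM nm_real ger0_norm ?(ltW (p0 n))//.
    have -> : A n * (2 ^+ n * nm d) = nm d / k * (2 ^+ n)^-1.
      by rewrite /A; field; rewrite !gt_eqF.
    rewrite ler_wpM2l ?divr_ge0 ?nm_ge0 ?(ltW k0)// -exprVn lerXn2r ?nnegrE//; lra.
  apply: chain_seg => t tI; have [Ux y0 _ _ _] := step n (gx n) t tI; split => //.
  by have := invA n t tI; rewrite -y0 -expRN opprK.
(* The limit supplied by completeness is absurd, as consecutive points are at distance at least
   |d|. *)
have e0 : 0 < nm d / 2 by rewrite divr_gt0.
have [N hN] := hz _ e0.
have := hN N (leqnn _); have := hN N.+1 (leqnSn _).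
have := nm_tri (x N.+1) z1 (x N); rewrite (nmBC z1).
have -> : x N.+1 - x N = (2 ^+ N)%:C * d by rewrite /x exprS rcM rcD; ring.
rewrite nmM nm_real ger0_norm ?(ltW (p0 N))//.
have : nm d <= 2 ^+ N * nm d by rewrite ler_peMl ?nm_ge0.
lra.
Qed.

End Coef.
End NoPos.

(** * The two domains contain complementary half-planes *)

Section HalfPlanes.
Variable R : realType.
Local Notation C := R[i].
Local Notation re := (@complex.Re R).
Local Notation im := (@complex.Im R).
Implicit Types (z w h u v b : C).

Lemma pairS_sym (f f' : C -> R) z w : pairS f f' z w = pairS f' f w z.
Proof. by rewrite /pairS addrC nmBC. Qed.

(** Reads the sign of [al] off |p|^2 e^(-f), a quantity that criticality relates on the two
    sides. *)
Lemma good_al (U U' : set C) (f f' : C -> R) p al b c z : nm b ^+ 2 - al * c = 4^-1 ->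
  good U U' f f' p al b c z -> nm (p z) ^+ 2 / (4 * expR (f z)) - 4^-1 = al * expR (- (f z / 2)).
Proof.
move=> rel g; have Y0 := good_pos g; have [_ y0 pY _ _] := g.
have Y0' := real_nz (lt0r_neq0 Y0).
rewrite y0 -form_polar//; congr (_ - _).
have -> : hpol al b z = - (p z * (hform al b c z)%:C / 2) by rewrite pY; field.
rewrite nmN nmM nmM nm_real nmV nm2 (gtr0_norm Y0) -y0 !exprMn.
have -> : expR (- (f z / 2)) ^+ 2 = (expR (f z))^-1.
  by rewrite expr2 -expRD -expRN; congr expR; field.
by field; rewrite gt_eqF// expR_gt0.
Qed.

Variables (U U' : set C) (f f' : C -> R) (p p' q q' : C -> C).
Hypotheses (H : hyp U f p q) (H' : hyp U' f' p' q').
Hypothesis dis : forall z, U z -> U' z -> False.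
Hypothesis S4 : forall z w, U z -> U' w -> 4 <= pairS f f' z w.
Hypotheses (cU : complete U f) (cU' : complete U' f').

(** A negative [al] on one side means a positive one on the other. With D = |z - w|^2, both |p z|^2
    and |p' w|^2 are 4/D, and D e^f times D e^f' is 16; so these two factors lie on opposite sides
    of 4 and [no_pos] applies with the roles exchanged. *)
Lemma good_al0 al b c z : nm b ^+ 2 - al * c = 4^-1 ->
  good U U' f f' p al b c z -> al = 0.
Proof.
move=> rel g.
have dis' x : U' x -> U x -> False by move=> a1 a2; exact: dis a2 a1.
have S4' x w : U' x -> U w -> 4 <= pairS f' f x w by move=> a1 a2; rewrite pairS_sym; exact: S4.
have ap : ~ 0 < al by move=> a0; exact: (no_pos H H' dis S4 cU cU' rel a0 g).
apply/eqP; rewrite eq_le leNgt; apply/andP; split; first exact/negP.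
rewrite leNgt; apply/negP => a0.
have [Uz _ _ _ [Uw _]] := g; have s4 := good_S g.
set w := refl al b c z in Uw s4.
have s4' : pairS f' f w z = 4 by rewrite pairS_sym.
have [al' [b' [c' [rel' g']]]] := good_start H' H dis' S4' Uw Uz s4'.
apply: (no_pos H' H dis' S4' cU' cU rel' _ g').
have [e1 e2] := critical H H' dis S4 Uz Uw s4.
have ea := good_al rel g; have ea' := good_al rel' g'.
have zw : 0 < nm (z - w) ^+ 2.
  by rewrite exprn_gt0// nm_gt0 subr_eq0; apply/eqP => zw; apply: (dis Uz); rewrite zw.
have e3 := s4; rewrite /pairS in e3.
set D := nm (z - w) ^+ 2 in zw e3.
set x := expR (f z) in ea; set x' := expR (f' w) in ea'.
have x0 : 0 < x := expR_gt0 _; have x0' : 0 < x' := expR_gt0 _.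
have xx : x * x' * D ^+ 2 = 16.
  transitivity (4 ^+ 2 : R); last by ring.
  rewrite -e3.
  have <- : expR ((f z + f' w) / 2) ^+ 2 = x * x' by rewrite expr2 -!expRD; congr expR; field.
  ring.
have np : nm (p z) ^+ 2 = 4 / D by rewrite e1 nmM nmV nmN nm2 exprMn exprVn /D; congr (_ / _); ring.
have np' : nm (p' w) ^+ 2 = 4 / D by rewrite e2 nmM nmV nm2 exprMn exprVn /D; congr (_ / _); ring.
rewrite np in ea; rewrite np' in ea'.
have Dx : 0 < D * x by rewrite mulr_gt0.
have Dx' : 0 < D * x' by rewrite mulr_gt0.
have h : 4 / D / (4 * x) < 4^-1.
  by rewrite -subr_lt0 ea pmulr_llt0// expR_gt0.
have h1 : 4 < D * x.
  rewrite -ltf_pV2 ?posrE//; apply: le_lt_trans h; apply: eqle; field.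
  by rewrite !gt_eqF.
have h2 : D * x' < 4.
  have : D * x * (D * x') = 16 by rewrite -xx; ring.
  move=> e; rewrite ltNge; apply/negP => h2.
  have : 16 < D * x * (D * x') by nra.
  by rewrite e ltxx.
have : 0 < al' * expR (- (f' w / 2)).
  rewrite -ea' subr_gt0 (_ : 4 / D / (4 * x') = (D * x')^-1) ?ltf_pV2 ?posrE//.
  by field; rewrite !gt_eqF.
by rewrite pmulr_lgt0// expR_gt0.
Qed.

Theorem half_planes z0 w0 : U z0 -> U' w0 -> pairS f f' z0 w0 = 4 ->
  exists b c, [/\ b != 0, forall z, 0 < 2 * re (b * z) + c -> U z
    & forall w, 2 * re (b * w) + c < 0 -> U' w].
Proof.
move=> Uz Uw s4; have [al [b [c [rel g]]]] := good_start H H' dis S4 Uz Uw s4.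
have a0 := good_al0 rel g; rewrite {}a0 in rel g.
have nb : nm b ^+ 2 = 4^-1 by rewrite -rel mul0r subr0.
have nb2 : nm b = 2^-1.
  by apply/eqP; rewrite -(@eqrXn2 _ 2) ?nm_ge0 ?invr_ge0// nb; apply/eqP; field.
have b0 : b != 0 by rewrite -nm_gt0 nb2 invr_gt0.
have YE z : hform 0 b c z = 2 * re (b * z) + c by rewrite /hform mul0r add0r.
have PE z : hpol 0 b z = b by rewrite /hpol rc0 mul0r add0r.
have Yseg u v (t : R) : hform 0 b c (seg u v t) = hform 0 b c u + t * (hform 0 b c v - hform 0 b c u).
  rewrite !YE /seg mulrDr reD mulrCA reZ mulrBr reB; ring.
have P0 z : hpol 0 b z != 0 by rewrite PE.
(* For al = 0 the form is affine, |P| = 1/2 and the reflection is an isometry. On the segment from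
   [z0] the form is at least its minimum m over the end points, so [extend] applies with both
   density bounds 1/m. *)
have gall z : 0 < 2 * re (b * z) + c -> good U U' f f' p 0 b c z.
  move=> Yz; have Y0 := good_pos g.
  pose m := Num.min (hform 0 b c z0) (hform 0 b c z).
  have m0 : 0 < m by rewrite lt_min Y0 YE.
  have Ym (t : R) : 0 <= t <= 1 -> m <= hform 0 b c (seg z0 z t).
    by move=> tI; rewrite Yseg; case/andP: (conv_between (hform 0 b c z0) (hform 0 b c z) tI).
  have nrefl x y : nm (refl 0 b c x - refl 0 b c y) = nm (x - y).
    by rewrite nm_refl_sub// !PE nb2 (_ : 4 * 2^-1 * 2^-1 = 1) ?divr1//; field.
  have := @extend R U U' f f' p p' q q' H H' dis S4 cU cU' 0 b c rel z0 z m^-1 m^-1 (nm (z - z0)) g (nm_ge0 _).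
  have h1 (t : R) : 0 <= t <= 1 -> [/\ 0 < hform 0 b c (seg z0 z t), hpol 0 b (seg z0 z t) != 0,
     (hform 0 b c (seg z0 z t))^-1 <= m^-1 & 4 * nm (hpol 0 b (seg z0 z t)) ^+ 2 / hform 0 b c (seg z0 z t) <= m^-1].
    move=> tI; have Yt := lt_le_trans m0 (Ym t tI); split=> //.
      by rewrite lef_pV2 ?posrE// Ym.
    by rewrite PE nb divff// mul1r lef_pV2 ?posrE// Ym.
  have h2 (t s : R) : 0 <= t <= 1 -> 0 <= s <= 1 ->
      nm (refl 0 b c (seg z0 z t) - refl 0 b c (seg z0 z s)) <= nm (z - z0) * `|t - s|.
    by move=> _ _; rewrite nrefl segB nmZ mulrC.
  have h3 (t s r : R) : 0 <= t <= 1 -> 0 <= s <= 1 -> 0 <= r <= 1 ->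
      exists2 x : R, 0 <= x <= Num.max t s & seg (refl 0 b c (seg z0 z t)) (refl 0 b c (seg z0 z s)) r = refl 0 b c (seg z0 z x).
    move=> tI sI rI; exists (t + r * (s - t)).
      have /andP[a1 ->] := conv_between t s rI; rewrite andbT (le_trans _ a1)// le_min.
      by case/andP: tI => ->; case/andP: sI.
    rewrite -seg_seg; move: (seg z0 z t) (seg z0 z s) => x y.
    rewrite /refl !PE /seg cjD cjM cj_rc cjB.
    by field.
  by move=> /(_ h1 h2 h3 1); rewrite seg1 ler01 lexx; apply.
exists b, c; split => //; first by move=> z /gall [].
move=> w Yw; pose z := refl 0 b c w.
have zE : z = w - (2 * re (b * w) + c)%:C / b.
  by rewrite -YE -[X in _ / X](PE w) -refl_sub// subKr.
have Yz : 2 * re (b * z) + c = - (2 * re (b * w) + c).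
  by rewrite zE mulrBr reB (mulrC b (_ / b)) (divfK b0) /=; ring.
have Yz0 : 0 < 2 * re (b * z) + c by rewrite Yz oppr_gt0.
have [_ _ _ _ []] := gall z Yz0.
suff -> : refl 0 b c z = w by [].
have := refl_sub c (P0 z); rewrite YE Yz PE => e.
by rewrite -[LHS](subKr z) e zE rcN mulNr opprK subrK.
Qed.

End HalfPlanes.

(** * Metrics in a coordinate *)

Section Partials.
Variable R : realType.
Local Notation C := R[i].
Local Notation re := (@complex.Re R).
Local Notation im := (@complex.Im R).
Implicit Types (z w h u v : C) (F : R * R -> R).

Definition pt z : R * R := (re z, im z).

Lemma cplxK z : cplx (pt z) = z. Proof. by case: z. Qed.
Lemma ptK (u : R * R) : pt (cplx u) = u. Proof. by case: u. Qed.

Lemma line_derive F (b v : R * R) (t : R) : derivable F (b + t *: v) v ->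
  is_derive t (1 : R) (fun s => F (b + s *: v)) ('D_v F (b + t *: v)).
Proof.
move=> d; have E : (fun s : R => s^-1 *: (F (b + (s *: (1 : R) + t) *: v) - F (b + t *: v))) =
    (fun s : R => s^-1 *: ((F \o shift (b + t *: v)) (s *: v) - F (b + t *: v))).
  apply/funext => s /=; congr (_ *: (F _ - _)).
  by rewrite /GRing.scale /= mulr1 -/(GRing.scale _ _) scalerDl addrCA.
apply: DeriveDef; first by rewrite /derivable E.
by rewrite /derive E.
Qed.

Lemma mvt_dir F (b v : R * R) (c e k : R) :
  (forall t : R, 0 <= t <= 1 -> derivable F (b + (t * k) *: v) v /\
     `|'D_v F (b + (t * k) *: v) - c| <= e) ->
  `|F (b + k *: v) - F b - c * k| <= e * `|k|.
Proof.
move=> h; pose G (t : R) := F (b + (t * k) *: v) - c * (t * k).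
have -> : F (b + k *: v) - F b - c * k = G 1 - G 0.
  by rewrite /G mul1r mul0r scale0r addr0 mulr0 subr0; ring.
apply: (@mvt_bound R G (fun t => ('D_v F (b + (t * k) *: v) - c) * k)) => t tI.
  have [d _] := h t tI; rewrite mulrBl.
  have dk : is_derive t (1 : R) (fun t : R => t * k) k.
    by apply: is_derive_eq; rewrite /GRing.scale /= mulr1 mulr0 add0r.
  have d1 := @is_derive1_comp R (fun s => F (b + s *: v)) (fun x => x * k) t _ k (line_derive d) dk.
  have d2 : is_derive t (1 : R) (fun t : R => c * (t * k)) (c * k) by exact: is_deriveZ.
  exact: is_deriveB d1 d2.
rewrite normrM ler_wpM2r//; exact: (h t tI).2.
Qed.

Lemma cont_pt F z (e : R) : {for pt z, continuous F} -> 0 < e ->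
  exists2 d : R, 0 < d & forall h, nm h < d -> `|F (pt (z + h)) - F (pt z)| < e.
Proof.
move=> /cvgrPdist_lt h /h {h} /nbhs_ballP [d d0 h]; exists d => // v vd.
have := h (pt (z + v)); rewrite distrC; apply; split; rewrite /ball /= distrC.
  by rewrite -reB addrC addKr (le_lt_trans (re_le _)).
by apply: le_lt_trans vd; apply: le_trans (im_le _); case: (z); case: (v) => a b c d' /=; rewrite addrC addKr.
Qed.

Definition locally_in (A : set (R * R)) z := exists2 d : R, 0 < d & forall h, nm h < d -> A (pt (z + h)).

(** The increment is split into a vertical and a horizontal one, each handled by the mean value
    theorem and the continuity of one partial derivative. *)
Lemma C1_DR (A : set (R * R)) F z : Cn 1 A F -> locally_in A z ->
  DR (fun w => F (pt w)) z
     (('D_((1 : R), (0 : R)) F (pt z))%:C / 2 - 'i * ('D_((0 : R), (1 : R)) F (pt z))%:C / 2).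
Proof.
move=> [_ C1] [d0 d00 hA]; apply/DR_small => e e0.
have e4 : 0 < e / 2 by rewrite divr_gt0.
have [dx cx] := C1 (1, 0); have [dy cy] := C1 (0, 1).
have Az : A (pt z) by have := hA 0; rewrite nm0 addr0; apply.
have [d1 d10 h1] := cont_pt (cx _ Az) e4; have [d2 d20 h2] := cont_pt (cy _ Az) e4.
pose d := Num.min d0 (Num.min d1 d2).
have dp : 0 < d by rewrite !lt_min d00 d10.
exists (d / 2); first by rewrite divr_gt0.
move=> h hd; rewrite expr1.
set X := 'D_(1, 0) F (pt z) in h1 *; set Y := 'D_(0, 1) F (pt z) in h2 *.
have rle := re_le h; have ile := im_le h.
have near (s t : R) : 0 <= s <= 1 -> 0 <= t <= 1 -> nm ((s * re h) +i* (t * im h)) < d.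
  move=> /andP[s0 s1] /andP[t0 t1]; apply: le_lt_trans (nm_le _) _; rewrite /= !normrM (ger0_norm s0) (ger0_norm t0).
  have : s * `|re h| <= `|re h| by rewrite ler_piMl.
  have : t * `|im h| <= `|im h| by rewrite ler_piMl.
  lra.
have A1 : `|F ((re z, im z + im h) + re h *: (1, 0)) - F (re z, im z + im h) - X * re h| <= e / 2 * `|re h|.
  apply: mvt_dir => t tI.
  have -> : (re z, im z + im h) + (t * re h) *: ((1 : R), (0 : R)) = pt (z + (t * re h +i* im h)).
    by case: (z) => a b; congr (_, _) => /=; rewrite /GRing.scale /= ?mulr1 ?mulr0 ?addr0.
  have := near t 1 tI; rewrite ler01 lexx mul1r => /(_ erefl).
  rewrite /d !lt_min => /and3P[k1 k2 k3].
  by split; [apply/dx/hA|exact/ltW/h1].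
have A2 : `|F ((re z, im z) + im h *: (0, 1)) - F (re z, im z) - Y * im h| <= e / 2 * `|im h|.
  apply: mvt_dir => t tI.
  have -> : (re z, im z) + (t * im h) *: ((0 : R), (1 : R)) = pt (z + (0 +i* (t * im h))).
    by case: (z) => a b; congr (_, _) => /=; rewrite /GRing.scale /= ?mulr1 ?mulr0 ?addr0.
  have := near 0 t; rewrite ler01 lexx mul0r => /(_ erefl tI).
  rewrite /d !lt_min => /and3P[k1 k2 k3].
  by split; [apply/dy/hA|exact/ltW/h2].
have e1 : (re z, im z + im h) + re h *: ((1 : R), (0 : R)) = pt (z + h).
  by case: (z) => a b; case: (h) => a' b'; congr (_, _) => /=; rewrite /GRing.scale /= ?mulr1 ?mulr0 ?addr0.
have e2 : (re z, im z) + im h *: ((0 : R), (1 : R)) = (re z, im z + im h).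
  by congr (_, _) => /=; rewrite /GRing.scale /= ?mulr1 ?mulr0 ?addr0.
rewrite e1 in A1; rewrite e2 in A2.
have -> : 2 * re ((X%:C / 2 - 'i * Y%:C / 2) * h) = X * re h + Y * im h.
  have -> : X%:C / 2 = (X / 2)%:C by rewrite rcM rcV (_ : 2%:C = 2)// rcD.
  have -> : 'i * Y%:C / 2 = 'i * (Y / 2)%:C by rewrite rcM rcV (_ : 2%:C = 2) ?rcD// mulrA.
  by case: (h) => a b /=; field.
have -> : F (pt (z + h)) - F (pt z) - (X * re h + Y * im h) =
   (F (pt (z + h)) - F (re z, im z + im h) - X * re h) + (F (re z, im z + im h) - F (re z, im z) - Y * im h).
  by rewrite /pt /=; ring.
rewrite (le_trans (ler_normD _ _))//.
have : e / 2 * `|re h| <= e / 2 * nm h by apply: ler_wpM2l (ltW e4) _ _ _.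
have : e / 2 * `|im h| <= e / 2 * nm h by apply: ler_wpM2l (ltW e4) _ _ _.
lra.
Qed.

Lemma DR_partial F z (a : C) : DR (fun w => F (pt w)) z a ->
  'D_((1 : R), (0 : R)) F (pt z) = 2 * re a /\ 'D_((0 : R), (1 : R)) F (pt z) = 2 * re ('i * a).
Proof.
have key (v : C) : DR (fun w => F (pt w)) z a -> 'D_(pt v) F (pt z) = 2 * re (a * v).
  move=> D; have D0 : DR (fun w => F (pt w)) (z + 0%:C * v) a by rewrite mul0r addr0.
  have h := DR_line D0; have := derive_val (is_derive := h); rewrite /derive => <-.
  have -> // : (fun s : R => s^-1 *: ((F \o shift (pt z)) (s *: pt v) - F (pt z))) =
    (fun s : R => s^-1 *: (((fun s : R => F (pt (z + s%:C * v))) \o shift 0) (s *: (1 : R)) - F (pt (z + 0%:C * v)))).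
  apply/funext => s /=; congr (_ *: (F _ - F _)); last by rewrite mul0r addr0.
  by case: (z) (v) => a1 a2 [b1 b2]; congr (_, _) => /=; rewrite /GRing.scale /=; ring.
move=> D; split; first by have := key 1 D; rewrite mulr1.
by have := key 'i D; rewrite [a * 'i]mulrC.
Qed.

(* Both bounds on the second difference of f over the parallelogram (h, k) agree. *)
Lemma mixed_real (f : C -> R) (P : C -> C) z A B (d : R) : 0 < d ->
  (forall h, nm h < d -> DR f (z + h) (P (z + h))) -> D1 P z A B -> im B = 0.
Proof.
move=> d0 Df DP; apply/eqP/negPn/negP => n0.
have e0 : 0 < `|im B| / 8 by rewrite divr_gt0// normr_gt0.
have [d1 d10 h1] := DP _ e0.
pose t := Num.min d d1 / 4.
have m0 : 0 < Num.min d d1 by rewrite lt_min d0.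
have t0 : 0 < t by rewrite divr_gt0.
pose dd h k := f (z + h + k) - f (z + h) - (f (z + k) - f z).
have key h k : nm h = t -> nm k = t -> `|dd h k - 2 * re ((A * k + B * k^*) * h)| <= 3 / 4 * `|im B| * t ^+ 2.
  move=> nh nk.
  pose G (s : R) := (f (z + k + s%:C * h) - f (z + s%:C * h)) - s * (2 * re ((A * k + B * k^*) * h)).
  have -> : dd h k - 2 * re ((A * k + B * k^*) * h) = G 1 - G 0.
    by rewrite /dd /G rc0 rc1 !mul1r !mul0r !addr0 (addrAC z h k); ring.
  have le s : 0 <= s <= 1 -> nm (s%:C * h) <= t.
    by move=> /andP[s0 s1]; rewrite nmM nm_real ger0_norm// nh ler_piMl// ltW.
  have le2 s : 0 <= s <= 1 -> nm (k + s%:C * h) <= 2 * t.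
    by move=> /le sh; apply: le_trans (nmD _ _) _; rewrite nk; lra.
  have hd : 2 * t < d.
    have : Num.min d d1 <= d by rewrite ge_min lexx.
    by move: t0; rewrite /t; lra.
  have hd1 : 2 * t < d1.
    have : Num.min d d1 <= d1 by rewrite ge_min lexx orbT.
    by move: t0; rewrite /t; lra.
  apply: (@mvt_bound R G (fun s => (2 * re (P (z + k + s%:C * h) * h) - 2 * re (P (z + s%:C * h) * h)) - 2 * re ((A * k + B * k^*) * h))).
    move=> s sI; apply: is_deriveB; last first.
      by apply: is_derive_eq; rewrite /GRing.scale /= mulr1 mulr0 add0r.
    apply: is_deriveB; apply: DR_line.
      by rewrite -addrA; apply: Df; apply: le_lt_trans (le2 _ sI) hd.
    by apply: Df; apply: (le_lt_trans (le _ sI)); lra.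
  move=> s sI.
  pose r1 := P (z + (k + s%:C * h)) - P z - A * (k + s%:C * h) - B * (k + s%:C * h)^*.
  pose r2 := P (z + s%:C * h) - P z - A * (s%:C * h) - B * (s%:C * h)^*.
  have -> : 2 * re (P (z + k + s%:C * h) * h) - 2 * re (P (z + s%:C * h) * h) - 2 * re ((A * k + B * k^*) * h) =
     2 * re ((r1 - r2) * h).
    rewrite -!mulrBr -!reB /r1 /r2 -(addrA z) cjD; congr (2 * re _); ring.
  have n1 : nm r1 <= `|im B| / 8 * (2 * t).
    have := h1 (k + s%:C * h) (le_lt_trans (le2 _ sI) hd1); rewrite expr1 ger0_norm ?nm_ge0// => /le_trans; apply.
    by rewrite ler_wpM2l ?(ltW e0)// le2.
  have n2 : nm r2 <= `|im B| / 8 * t.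
    have lt1 : nm (s%:C * h) < d1 by apply: (le_lt_trans (le _ sI)); lra.
    have := h1 (s%:C * h) lt1; rewrite expr1 ger0_norm ?nm_ge0// => /le_trans; apply.
    by rewrite ler_wpM2l ?(ltW e0)// le.
  rewrite normrM ger0_norm//; apply: (@le_trans _ _ (2 * (nm (r1 - r2) * t))).
    by rewrite ler_wpM2l// (le_trans (re_le _))// nmM nh.
  have n3 : nm (r1 - r2) <= `|im B| / 8 * (3 * t) by apply: le_trans (nmB _ _) _; lra.
  have : nm (r1 - r2) * t <= `|im B| / 8 * (3 * t) * t by rewrite ler_wpM2r// ltW.
  lra.
have nh : nm t%:C = t by rewrite nm_real gtr0_norm.
have nk : nm ('i * t%:C) = t by rewrite nmM nmi mul1r.
have k1 := key _ _ nh nk; have k2 := key _ _ nk nh.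
have dds : dd t%:C ('i * t%:C) = dd ('i * t%:C) t%:C.
  by rewrite /dd (addrAC z t%:C); ring.
rewrite dds in k1.
have : `|2 * re ((A * ('i * t%:C) + B * ('i * t%:C)^*) * t%:C) - 2 * re ((A * t%:C + B * (t%:C)^*) * ('i * t%:C))| <=
   3 / 2 * `|im B| * t ^+ 2.
  move: k1 k2; move: (dd _ _) (2 * re _) (2 * re _) => x y w k1 k2.
  have := ler_distD x w y; rewrite (distrC w x); lra.
have -> : 2 * re ((A * ('i * t%:C) + B * ('i * t%:C)^*) * t%:C) - 2 * re ((A * t%:C + B * (t%:C)^*) * ('i * t%:C)) = 4 * im B * t ^+ 2.
  by case: (A) => a1 a2; case: (B) => b1 b2 /=; ring.
rewrite normrM normrM ger0_norm// (ger0_norm (sqr_ge0 t)).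
have : 0 < `|im B| * t ^+ 2 by rewrite mulr_gt0 ?normr_gt0 ?exprn_gt0.
lra.
Qed.

Definition lbounded (g : C -> C) z := exists2 d : R, 0 < d & exists K : R,
  forall h, nm h < d -> nm (g (z + h)) <= K.

Lemma lbounded_D1 g z A B : D1 g z A B -> lbounded g z.
Proof.
move=> /D1_cont /(_ _ ltr01) [d d0 h]; exists d => //; exists (nm (g z) + 1) => k /h hk.
have := nm_sub (g (z + k)) (g z); lra.
Qed.

Lemma lbounded_cont F z : {for pt z, continuous F} -> lbounded (fun w => (F (pt w))%:C) z.
Proof.
move=> /cont_pt /(_ ltr01) [d d0 h]; exists d => //; exists (`|F (pt z)| + 1) => k /h hk.
rewrite nm_real; have := lerB_dist (F (pt (z + k))) (F (pt z)); lra.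
Qed.

Lemma lbounded_cst c z : lbounded (fun=> c) z.
Proof. by exists 1 => //; exists (nm c). Qed.

Lemma lbounded_add g g' z : lbounded g z -> lbounded g' z -> lbounded (fun x => g x + g' x) z.
Proof.
move=> [d d0 [K h]] [d' d0' [K' h']]; exists (Num.min d d'); first by rewrite lt_min d0.
exists (K + K') => k; rewrite lt_min => /andP[/h k1 /h' k2].
by apply: le_trans (nmD _ _) _; exact: lerD.
Qed.

Lemma lbounded_mul g g' z : lbounded g z -> lbounded g' z -> lbounded (fun x => g x * g' x) z.
Proof.
move=> [d d0 [K h]] [d' d0' [K' h']]; exists (Num.min d d'); first by rewrite lt_min d0.
exists (K * K') => k; rewrite lt_min => /andP[/h k1 /h' k2].
by rewrite nmM ler_pM ?nm_ge0.
Qed.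

(** [p] and [q] are the Wirtinger derivatives of ln F. The point is that the conjugate derivative of
    [p] is e^f / 2: its real part is the curvature equation, and its imaginary part vanishes by
    [mixed_real]. *)
Lemma chart_hyp (A : set (R * R)) (F : R * R -> R) :
  (forall z, A (pt z) -> locally_in A z) -> smooth A F -> (forall u : R * R, A u -> 0 < F u) ->
  (forall u : R * R, A u -> curvature F u = -1) ->
  exists p q, hyp [set z | A (pt z)] (fun z => ln (F (pt z))) p q.
Proof.
move=> oA sF F0 cF.
have C1F := sF 1%N; have [_ C2F] := sF 2%N.
pose e1 : R * R := (1, 0); pose e2 : R * R := (0, 1).
pose X := 'D_e1 F; pose Y := 'D_e2 F.
have [_ C1X] : Cn 2 A F := sF 2%N.
have CX : Cn 1 A X := (C2F e1).2; have CY : Cn 1 A Y := (C2F e2).2.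
pose dd (G : R * R -> R) z : C := ('D_e1 G (pt z))%:C / 2 - 'i * ('D_e2 G (pt z))%:C / 2.
have DF z : A (pt z) -> DR (fun w => F (pt w)) z (dd F z) by move=> /oA; exact: C1_DR.
have DX z : A (pt z) -> DR (fun w => X (pt w)) z (dd X z) by move=> /oA; exact: C1_DR.
have DY z : A (pt z) -> DR (fun w => Y (pt w)) z (dd Y z) by move=> /oA; exact: C1_DR.
pose q1 z := 2^-1 * dd X z + (- 'i / 2) * dd Y z.
pose b1 z := 2^-1 * (dd X z)^* + (- 'i / 2) * (dd Y z)^*.
have Dd z : A (pt z) -> D1 (dd F) z (q1 z) (b1 z).
  move=> Az; apply: (@D1_eq R (fun w => 2^-1 * (X (pt w))%:C + (- 'i / 2) * (Y (pt w))%:C) _ _ _ _ 1 ltr01).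
    by move=> h _; rewrite /dd /X /Y; field.
  exact: D1_add (D1_mulc _ (DX z Az)) (D1_mulc _ (DY z Az)).
pose P z := dd F z / (F (pt z))%:C.
pose q z := q1 z / (F (pt z))%:C + dd F z * (- dd F z / (F (pt z))%:C ^+ 2).
pose B z := b1 z / (F (pt z))%:C + dd F z * (- (dd F z)^* / (F (pt z))%:C ^+ 2).
have FC z : A (pt z) -> (F (pt z))%:C != 0 :> C.
  by move=> /F0 f0; rewrite -rc0 (inj_eq (@rc_inj R)) gt_eqF.
have DP z : A (pt z) -> D1 P z (q z) (B z).
  by move=> Az; exact: D1_mul (Dd z Az) (D1_inv (DF z Az) (FC z Az)).
have Du z : A (pt z) -> DR (fun w => ln (F (pt w))) z (P z).
  move=> Az; have := @DR_comp R (@ln R) (F (pt z))^-1 _ z _ (is_derive1_ln (F0 _ Az)) (DF z Az).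
  by rewrite /P mulrC rcV.
have BE z : A (pt z) -> B z = (expR (ln (F (pt z))) / 2)%:C.
  move=> Az; have [d d0 hd] := oA z Az.
  have Bi : im (B z) = 0 := mixed_real d0 (fun h hh => Du _ (hd h hh)) (DP z Az).
  have f0 := F0 _ Az.
  have Bre : 4 * re (B z) = 2 * F (pt z).
    pose g1 := 'D_((1 : R), (0 : R)) (fun u : R * R => ln (F u)).
    pose g2 := 'D_((0 : R), (1 : R)) (fun u : R * R => ln (F u)).
    have cE : - ('D_((1 : R), (0 : R)) g1 (pt z) + 'D_((0 : R), (1 : R)) g2 (pt z)) / (2 * F (pt z)) = -1 := cF _ Az.
    have D1g : DR (fun w => g1 (pt w)) z ((2 * q z + (2 * B z)^*) / 2).
      apply: (@D1_eq R _ _ _ _ _ d d0 _ (D1_re (D1_mulc 2 (DP z Az)))) => h hh.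
      by have [e _] := @DR_partial (fun u : R * R => ln (F u)) _ _ (Du _ (hd h hh)); rewrite /g1 e; case: (P _) => a b /=; congr _%:C; ring.
    have D2g : DR (fun w => g2 (pt w)) z ((2 * 'i * q z + (2 * 'i * B z)^*) / 2).
      apply: (@D1_eq R _ _ _ _ _ d d0 _ (D1_re (D1_mulc (2 * 'i) (DP z Az)))) => h hh.
      by have [_ e] := @DR_partial (fun u : R * R => ln (F u)) _ _ (Du _ (hd h hh)); rewrite /g2 e; case: (P _) => a b /=; congr _%:C; ring.
    move: cE; have [-> _] := DR_partial D1g; have [_ ->] := DR_partial D2g.
    have n2 (x : C) : x / 2 = (2^-1)%:C * x by rewrite rcV (_ : 2%:C = 2) ?rcD// mulrC.
    rewrite !n2; case: (q z) => a b; case: (B z) => c d' /= cE.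
    have F2 : 2 * F (pt z) != 0 by rewrite mulf_neq0 ?gt_eqF.
    have := congr1 (fun x => x * (2 * F (pt z))) cE; rewrite /= divfK// mulN1r => /oppr_inj <-.
    by field.
  rewrite lnK ?posrE//; move: Bi Bre; case: (B z) => x y /= -> e.
  by have -> : x = F (pt z) / 2 by lra.
exists P, q; split.
- by move=> z /oA.
- exact: Du.
- by move=> z Az; rewrite -BE//; exact: DP.
move=> z Az; rewrite -/(lbounded q z).
apply: (@lbounded_add (fun z => q1 z / (F (pt z))%:C) (fun z => dd F z * (- dd F z / (F (pt z))%:C ^+ 2))).
  apply: lbounded_mul; last exact: lbounded_D1 (D1_inv (DF z Az) (FC z Az)).
  have lb G : Cn 1 A G -> lbounded (dd G) z.
    move=> [_ CG]; rewrite /dd; apply: lbounded_add.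
      exact: lbounded_mul (lbounded_cont ((CG e1).2 _ Az)) (lbounded_cst _ _).
    have E : (fun x => - ('i * ('D_e2 G (pt x))%:C / 2)) = (fun x => (- 'i / 2) * ('D_e2 G (pt x))%:C) :> (C -> C).
      by apply/funext => x; field.
    rewrite E; exact: lbounded_mul (lbounded_cst _ _) (lbounded_cont ((CG e2).2 _ Az)).
  exact: lbounded_add (lbounded_mul (lbounded_cst _ _) (lb _ CX)) (lbounded_mul (lbounded_cst _ _) (lb _ CY)).
have lF := lbounded_D1 (Dd z Az); have lI := lbounded_D1 (D1_inv (DF z Az) (FC z Az)).
apply: lbounded_mul => //.
have E : (fun x => - dd F x / (F (pt x))%:C ^+ 2) = (fun x => (-1 * dd F x) * ((F (pt x))%:C^-1 * (F (pt x))%:C^-1)) :> (C -> C).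
  by apply/funext => x; rewrite mulN1r -invfM -expr2.
by rewrite E; exact: lbounded_mul (lbounded_mul (lbounded_cst _ _) lF) (lbounded_mul lI lI).
Qed.

End Partials.

(** * Moebius changes of coordinate *)

Section Moebius.
Variable R : realType.
Local Notation C := R[i].
Local Notation re := (@complex.Re R).
Local Notation im := (@complex.Im R).
Implicit Types (z w h u v a : C).

Let two : 2%:C = 2 :> C. Proof. by rewrite rcD. Qed.
Let c0 : (0 : C)^* = 0. Proof. by rewrite -rc0 cj_rc. Qed.
Let c1 : (1 : C)^* = 1. Proof. by rewrite -rc1 cj_rc. Qed.

Lemma D1_cast F z A B A' B' : D1 F z A B -> A = A' -> B = B' -> D1 F z A' B'.
Proof. by move=> D <- <-. Qed.

Lemma DR_lnnorm (e : C -> C) z g : D1 e z g 0 -> e z != 0 ->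
  DR (fun x => ln (nm (e x) ^+ 2)) z (g / e z).
Proof.
move=> De e0; have n0 : 0 < nm (e z) ^+ 2 by rewrite exprn_gt0// nm_gt0.
have ec : (e z)^* != 0 by rewrite -nm_gt0 nm_conj nm_gt0.
have D : DR (fun x => nm (e x) ^+ 2) z (g * (e z)^*).
  apply: (@D1_eq R (fun x => e x * (e x)^*) _ _ _ _ 1 ltr01); first by move=> h _; rewrite mul_conj.
  apply: (D1_cast (D1_mul De (D1_conj De))); first by rewrite c0; ring.
  by rewrite cjM cjK mul0r add0r mulrC.
have := @DR_comp R (@ln R) (nm (e z) ^+ 2)^-1 _ z _ (is_derive1_ln n0) D.
rewrite rcV -mul_conj; by congr (D1 _ _ _ _^*); field; rewrite e0 ec.
Qed.

(** M' = det / e^2 has modulus |e|^(-2), so the pull-back of e^g |dz|^2 has logarithm g o M - 2 ln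
    |e|^2. The correction is harmonic, and the curvature equation survives. *)
Lemma hyp_moebius (V : set C) (g : C -> R) P Q (M e : C -> C) (gam det : C) :
  hyp V g P Q -> nm det = 1 -> (forall z, D1 e z gam 0) ->
  (forall z, e z != 0 -> D1 M z (det / e z ^+ 2) 0) ->
  exists p q, hyp [set z | e z != 0 /\ V (M z)] (fun z => g (M z) - 2 * ln (nm (e z) ^+ 2)) p q.
Proof.
move=> HV nd De DM.
pose m z := det / e z ^+ 2; pose m' z := det * (- (2 * gam) / e z ^+ 3).
have Dm z : e z != 0 -> D1 m z (m' z) 0.
  move=> e0; have D2 := D1_mul (De z) (De z).
  have e2 : e z * e z != 0 by rewrite mulf_neq0.
  apply: (@D1_eq R (fun x => det * (e x * e x)^-1) _ _ _ _ 1 ltr01); first by move=> h _; rewrite /m expr2.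
  apply: (D1_cast (D1_mulc det (D1_inv D2 e2))); last by rewrite mul0r mulr0 addr0 oppr0 mul0r mulr0.
  by rewrite /m'; congr (det * _); field; rewrite e0.
pose p z := P (M z) * m z + (- 2 * gam) * (e z)^-1.
pose q z := Q (M z) * m z * m z + P (M z) * m' z + (- 2 * gam) * (- gam / e z ^+ 2).
exists p, q; split.
- move=> z [e0 Vz]; have [d d0 hd] := hyp_open HV Vz.
  have [d1 d10 h1] := D1_cont (DM z e0) d0.
  have [d2 d20 h2] := D1_cont (De z) (etrans (nm_gt0 _) e0).
  exists (Num.min d1 d2); first by rewrite lt_min d10.
  move=> h; rewrite lt_min => /andP[/h1 k1 /h2 k2]; split.
    by apply: contraTneq k2 => ->; rewrite sub0r nmN ltxx.
  by have := hd _ k1; rewrite addrC subrK.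
- move=> z [e0 Vz].
  have Dg := D1_comp (hyp_f HV Vz) (DM z e0).
  have D := D1_add Dg (D1_mulc (-2) (DR_lnnorm (De z) e0)).
  apply: (@D1_eq R _ _ _ _ _ 1 ltr01 _ (D1_cast D _ _)).
  + by move=> h _ /=; rewrite rcB rcM two mulNr.
  + by rewrite c0 mulr0 addr0 /p /m; ring.
  by rewrite mulr0 add0r /p /m cjD !cjM cjN -two cj_rc; ring.
- move=> z [e0 Vz].
  have DPM := D1_comp (hyp_p HV Vz) (DM z e0).
  have D := D1_add (D1_mul DPM (Dm z e0)) (D1_mulc (-2 * gam) (D1_inv (De z) e0)).
  apply: (D1_cast D); first by rewrite c0 mulr0 addr0 /q.
  rewrite oppr0 !mul0r !mulr0 !addr0 add0r -mulrA [_^* * _]mulrC -/(m z) mul_conj -rcM; congr _%:C.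
  have n0 : 0 < nm (e z) by rewrite nm_gt0.
  rewrite expRD expRN (_ : expR (2 * _) = nm (e z) ^+ 4); last first.
    by rewrite mulrDl mul1r expRD lnK ?posrE ?exprn_gt0//; ring.
  by rewrite /m nmM nmV nmX nd mul1r; field; rewrite gt_eqF.
move=> z [e0 Vz]; rewrite -/(lbounded q z).
have lQ : lbounded (fun x => Q (M x)) z.
  have [d d0 [K hK]] := hyp_q HV Vz.
  have [d1 d10 h1] := D1_cont (DM z e0) d0.
  by exists d1 => //; exists K => h /h1 /hK; rewrite addrC subrK.
have lm := lbounded_D1 (Dm z e0).
have lP := lbounded_D1 (D1_comp (hyp_p HV Vz) (DM z e0)).
have li := lbounded_D1 (D1_inv (De z) e0).
have lc c := @lbounded_cst R c z.
have lm' : lbounded m' z.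
  have := lbounded_mul (lc (det * (- (2 * gam)))) (lbounded_mul li (lbounded_mul li li)).
  congr (lbounded _ z); apply/funext => x; rewrite /m' -mulrA; congr (_ * (_ * _)).
  by rewrite exprSr expr2 !invfM mulrA.
have E : q = (fun x => Q (M x) * m x * m x + P (M x) * m' x + (- 2 * gam * - gam) * ((e x)^-1 * (e x)^-1)).
  by apply/funext => x; rewrite /q -invfM -expr2 mulrA.
rewrite E; exact: lbounded_add (lbounded_add (lbounded_mul (lbounded_mul lQ lm) lm) (lbounded_mul lP lm'))
  (lbounded_mul (lc _) (lbounded_mul li li)).
Qed.

Lemma small_lin (K : R) : small 1 (fun h : C => K * nm h) -> 0 <= K -> K = 0.
Proof.
move=> sm K0; apply/eqP; rewrite eq_le K0 andbT; apply/ler_addgt0Pr => e e0; rewrite add0r.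
have [d d0 h] := sm e e0.
have d2 : 0 < d / 2 by rewrite divr_gt0.
have n2 : nm (d / 2)%:C = d / 2 by rewrite nm_real gtr0_norm.
have dd : d / 2 < d by lra.
have := h (d / 2)%:C; rewrite n2 => /(_ dd); rewrite expr1 (ger0_norm (mulr_ge0 K0 (ltW d2))) => h1.
by rewrite -(ler_pM2r d2).
Qed.

Lemma D1_uniq F z A A' B : D1 F z A B -> D1 F z A' B -> A = A'.
Proof.
move=> D D'; apply/eqP; rewrite -subr_eq0 -nm_eq0; apply/eqP; apply: small_lin; last exact: nm_ge0.
apply: (@small_dom R 1 _ _ (small_add D D')) => h; rewrite -nmM !ger0_norm ?addr_ge0 ?nm_ge0//.
have -> : (A - A') * h = (F (z + h) - F z - A' * h - B * h^*) - (F (z + h) - F z - A * h - B * h^*) by ring.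
by rewrite [leRHS]addrC; exact: nmB.
Qed.

(** Tested in the direction of conj (a - a'), where re ((a - a') x) equals |a - a'| |x|. *)
Lemma DR_uniq f z a a' : DR f z a -> DR f z a' -> a = a'.
Proof.
move=> D D'; have D2 := DR_small f z a; have D2' := DR_small f z a'.
apply/eqP; rewrite -subr_eq0 -nm_eq0; apply/eqP; apply: small_lin; last exact: nm_ge0.
move=> e e0; have [d d0 h] := D2.1 D e e0; have [d' d0' h'] := D2'.1 D' e e0.
exists (Num.min d d'); first by rewrite lt_min d0.
move=> k; rewrite lt_min => /andP[k1 k2].
have [->|n0] := eqVneq (a - a') 0; first by rewrite nm0 mul0r normr0 mulr_ge0 ?(ltW e0) ?exprn_ge0 ?nm_ge0.
pose x := (nm k / nm (a - a'))%:C * (a - a')^*.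
have na : 0 < nm (a - a') by rewrite nm_gt0.
have nx : nm x = nm k.
  by rewrite /x nmM nm_conj nm_real ger0_norm ?divr_ge0 ?nm_ge0// divfK// gt_eqF.
have := h x; have := h' x; rewrite nx => /(_ k2) h2 /(_ k1) h1.
have e1 : 2 * re ((a - a') * x) = 2 * (nm (a - a') * nm k).
  rewrite /x mulrCA mul_conj -rcM /=; congr (2 * _); field; exact: lt0r_neq0.
move: h1 h2; rewrite (ger0_norm (mulr_ge0 (nm_ge0 _) (nm_ge0 k))).
move: e1; rewrite mulrBl reB mulrBr; move: (f (z + x) - f z) (2 * re _) (2 * re _) => y s t.
rewrite expr1 => e1 h1 h2; have := ler_distD y t s; rewrite (distrC t y).
rewrite e1 ger0_norm ?mulr_ge0 ?nm_ge0//; lra.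
Qed.

(** Derivatives are unique, so [p] and [q] agree on the overlap; near each point the glued functions
    then coincide with one of the given triples, both sets being open. *)
Lemma hyp_glue (U0 U1 : set C) (f0 f1 : C -> R) p0 p1 q0 q1 :
  hyp U0 f0 p0 q0 -> hyp U1 f1 p1 q1 -> (forall z, U0 z -> U1 z -> f0 z = f1 z) ->
  exists f p q, [/\ hyp (U0 `|` U1) f p q, forall z, U0 z -> f z = f0 z & forall z, U1 z -> f z = f1 z].
Proof.
move=> H0 H1 eqf.
pose G T (g0 g1 : C -> T) z := if `[< U0 z >] then g0 z else g1 z.
have G0 T (g0 g1 : C -> T) z : U0 z -> G _ g0 g1 z = g0 z.
  by move=> Uz; rewrite /G (asboolT Uz).
have G1 T (g0 g1 : C -> T) : (forall z, U0 z -> U1 z -> g0 z = g1 z) -> forall z, U1 z -> G _ g0 g1 z = g1 z.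
  by move=> e z Uz; rewrite /G; case: asboolP => // U0z; exact: e.
have eqp z : U0 z -> U1 z -> p0 z = p1 z.
  move=> h0 h1; have [d d0 hd] := hyp_open H0 h0; have [d' d0' hd'] := hyp_open H1 h1.
  apply: DR_uniq (hyp_f H1 h1).
  apply: (@D1_eq R (fun x => (f0 x)%:C) _ _ _ _ (Num.min d d') _ _ (hyp_f H0 h0)).
    by rewrite lt_min d0.
  by move=> k; rewrite lt_min => /andP[/hd k0 /hd' k1]; rewrite eqf.
have eqq z : U0 z -> U1 z -> q0 z = q1 z.
  move=> h0 h1; have [d d0 hd] := hyp_open H0 h0; have [d' d0' hd'] := hyp_open H1 h1.
  apply: D1_uniq (hyp_p H1 h1); rewrite -eqf//.
  apply: (@D1_eq R p0 _ _ _ _ (Num.min d d') _ _ (hyp_p H0 h0)).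
    by rewrite lt_min d0.
  by move=> k; rewrite lt_min => /andP[/hd k0 /hd' k1]; rewrite eqp.
have key U f p q : hyp U f p q -> (forall z, U z -> G _ f0 f1 z = f z) -> (forall z, U z -> G _ p0 p1 z = p z) ->
    (forall z, U z -> G _ q0 q1 z = q z) -> forall z, U z ->
    [/\ exists2 d : R, 0 < d & forall h, nm h < d -> U (z + h),
     DR (G _ f0 f1) z (G _ p0 p1 z), D1 (G _ p0 p1) z (G _ q0 q1 z) (expR (G _ f0 f1 z) / 2)%:C &
     exists2 d : R, 0 < d & exists K : R, forall h, nm h < d -> nm (G _ q0 q1 (z + h)) <= K].
  move=> HH ef ep eq z Uz; have [d d0 hd] := hyp_open HH Uz.
  split; first by exists d.
  - rewrite ep//; apply: (@D1_eq R (fun x => (f x)%:C) _ _ _ _ d d0 _ (hyp_f HH Uz)) => k /hd /ef -> //.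
  - rewrite eq// ef//; apply: (@D1_eq R p _ _ _ _ d d0 _ (hyp_p HH Uz)) => k /hd /ep -> //.
  have [d' d0' [K hK]] := hyp_q HH Uz.
  exists (Num.min d d'); first by rewrite lt_min d0.
  by exists K => h; rewrite lt_min => /andP[/hd /eq -> /hK].
have k0 := key _ _ _ _ H0 (@G0 _ f0 f1) (@G0 _ p0 p1) (@G0 _ q0 q1).
have k1 := key _ _ _ _ H1 (@G1 _ f0 f1 eqf) (@G1 _ p0 p1 eqp) (@G1 _ q0 q1 eqq).
exists (G _ f0 f1), (G _ p0 p1), (G _ q0 q1); split; [|exact: G0|exact: G1].
split=> z [] Uz.
- by have [[d d0 h] _ _ _] := k0 z Uz; exists d => // k /h; left.
- by have [[d d0 h] _ _ _] := k1 z Uz; exists d => // k /h; right.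
- by have [] := k0 z Uz.
- by have [] := k1 z Uz.
- by have [] := k0 z Uz.
- by have [] := k1 z Uz.
- by have [] := k0 z Uz.
- by have [] := k1 z Uz.
Qed.

End Moebius.

(** * Topology of the sphere *)

Section Topology.
Variable R : realType.
Local Notation C := R[i].
Local Notation re := (@complex.Re R).
Local Notation im := (@complex.Im R).
Implicit Types (z w h u v a : C).

Lemma norm_nm z : `|z| = (nm z)%:C. Proof. by case: z. Qed.

Lemma posC (e : C) : 0 < e -> e = (re e)%:C /\ 0 < re e.
Proof. by case: e => x y; rewrite ltcE /= => /andP[/eqP -> x0]; split. Qed.

Lemma cplx_cont : continuous (fun u : R * R => cplx u : C^o).
Proof.
move=> x; apply/cvgrPdist_lt => e /posC [-> e0].
have := cC_near (cC_cplx x) e0; apply: filterS => y.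
by rewrite nmBC norm_nm ltcR.
Qed.

Lemma nm_cont : continuous (fun z : C^o => nm z : R).
Proof.
move=> x A /nbhs_ballP [e e0 hA]; apply/nbhs_ballP; exists e%:C; first by rewrite /= ltcR.
move=> y; rewrite -ball_normE /= norm_nm ltcR => yb; apply: hA.
rewrite -ball_normE /=; apply: le_lt_trans yb; rewrite ler_norml.
by have := nm_sub x y; have := nm_sub y x; rewrite (nmBC y x) => *; apply/andP; split; lra.
Qed.

Lemma circle_compact : compact (@unit_circle R).
Proof.
have := @cbd_compact R [set z | nm (z - 0) = 1] (cbd_sphere 0 1).
move=> /(continuous_compact (continuous_subspaceT cplx_cont)).
congr compact; apply/seteqP; split => z.
  move=> [u h <-]; have {}h : nm (cplx u - 0) = 1 := h.
  by rewrite /unit_circle /mkset norm_nm -[cplx u]subr0 h.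
rewrite /unit_circle /mkset norm_nm => h; exists (pt z); last exact: cplxK.
by rewrite /mkset cplxK subr0; case: h.
Qed.

Lemma sphere_hausdorff : hausdorff_space (sphere R).
Proof.
apply: one_point_compactification_hausdorff; last exact: norm_hausdorff.
move=> z _; exists [set w : C^o | nm (w - z) <= 1].
  apply: (@filterS _ (nbhs z) _ (ball z (1 : C))); last exact: nbhsx_ballx.
  by move=> w; rewrite -ball_normE /ball_ /mkset norm_nm -rc1 ltcR nmBC => /ltW.
have cK : compact [set w : C^o | nm (w - z) <= 1].
  have := @cbd_compact R [set w | nm (w - z) <= 1] (cbd_ball z 1).
  move=> /(continuous_compact (continuous_subspaceT cplx_cont)).
  congr compact; apply/seteqP; split => w; first by move=> [u h <-].
  by move=> h; exists (pt w); rewrite /mkset cplxK.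
by split => //; apply: compact_closed => //; exact: norm_hausdorff.
Qed.

Lemma jordan_closed (gamma : set (sphere R)) : jordan_curve gamma -> closed gamma.
Proof.
move=> [f [cf _ ->]]; apply: compact_closed; first exact: sphere_hausdorff.
exact: continuous_compact cf circle_compact.
Qed.

Lemma compact_nm (K : set C^o) : compact K -> exists M : R, forall z, K z -> nm z <= M.
Proof.
move=> cK; have := continuous_compact (continuous_subspaceT nm_cont) cK.
move=> /compact_bounded [M [_ h]]; exists (M + 1) => z Kz.
have M1 : M < M + 1 by rewrite ltrDl.
have : `|nm z| <= M + 1 by apply: (h _ M1); exists z.
by rewrite ger0_norm ?nm_ge0.
Qed.

Lemma param_cont k : continuous (param (R := R) k).
Proof.
case: k => x.
  apply: (@continuous_comp _ _ _ (fun u : R * R => cplx u : C^o) (fun z : C^o => Some z : sphere R)).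
    exact: cplx_cont.
  exact: one_point_compactification_some_continuous.
have [x0|xn] := eqVneq x 0.
  (* A neighbourhood of infinity contains the complement of a compact [K], which lies in some disc;
     the inverse of a small nonzero u falls outside this disc. *)
  rewrite x0 => U; rewrite /= eqxx => -[K [cK _] hK].
  have [M hM] := compact_nm cK.
  have M0 : 0 < `|M| + 1 by rewrite ltr_wpDl.
  have M1 : 0 < (`|M| + 1)^-1 by rewrite invr_gt0.
  have := cC_near (cC_cplx ((0 : R), (0 : R))) M1.
  have E0 : cplx ((0 : R), (0 : R)) = 0 by [].
  apply: filterS => y; rewrite E0 subr0 => ny; rewrite /=.
  case: ifPn => [_|yn]; apply: hK; first by right.
  left; exists (cplx y)^-1 => // Ky; have := hM _ Ky; rewrite nmV.
  have n0 : 0 < nm (cplx y).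
    by rewrite nm_gt0; apply: contra yn => /eqP y0; rewrite -(ptK y) y0.
  move: ny; rewrite -[X in X < _]invrK ltf_pV2 ?posrE ?invr_gt0//.
  by have := ler_norm M; lra.
have c1 : {for x, continuous (fun u : R * R => ((cplx u)^-1 : C^o))}.
  have xC : cplx x != 0 by apply: contra xn => /eqP y0; rewrite -(ptK x) y0.
  apply/cvgrPdist_lt => e /posC [-> e0].
  have := cC_near (cC_D1 (D1_inv (D1_id (cplx x)) xC) (cC_cplx x)) e0.
  by apply: filterS => y; rewrite nmBC norm_nm ltcR.
have c2 := @continuous_comp _ _ _ _ (fun z : C^o => Some z : sphere R) x c1 (@one_point_compactification_some_continuous _ _).
have E : \forall u \near x, param at_infinity u = Some (cplx u)^-1.
  have xC : 0 < nm (cplx x).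
    by rewrite nm_gt0; apply: contra xn => /eqP y0; rewrite -(ptK x) y0.
  have := cC_near (cC_cplx x) xC; apply: filterS => u; rewrite /param; case: eqVneq => // ->.
  by rewrite (_ : cplx 0 = 0)// sub0r nmN ltxx.
rewrite /continuous_at /= (negbTE xn).
apply: cvg_trans c2; apply: near_eq_cvg; apply: filterS E => u -> //.
Qed.

Lemma chart_open (A : set (sphere R)) k z : open A -> A (param k (pt z)) ->
  locally_in [set u | A (param k u)] z.
Proof.
move=> oA Az; have : nbhs (pt z) (param k @^-1` A).
  by apply: param_cont; exact: open_nbhs_nbhs.
move=> /nbhs_ballP [d d0 h]; exists d => // v vd; apply: h; split; rewrite /ball /= distrC.
  by rewrite -reB addrC addKr (le_lt_trans (re_le _)).
by apply: le_lt_trans vd; apply: le_trans (im_le _); case: (z); case: (v) => a b c d' /=; rewrite addrC addKr.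
Qed.

Lemma component_seg (A Om : set (sphere R)) k u v : component A Om ->
  (forall t : R, 0 <= t <= 1 -> A (param k (pt (seg u v t)))) ->
  Om (param k (pt u)) -> Om (param k (pt v)).
Proof.
move=> [x Ax ->] hA Ou; rewrite (same_connected_component Ou).
pose g (t : R) := param k (pt (seg u v t)).
have cg : continuous g.
  move=> t; apply: (@continuous_comp _ _ _ (fun t : R => pt (seg u v t)) (param k)); last exact: param_cont.
  have -> : (fun t : R => pt (seg u v t)) = (fun t : R => pt u + t *: pt (v - u)).
    apply/funext => s; rewrite /seg; case: (u) (v) => a1 a2 [b1 b2].
    by congr (_, _) => /=; rewrite /GRing.scale /=; ring.
  by apply: cvgD; [exact: cvg_cst|exact: scalel_continuous].
have cI := @connected_continuous_connected _ _ _ g (@segment_connected R 0 1) (continuous_subspaceT cg).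
apply: (@connected_component_max _ A _ (param k (pt u)) _ _ cI).
- by exists 0; rewrite /= ?in_itv /= ?lexx ?ler01// /g seg0.
- by move=> _ [t /= tI <-]; apply: hA; rewrite in_itv in tI.
by exists 1; rewrite /= ?in_itv /= ?lexx ?ler01// /g seg1.
Qed.

Lemma component_sub (A Om : set (sphere R)) : component A Om -> Om `<=` A.
Proof. by move=> [x Ax ->]; exact: connected_component_sub. Qed.

Lemma component_meet (A Om Om' : set (sphere R)) x : component A Om -> component A Om' ->
  Om x -> Om' x -> Om = Om'.
Proof.
by move=> [y Ay ->] [y' Ay' ->] h h'; rewrite (same_connected_component h) (same_connected_component h').
Qed.

(** A small chart disc inside the open set is star-shaped about its centre, so it stays in one
    component. *)
Lemma component_open (A Om : set (sphere R)) k z : open A -> component A Om ->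
  Om (param k (pt z)) -> locally_in [set u | Om (param k u)] z.
Proof.
move=> oA cOm Oz; have [d d0 hd] := chart_open oA (component_sub cOm Oz).
exists d => // h hh; apply: component_seg cOm _ Oz => t /andP[t0 t1].
apply: hd; rewrite addrAC subrr add0r nmZ ger0_norm// (le_lt_trans _ hh)//.
by rewrite ler_piMl ?nm_ge0.
Qed.

End Topology.

(** * The planar coordinate that sends a point of gamma to infinity *)

Section Coordinate.
Variable R : realType.
Local Notation C := R[i].
Local Notation re := (@complex.Re R).
Local Notation im := (@complex.Im R).
Implicit Types (z w h u v a : C) (k : chart).

(** It parametrises the sphere minus [a]. With [a] on gamma, one planar coordinate covers both
    components, including infinity, which sits at z = 0. *)
Definition TT a z : sphere R := if z == 0 then infty R else finite_pt (a + z^-1).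

(* The coordinate k at TT a z is the Moebius map mM a k z, with denominator me a k z. *)
Definition me a k z : C := match k with at_zero => z | at_infinity => 1 + a * z end.
Definition mM a k z : C := match k with at_zero => a + z^-1 | at_infinity => z / (1 + a * z) end.
Definition mdet k : C := match k with at_zero => -1 | at_infinity => 1 end.
Definition mN a k w : C := match k with at_zero => (w - a)^-1 | at_infinity => w / (1 - a * w) end.
Definition mden a k w : C := match k with at_zero => w - a | at_infinity => 1 - a * w end.

Lemma nm_mdet k : nm (mdet k) = 1. Proof. by case: k; rewrite /mdet ?nmN nm1. Qed.

Lemma pt_eq0 z : (pt z == 0) = (z == 0).
Proof. by apply/eqP/eqP => [e|-> //]; rewrite -[z]cplxK e. Qed.

Lemma TT_param a k z : me a k z != 0 -> TT a z = param k (pt (mM a k z)).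
Proof.
case: k => /= e0; first by rewrite cplxK /TT (negbTE e0).
rewrite pt_eq0 mulf_eq0 invr_eq0 (negbTE e0) orbF /TT; case: eqP => // /eqP z0.
by rewrite cplxK; congr finite_pt; field; rewrite e0 z0.
Qed.

Lemma me_neq0 a z : me a at_zero z != 0 \/ me a at_infinity z != 0.
Proof. by case: (eqVneq z 0) => [->|]; [right; rewrite /= mulr0 addr0 oner_eq0|left]. Qed.

Lemma me_D1 a k z : D1 (me a k) z (match k with at_zero => 1 | at_infinity => a end) 0.
Proof.
case: k; first exact: D1_id.
apply: (D1_cast (D1_add (D1_holo_cst 1 z) (D1_mulc a (D1_id z)))); by rewrite ?mulr1 ?mulr0 add0r.
Qed.

Lemma mM_D1 a k z : me a k z != 0 -> D1 (mM a k) z (mdet k / me a k z ^+ 2) 0.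
Proof.
case: k => /= e0.
  apply: (D1_cast (D1_add (D1_holo_cst a z) (D1_inv (D1_id z) e0))); rewrite add0r //.
  by rewrite oppr0 mul0r.
apply: (D1_cast (D1_mul (D1_id z) (D1_inv (me_D1 a at_infinity z) e0))) => /=; last first.
  by rewrite mul0r oppr0 mul0r mulr0 addr0.
by field; rewrite e0.
Qed.

Lemma mN_spec a k w : param k (pt w) <> finite_pt a ->
  [/\ mden a k w != 0, me a k (mN a k w) != 0, mM a k (mN a k w) = w & TT a (mN a k w) = param k (pt w)].
Proof.
move=> ha; have d0 : mden a k w != 0.
  apply/eqP; case: k ha => /= ha.
    by move=> /eqP; rewrite subr_eq0 => /eqP wa; apply: ha; rewrite cplxK wa.
  move=> /eqP; rewrite subr_eq0 => /eqP aw; apply: ha; rewrite pt_eq0.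
  have w0 : w != 0 by apply/eqP => w0; move/eqP: aw; rewrite w0 mulr0 oner_eq0.
  rewrite (negbTE w0) cplxK; congr finite_pt; apply: (mulIf w0); by rewrite mulVf// aw.
have e0 : me a k (mN a k w) != 0.
  case: k d0 {ha} => /= d0; first by rewrite invr_eq0.
  by rewrite (_ : 1 + a * (w / (1 - a * w)) = (1 - a * w)^-1) ?invr_eq0//; field; rewrite d0.
have e1 : mM a k (mN a k w) = w.
  case: k d0 e0 {ha} => /= d0 e0; first by rewrite invrK addrC subrK.
  have -> : 1 + a * (w / (1 - a * w)) = (1 - a * w)^-1 by field; rewrite d0.
  by rewrite invrK divfK.
by split => //; rewrite (TT_param e0) e1.
Qed.

Lemma mN_D1 a k w : mden a k w != 0 -> D1 (mN a k) w (mdet k * me a k (mN a k w) ^+ 2) 0.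
Proof.
case: k => /= d0.
  apply: (D1_cast (D1_inv (D1_add (D1_id w) (D1_holo_cst (- a) w)) d0)); last by rewrite addr0 oppr0 mul0r.
  by rewrite addr0; field; rewrite d0.
have De : D1 (fun w => 1 - a * w) w (- a) 0.
  apply: (@D1_eq R (fun w => 1 + (- a) * w) _ _ _ _ 1 ltr01); first by move=> h _; rewrite mulNr.
  apply: (D1_cast (D1_add (D1_holo_cst 1 w) (D1_mulc (- a) (D1_id w)))); by rewrite ?mulr1 ?mulr0 add0r.
apply: (D1_cast (D1_mul (D1_id w) (D1_inv De d0))); last by rewrite mul0r oppr0 mul0r mulr0 addr0.
by field; rewrite d0.
Qed.

Section Metric.
Variables (A Om : set (sphere R)) (rho : density R).
Hypotheses (oA : open A) (cOm : component A Om) (hr : hyperbolic_metric Om rho).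
Variable a : C.

(** Each chart yields a metric where its denominator [me] is nonzero. The two agree by the
    transition rule of conformal metrics, and by [me_neq0] they cover the whole preimage. *)
Lemma sphere_hyp : exists f p q, hyp [set z | Om (TT a z)] f p q /\
  forall k z, Om (TT a z) -> me a k z != 0 -> expR (f z) = rho k (pt (mM a k z)) / nm (me a k z) ^+ 4.
Proof.
have [[sm pos tr] cu _] := hr.
pose Uk k := [set z | me a k z != 0 /\ Om (param k (pt (mM a k z)))].
pose fk k z := ln (rho k (pt (mM a k z))) - 2 * ln (nm (me a k z) ^+ 2).
have hk k : exists p q, hyp (Uk k) (fk k) p q.
  have [|P [Q HV]] := @chart_hyp R [set u | Om (param k u)] (rho k) _ (sm k) (pos k) (cu k).
    by move=> z; exact: component_open oA cOm.
  exact: (hyp_moebius HV (nm_mdet k) (me_D1 a k) (@mM_D1 a k)).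
have ek k z : Uk k z -> expR (fk k z) = rho k (pt (mM a k z)) / nm (me a k z) ^+ 4.
  move=> [e0 Oz]; have n0 : 0 < nm (me a k z) by rewrite nm_gt0.
  rewrite /fk expRD expRN lnK ?posrE ?pos//; congr (_ / _).
  by rewrite mulrDl mul1r expRD lnK ?posrE ?exprn_gt0//; ring.
have [p0 [q0 H0]] := hk at_zero; have [p1 [q1 H1]] := hk at_infinity.
have agree z : Uk at_zero z -> Uk at_infinity z -> fk at_zero z = fk at_infinity z.
  move=> U0 U1; rewrite -[LHS]expRK -[RHS]expRK; congr ln; rewrite !ek//.
  have [e0 Oz] := U0; have [e1 _] := U1.
  have M0 : mM a at_zero z != 0.
    rewrite /= (_ : a + z^-1 = (1 + a * z) / z) ?mulf_neq0 ?invr_eq0//.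
    by field; rewrite e0.
  rewrite tr ?pt_eq0// sqmodE cplxK.
  have -> : cinv (pt (mM a at_zero z)) = pt (mM a at_infinity z).
    rewrite /cinv -/(pt _) cplxK; congr pt => /=.
    by rewrite (_ : a + z^-1 = (1 + a * z) / z) ?invf_div//; field; rewrite e0.
  have -> : mM a at_zero z = me a at_infinity z / me a at_zero z.
    by rewrite /=; field; rewrite e0.
  have n0 : 0 < nm (me a at_zero z) by rewrite nm_gt0.
  have n1 : 0 < nm (me a at_infinity z) by rewrite nm_gt0.
  by rewrite nmM nmV; field; rewrite !gt_eqF.
have [f [p [q [H f0 f1]]]] := hyp_glue H0 H1 agree.
have UE : Uk at_zero `|` Uk at_infinity = [set z | Om (TT a z)].
  apply/seteqP; split => z /=.
    by move=> [[e0 Oz]|[e0 Oz]]; rewrite (TT_param e0).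
  by move=> Oz; have [e0|e0] := me_neq0 a z; [left|right]; split => //; rewrite -TT_param.
exists f, p, q; rewrite -UE; split => // k z Oz e0.
have Uz : Uk k z by split => //; rewrite -TT_param.
by rewrite -ek//; case: k {e0} Uz => Uz; [rewrite (f0 _ Uz)|rewrite (f1 _ Uz)].
Qed.

End Metric.

Lemma pair_derive (c1 c2 : R -> R) (t x y : R) : is_derive t (1 : R) c1 x -> is_derive t (1 : R) c2 y ->
  is_derive t (1 : R) (fun s => (c1 s, c2 s)) (x, y).
Proof.
move=> d1 d2.
have key (c : R -> R) (z : R) : is_derive t (1 : R) c z ->
    (fun h : R => h^-1 *: ((c \o shift t) (h *: (1 : R)) - c t)) @ 0^' --> z.
  by move=> d; have := @ex_derive _ _ _ _ _ _ _ d; rewrite -(@derive_val _ _ _ _ _ _ _ d).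
have h1 := key _ _ d1; have h2 := key _ _ d2.
have h : (fun h : R => h^-1 *: (((fun s : R => (c1 s, c2 s)) \o shift t) (h *: (1 : R)) - (c1 t, c2 t))) @ 0^' --> (x, y).
  exact: (cvg_pair h1 h2).
apply: DeriveDef; first by apply/cvg_ex; exists (x, y).
exact: (cvg_lim (@norm_hausdorff _ _) h).
Qed.

End Coordinate.

(** * Lengths of paths *)

Section Speed.
Variable R : realType.
Local Notation C := R[i].
Local Notation re := (@complex.Re R).
Local Notation im := (@complex.Im R).
Local Notation mu := (@lebesgue_measure R).
Implicit Types (z w u v a : C) (k : chart).

Lemma enormE (x : R * R) : enorm x = nm (cplx x).
Proof. by rewrite /enorm sqmodE sqrtr_sqr ger0_norm ?nm_ge0. Qed.

Lemma within01 (h : R -> R) : (forall t : R, 0 <= t <= 1 -> continuous_at t h) ->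
  {within `[0, 1], continuous h}.
Proof. by move=> H; apply: continuous_in_subspaceT => t; rewrite inE /= in_itv /=; exact: H. Qed.

Lemma integrable01 (h : R -> R) : {within `[0, 1], continuous h} -> mu.-integrable `[0, 1] (EFin \o h).
Proof. by move=> ch; apply: (@continuous_compact_integrable R h); [exact: segment_compact|]. Qed.

Lemma integral01_le (h : R -> R) (B : R) : {within `[0, 1], continuous h} ->
  (forall t : R, 0 <= t <= 1 -> 0 <= h t <= B) -> (\int[mu]_(t in `[0%R, 1%R]) (h t)%:E <= B%:E)%E.
Proof.
move=> ch hB; have mh := measurable_int _ (integrable01 ch).
have : (\int[mu]_(t in `[0%R, 1%R]) (h t)%:E <= \int[mu]_(t in `[0%R, 1%R]) cst B%:E t)%E.
  apply: ge0_le_integral => //.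
  - by move=> t /=; rewrite in_itv /= => /hB /andP[h0 _]; rewrite lee_fin.
  - by move=> t /=; rewrite in_itv /= => /hB /andP[_ h0]; rewrite lee_fin.
move=> /le_trans; apply.
by rewrite integral_cst//= lebesgue_measure_itv /= lte_fin ltr01 -EFinB subr0 mule1.
Qed.

(** The mean value theorem is applied to K times the primitive of h minus g, whose derivative is
    nonnegative. *)
Lemma integral01_ge (g dg h : R -> R) (K : R) : {within `[0, 1], continuous h} ->
  (forall t : R, 0 <= t <= 1 -> is_derive t (1 : R) g (dg t)) ->
  (forall t : R, 0 <= t <= 1 -> `|dg t| <= K * h t) ->
  ((g 1 - g 0)%:E <= K%:E * \int[mu]_(t in `[0%R, 1%R]) (h t)%:E)%E.
Proof.
move=> ch hg hK; have ih := integrable01 ch.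
pose H (x : R) := Rintegral mu `[0, x] h.
have H0 : H 0 = 0 by rewrite /H set_itv1 Rintegral_set1.
have H1 : (\int[mu]_(t in `[0%R, 1%R]) (h t)%:E = (H 1)%:E)%E.
  by rewrite /H /Rintegral fineK//; exact: integrable_fin_num.
have cH : {within `[0, 1], continuous H} := parameterized_integral_continuous ler01 ih.
have cg : {within `[0, 1], continuous g}.
  by apply: within01 => t tI; have := hg t tI => d; apply: differentiable_continuous; exact/derivable1_diffP.
have [||cx] := @MVT R (fun x => K * H x - g x) (fun x => K * h x - dg x) 0 1 ltr01.
- move=> x xI; have x01 : 0 < x < 1 by move: xI; rewrite in_itv.
  have hc : {for x, continuous h}.
    have := ch; move=> /continuous_within_itvP; rewrite ltr01 => /(_ erefl) [h1 _ _].
    by apply: h1.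
  case/andP: x01 => x0 x1.
  have [dH dHe] := @continuous_FTC1_closed R h 0 x 1 x1 ih x0 hc.
  have D1 : is_derive x (1 : R) H (h x).
    by apply: DeriveDef; [exact: dH|rewrite -derive1E; exact: dHe].
  have D2 : is_derive x (1 : R) (fun x => K * H x) (K * h x) by exact: is_deriveZ.
  by apply: is_deriveB D2 (hg x _); rewrite (ltW x0) (ltW x1).
- move=> x; apply: cvgB; last exact: cg.
  by apply: cvgM; [exact: cvg_cst|exact: cH].
rewrite in_itv /= => /andP[c0 c1]; rewrite H0 mulr0 subr0 mulr1 sub0r opprK => e.
have := hK cx; rewrite (ltW c0) (ltW c1) => /(_ erefl) hc.
rewrite H1 -EFinM lee_fin; have := ler_norm (dg cx); lra.
Qed.

Lemma component_derive (c : R -> R * R) (t : R) : derivable c t 1 ->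
  is_derive t (1 : R) (fun s => (c s).1) ('D_1 c t).1 /\ is_derive t (1 : R) (fun s => (c s).2) ('D_1 c t).2.
Proof.
move=> dc; have h : (fun h : R => h^-1 *: ((c \o shift t) (h *: (1 : R)) - c t)) @ 0^' --> 'D_1 c t by exact: dc.
split.
  have h1 : (fun h : R => h^-1 *: ((fst \o c \o shift t) (h *: (1 : R)) - (c t).1)) @ 0^' --> ('D_1 c t).1.
    exact: (cvg_comp _ _ h (@cvg_fst _ _ _ _ _)).
  by apply: DeriveDef; [apply/cvg_ex; eexists; exact: h1|exact: (cvg_lim (@norm_hausdorff _ _) h1)].
have h1 : (fun h : R => h^-1 *: ((snd \o c \o shift t) (h *: (1 : R)) - (c t).2)) @ 0^' --> ('D_1 c t).2.
  exact: (cvg_comp _ _ h (@cvg_snd _ _ _ _ _)).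
by apply: DeriveDef; [apply/cvg_ex; eexists; exact: h1|exact: (cvg_lim (@norm_hausdorff _ _) h1)].
Qed.

Lemma DR_curve (G : C -> R) (c : R -> R * R) (t : R) p : DR G (cplx (c t)) p -> derivable c t 1 ->
  is_derive t (1 : R) (fun s => G (cplx (c s))) (2 * re (p * cplx ('D_1 c t))).
Proof.
move=> DG dc; have [d1 d2] := component_derive dc.
set x := ('D_1 c t).1 in d1; set y := ('D_1 c t).2 in d2.
have mE : cplx ('D_1 c t) = x +i* y by [].
rewrite mE; set m := x +i* y.
move: d1 d2 => /is_derive_eps d1 /is_derive_eps d2.
apply/is_derive_eps => e e0; have /DR_small DGs := DG.
pose L := 2 * nm p + 1; have L0 : 0 < L by rewrite ltr_wpDl ?mulr_ge0 ?nm_ge0.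
pose e1 := Num.min 1 (e / (4 * L)).
have e10 : 0 < e1 by rewrite lt_min ltr01 divr_gt0// mulr_gt0.
have [a1 a10 h1] := d1 _ e10; have [a2 a20 h2] := d2 _ e10.
pose N := nm m + 2; have N0 : 0 < N by rewrite ltr_wpDl ?nm_ge0.
have eN : 0 < e / (2 * N) by rewrite divr_gt0// mulr_gt0.
have [a3 a30 h3] := DGs _ eN.
exists (Num.min a1 (Num.min a2 (a3 / N))); first by rewrite !lt_min a10 a20 divr_gt0.
move=> s; rewrite !lt_min => /and3P[/h1 k1 /h2 k2]; rewrite ltr_pdivlMr// => k3.
pose D := cplx (c (t + s)) - cplx (c t).
have Dm : nm (D - s%:C * m) <= 2 * e1 * `|s|.
  apply: le_trans (nm_le _) _; rewrite /D /m /cplx /= !mul0r subr0 addr0.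
  by rewrite (mulrC s x) (mulrC s y) -/x -/y; lra.
have e11 : e1 <= 1 by rewrite ge_min lexx.
have s0 := normr_ge0 s.
have nD : nm D <= N * `|s|.
  have := nm_sub D (s%:C * m); rewrite nmM nm_real /N.
  have : e1 * `|s| <= `|s| by rewrite ler_piMl.
  lra.
have cD : cplx (c t) + D = cplx (c (t + s)) by rewrite /D addrC subrK.
have := h3 D; rewrite cD expr1 => h3'.
have D3 : nm D < a3 by apply: le_lt_trans nD _; rewrite mulrC.
have {h3'}h3' := h3' D3.
have E : G (cplx (c (t + s))) - G (cplx (c t)) - 2 * re (p * m) * s =
  (G (cplx (c (t + s))) - G (cplx (c t)) - 2 * re (p * D)) + 2 * re (p * (D - s%:C * m)).
  by move: (D) (m) => D0 m0; rewrite mulrBr reB (mulrCA p) reZ; ring.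
rewrite E; apply: le_trans (ler_normD _ _) _.
have b1 : e / (2 * N) * nm D <= e / 2 * `|s|.
  apply: (@le_trans _ _ (e / (2 * N) * (N * `|s|))); first by rewrite ler_wpM2l// ltW.
  by apply: eqle; field; rewrite gt_eqF.
have b2 : `|2 * re (p * (D - s%:C * m))| <= 2 * (nm p * (2 * e1 * `|s|)).
  rewrite normrM ger0_norm// ler_wpM2l// (le_trans (re_le _))// nmM ler_wpM2l ?nm_ge0//.
have b3 : 2 * (nm p * (2 * e1 * `|s|)) <= e / 2 * `|s|.
  rewrite (_ : 2 * _ = (2 * nm p) * (2 * e1) * `|s|); last by ring.
  rewrite ler_wpM2r// (@le_trans _ _ (L * (2 * e1)))//.
    by rewrite ler_wpM2r ?mulr_ge0 ?(ltW e10)// lerDl.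
  have : e1 <= e / (4 * L) by rewrite ge_min lexx orbT.
  rewrite -(ler_pM2l L0) => h; apply: (@le_trans _ _ (2 * (L * (e / (4 * L))))).
    by rewrite mulrCA ler_wpM2l.
  by apply: eqle; field; rewrite gt_eqF.
lra.
Qed.

Lemma seg_derive F u v (th : R -> R) (t dth : R) m : D1 F (seg u v (th t)) m 0 -> is_derive t (1 : R) th dth ->
  is_derive t (1 : R) (fun s => pt (F (seg u v (th s)))) (pt (dth%:C * (m * (v - u)))).
Proof.
move=> D dt; have c0 : (0 : C)^* = 0 by rewrite -rc0 cj_rc.
have key G n : D1 G (seg u v (th t)) n 0 ->
    is_derive t (1 : R) (fun s => re (G (seg u v (th s)))) (re (n * (v - u)) * dth).
  move=> DG; have := DR_line (D1_re DG).
  rewrite (_ : 2 * re ((n + 0^*) / 2 * (v - u)) = re (n * (v - u))); last first.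
    by rewrite c0 addr0 (_ : n / 2 * (v - u) = 2^-1%:C * (n * (v - u))) ?reZ; [field|rewrite rcV (_ : 2%:C = 2) ?rcD//; field].
  by move=> d; exact: (@is_derive1_comp R (fun s => re (G (u + s%:C * (v - u)))) th t _ dth d dt).
apply: pair_derive.
  by rewrite reZ mulrC; exact: key.
rewrite im_re (_ : - 'i * (dth%:C * (m * (v - u))) = dth%:C * (- 'i * m * (v - u))); last by ring.
rewrite reZ mulrC.
have := key _ _ (D1_cast (D1_mulc (- 'i) D) (erefl _) (mulr0 _)).
congr (is_derive _ _ _ _); by apply/funext => s; rewrite im_re.
Qed.

Lemma speed_cont (Om : set (sphere R)) (rho : density R) k (c : R -> R * R) : conformal_metric Om rho ->
  C1_path c -> (forall t : R, 0 <= t <= 1 -> Om (param k (c t))) ->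
  {within `[0, 1], continuous (fun t => Num.sqrt (rho k (c t)) * enorm ('D_1 c t))}.
Proof.
move=> [sm _ _] [dc cD] hc; apply: within01 => t tI; apply: cvgM.
  apply: (@continuous_comp _ _ _ (fun t => rho k (c t)) Num.sqrt); last exact: sqrt_continuous.
  apply: (@continuous_comp _ _ _ c (rho k)); last exact: (sm k 0%N _ (hc t tI)).
  by apply: differentiable_continuous; exact/derivable1_diffP.
apply: (@continuous_comp _ _ _ ('D_1 c) (@enorm R)); first exact: cD.
apply: (@continuous_comp _ _ _ (fun x : R * R => sqmod (cplx x)) Num.sqrt); last exact: sqrt_continuous.
by apply: cvgD; apply: cvgM; [exact: cvg_fst|exact: cvg_fst|exact: cvg_snd|exact: cvg_snd].
Qed.

End Speed.

(** * Chains against paths, and completeness in the plane *)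

Section Paths.
Variable R : realType.
Local Notation C := R[i].
Local Notation re := (@complex.Re R).
Local Notation im := (@complex.Im R).
Local Notation mu := (@lebesgue_measure R).
Implicit Types (z w u v a : C) (k : chart).

(* A C^1 parameter with values in [0, 1] on the whole line, as C1_path requires. *)
Definition th (t : R) : R := (1 - cos (pi * t)) / 2.
Definition dth (t : R) : R := pi / 2 * sin (pi * t).

Lemma th_derive t : is_derive t (1 : R) th (dth t).
Proof.
apply: is_derive_eq; rewrite /dth /GRing.scale /= ?mulr1 ?mulr0 ?addr0 ?add0r.
by field.
Qed.

Lemma th0 : th 0 = 0. Proof. by rewrite /th mulr0 cos0 subrr mul0r. Qed.
Lemma th1 : th 1 = 1. Proof. by rewrite /th mulr1 cospi opprK; field. Qed.
Lemma th01 t : 0 <= th t <= 1.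
Proof. by have := cos_le1 (pi * t); have := cos_geN1 (pi * t); rewrite /th => *; apply/andP; split; lra. Qed.

Lemma dth_le t : `|dth t| <= 2.
Proof.
have h0 : 0 <= pi / 2 :> R by rewrite divr_ge0// pi_ge0.
rewrite /dth normrM (ger0_norm h0).
have s1 : `|sin (pi * t)| <= 1 by rewrite ler_norml sin_geN1 sin_le1.
by apply: le_trans (ltW (pihalf_lt2 R)); rewrite ler_piMr.
Qed.

Lemma th_cont : continuous th.
Proof. by move=> t; apply: differentiable_continuous; exact/derivable1_diffP. Qed.

Lemma dth_cont : continuous dth.
Proof.
move=> t; apply: cvgM; first exact: cvg_cst.
apply: (@continuous_comp _ _ _ (fun t : R => pi * t) sin); last exact: continuous_sin.
by apply: cvgM; [exact: cvg_cst|exact: cvg_id].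
Qed.

Lemma imZ (r : R) z : im (r%:C * z) = r * im z.
Proof. by case: z => x y /=; rewrite mul0r addr0. Qed.

Lemma cC_seg u v t : cC (fun s : R => seg u v (th s)) t.
Proof.
split.
  have -> : (fun s : R => re (seg u v (th s))) = (fun s => re u + th s * re (v - u)).
    by apply/funext => s; rewrite /seg reD reZ.
  apply: cvgD; first exact: cvg_cst.
  by apply: cvgM; [exact: th_cont|exact: cvg_cst].
have -> : (fun s : R => im (seg u v (th s))) = (fun s => im u + th s * im (v - u)).
  by apply/funext => s; rewrite /seg -imZ; move: (_ * _) => x; case: (u); case: x.
apply: cvgD; first exact: cvg_cst.
by apply: cvgM; [exact: th_cont|exact: cvg_cst].
Qed.

Lemma TT_inj a : injective (TT a).
Proof.
move=> u v; rewrite /TT; case: eqP => [->|u0]; case: eqP => [-> //|v0] // [/addrI /invr_inj //].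
Qed.

Lemma TT_surj a (x : sphere R) : x <> finite_pt a -> exists z, x = TT a z.
Proof.
case: x => [w|] wa; last by exists 0; rewrite /TT eqxx.
exists (w - a)^-1; rewrite /TT invr_eq0 subr_eq0; case: eqP => [e|_]; first by case: wa; rewrite e.
by rewrite invrK addrC subrK.
Qed.

(** Equal to 1 at [z] and to 0 outside the disc of radius r; the outer square makes the positive
    part differentiable. *)
Definition bump (r : R) z w : R := Num.max 0 (1 - nm (w - z) ^+ 2 / r ^+ 2) ^+ 2.

Lemma bump_DR (r : R) z w :
  DR (bump r z) w ((2 * Num.max 0 (1 - nm (w - z) ^+ 2 / r ^+ 2))%:C * (- (r ^- 2)%:C * (w - z)^*)).
Proof.
apply: (@DR_comp R (fun x => Num.max 0 x ^+ 2) _ (fun w => 1 - nm (w - z) ^+ 2 / r ^+ 2)).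
  apply/is_derive_eps => e e0; exists e => // k ke.
  apply: (@le_trans _ _ (k ^+ 2)).
    move: (1 - _) => x; case: (leP 0 x) => x0; case: (leP 0 (x + k)) => xk.
    - by rewrite (_ : _ - _ - _ = k ^+ 2) ?ger0_norm ?sqr_ge0//; ring.
    - have := sqr_ge0 (x + k); have := sqr_ge0 k; have : 0 <= x * - (x + k) by rewrite mulr_ge0//; lra.
      by rewrite expr0n /= ler_norml => *; apply/andP; split; nra.
    - by rewrite expr0n /= mulr0 mul0r !subr0 ger0_norm ?sqr_ge0//; have := sqr_ge0 x; nra.
    by rewrite expr0n /= mulr0 mul0r !subr0 normr0 sqr_ge0.
  by rewrite -[k ^+ 2]ger0_norm ?sqr_ge0// normrX expr2 ler_wpM2r// ltW.
apply/DR_small; apply: (@small_powS R 1 _ (`|r ^- 2|) 1 ltr01) => h _.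
rewrite -(ger0_norm (sqr_ge0 (nm h))) -normrM; apply: eqle; rewrite -normrN; congr `|_|.
rewrite !nm_sqr; move: (r ^- 2) => s; case: (w) (z) h => a1 a2 [b1 b2] [h1 h2] /=; ring.
Qed.

Lemma bump_slope (r : R) z w : 0 < r ->
  let p := (2 * Num.max 0 (1 - nm (w - z) ^+ 2 / r ^+ 2))%:C * (- (r ^- 2)%:C * (w - z)^*) in
  nm p <= 2 / r /\ (r <= nm (w - z) -> p = 0).
Proof.
move=> r0 p; have r2 : 0 < r ^+ 2 by rewrite exprn_gt0.
have out : r <= nm (w - z) -> p = 0.
  move=> h; rewrite /p (_ : Num.max 0 _ = 0) ?mulr0 ?rc0 ?mul0r//.
  apply/max_idPl; rewrite subr_le0 ler_pdivlMr// mul1r ler_sqr ?nnegrE ?nm_ge0 ?(ltW r0)//.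
split=> //; have [h|h] := leP r (nm (w - z)); first by rewrite (out h) nm0 divr_ge0// ltW.
rewrite /p nmM nm_real nmM nmN nm_real nm_conj.
have m1 : Num.max 0 (1 - nm (w - z) ^+ 2 / r ^+ 2) <= 1.
  by rewrite ge_max ler01 gerBl divr_ge0 ?sqr_ge0.
have m0 : 0 <= Num.max 0 (1 - nm (w - z) ^+ 2 / r ^+ 2) by rewrite le_max lexx.
rewrite ger0_norm ?mulr_ge0// ger0_norm ?invr_ge0 ?(ltW r2)//.
apply: (@le_trans _ _ (2 * (r ^- 2 * r))).
  apply: ler_pM; rewrite ?mulr_ge0 ?nm_ge0 ?invr_ge0 ?(ltW r2)//; first lra.
  by rewrite ler_wpM2l ?invr_ge0 ?(ltW r2)// ltW.
by apply: eqle; field; rewrite gt_eqF.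
Qed.

Variables (A Om : set (sphere R)) (rho : density R).
Hypotheses (oA : open A) (cOm : component A Om) (hr : hyperbolic_metric Om rho).
Variable a : C.
Hypothesis aA : ~ A (finite_pt a).
Variables (f : C -> R) (p q : C -> C).
Local Notation U := [set z | Om (TT a z)].
Hypothesis H : hyp U f p q.
Hypothesis fE : forall k z, Om (TT a z) -> me a k z != 0 ->
  expR (f z) = rho k (pt (mM a k z)) / nm (me a k z) ^+ 4.

Lemma sqrt_rho k z : Om (TT a z) -> me a k z != 0 ->
  Num.sqrt (rho k (pt (mM a k z))) = expR (f z / 2) * nm (me a k z) ^+ 2.
Proof.
move=> Oz e0; have n0 : 0 < nm (me a k z) by rewrite nm_gt0.
have -> : rho k (pt (mM a k z)) = (expR (f z / 2) * nm (me a k z) ^+ 2) ^+ 2.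
  rewrite exprMn -[expR _ ^+ 2]expRM_natl (_ : 2%:R * (f z / 2) = f z) ?(fE Oz e0); last by field.
  by field; rewrite gt_eqF.
by rewrite sqrtr_sqr ger0_norm// mulr_ge0 ?expR_ge0 ?sqr_ge0.
Qed.

Lemma path_ge0 x y l : path_length Om rho x y l -> (0 <= l)%E.
Proof.
elim=> {x y l} [//|k c y l _ _ _ l0]; rewrite adde_ge0//; apply: integral_ge0 => t _.
by rewrite lee_fin mulr_ge0 ?sqrtr_ge0// /enorm sqrtr_ge0.
Qed.

(** The reparametrisation [th] has speed at most pi / 2 < 2, whence the factor 2. *)
Lemma path_seg k u v (B : R) y l :
  (forall t : R, 0 <= t <= 1 -> [/\ me a k (seg u v t) != 0, U (seg u v t) & expR (f (seg u v t) / 2) <= B]) ->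
  path_length Om rho (TT a v) y l ->
  exists2 l', path_length Om rho (TT a u) y l' & (l' <= (2 * B * nm (v - u))%:E + l)%E.
Proof.
move=> hs hv; have c00 : (0 : C)^* = 0 by rewrite -rc0 cj_rc.
have e0 t : me a k (seg u v (th t)) != 0 by have [] := hs _ (th01 t).
have Ot t : Om (TT a (seg u v (th t))) by have [] := hs _ (th01 t).
pose c t := pt (mM a k (seg u v (th t))).
pose m t := mdet R k / me a k (seg u v (th t)) ^+ 2 * (v - u).
have dc t : is_derive t (1 : R) c (pt ((dth t)%:C * m t)).
  exact: seg_derive (mM_D1 (e0 t)) (th_derive t).
have Dc t : 'D_1 c t = pt ((dth t)%:C * m t) by exact: (@derive_val _ _ _ _ _ _ _ (dc t)).
have cm t : cC m t.
  have De := me_D1 a k (seg u v (th t)).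
  have e2 : me a k (seg u v (th t)) * me a k (seg u v (th t)) != 0 by rewrite mulf_neq0.
  have DF := D1_mul (D1_mulc (mdet R k) (D1_inv (D1_mul De De) e2)) (D1_holo_cst (v - u) _).
  exact: (@cC_D1 R _ t (fun s => seg u v (th s)) (fun z => mdet R k * (me a k z * me a k z)^-1 * (v - u)) _ _ DF (cC_seg u v t)).
have C1 : C1_path c.
  split=> [t|t]; first exact: (@ex_derive _ _ _ _ _ _ _ (dc t)).
  have -> : (fun t => 'D_1 c t) = (fun t => (dth t * re (m t), dth t * im (m t))).
    by apply/funext => s; rewrite Dc /pt reZ imZ.
  have [c1 c2] := cm t.
  exact: (cvg_pair (cvgM (@dth_cont t) c1) (cvgM (@dth_cont t) c2)).
have Oc t : 0 <= t <= 1 -> Om (param k (c t)) by move=> _; rewrite /c -TT_param.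
have c0E : param k (c 0) = TT a u by rewrite /c -TT_param// th0 seg0.
have c1E : param k (c 1) = TT a v by rewrite /c -TT_param// th1 seg1.
have [cf _ _] := hr; have ch := speed_cont cf C1 Oc.
have le := @integral01_le R _ (2 * B * nm (v - u)) ch _.
have Pc := @path_cons R Om rho k c y l C1 Oc; rewrite c1E c0E in Pc.
eexists; first exact: Pc hv.
rewrite leeD2r//; apply: le => t tI.
rewrite mulr_ge0 ?sqrtr_ge0 /enorm ?sqrtr_ge0//= -/(enorm _) enormE Dc cplxK.
rewrite sqrt_rho// /m nmM nm_real nmM nmM nmV nmX nm_mdet mul1r.
have n0 : 0 < nm (me a k (seg u v (th t))) by rewrite nm_gt0.
rewrite [leLHS](_ : _ = expR (f (seg u v (th t)) / 2) * `|dth t| * nm (v - u)); last first.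
  by field; rewrite gt_eqF.
rewrite ler_wpM2r ?nm_ge0// mulrC ler_pM ?expR_ge0 ?dth_le//.
by have [] := hs _ (th01 t).
Qed.

(** A segment may meet the pole of either chart. Each denominator is affine in the parameter and
    vanishes at most once, never both at the same point; a cut halfway between the two zeros leaves
    each half in one chart. *)
Lemma path_link u v (B : R) y l :
  (forall t : R, 0 <= t <= 1 -> U (seg u v t) /\ expR (f (seg u v t) / 2) <= B) ->
  path_length Om rho (TT a v) y l ->
  exists2 l', path_length Om rho (TT a u) y l' & (l' <= (2 * B * nm (v - u))%:E + l)%E.
Proof.
move=> hs hv.
have one k : (forall t : R, 0 <= t <= 1 -> me a k (seg u v t) != 0) ->
    exists2 l', path_length Om rho (TT a u) y l' & (l' <= (2 * B * nm (v - u))%:E + l)%E.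
  by move=> hk; apply: path_seg hv => t tI; have [] := hs t tI; split => //; exact: hk.
have bad k : (forall t : R, 0 <= t <= 1 -> me a k (seg u v t) != 0) \/
    exists2 t : R, 0 <= t <= 1 & me a k (seg u v t) = 0.
  case: (pselect (exists2 t : R, 0 <= t <= 1 & me a k (seg u v t) = 0)) => [|n]; first by right.
  by left=> t tI; apply/eqP => e; apply: n; exists t.
have [h0|[t0 t0I b0]] := bad at_zero; first exact: one h0.
have [h1|[t1 t1I b1]] := bad at_infinity; first exact: one h1.
have uv : v - u != 0.
  apply/eqP => e; have := me_neq0 a u.
  move: b0 b1; rewrite /seg e !mulr0 !addr0 => -> ->; rewrite eqxx; by case.
have u0 t : me a at_zero (seg u v t) = 0 -> t = t0.
  move=> e; have : seg u v t - seg u v t0 = 0 by rewrite (e : seg u v t = 0) (b0 : seg u v t0 = 0) subrr.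
  by rewrite segB => /eqP; rewrite mulf_eq0 (negbTE uv) orbF -rc0 (inj_eq (@rc_inj R)) subr_eq0 => /eqP.
have u1 t : me a at_infinity (seg u v t) = 0 -> t = t1.
  move=> e; have : a * (seg u v t - seg u v t1) = 0.
    by have := e; have := b1; rewrite /= => e1 e2; rewrite mulrBr; apply/eqP; rewrite subr_eq0 -(inj_eq (addrI 1)) e1 e2.
  move/eqP; rewrite mulf_eq0 segB mulf_eq0 (negbTE uv) orbF => /orP[/eqP a0|].
    by move/eqP: b1; rewrite /= a0 mul0r addr0 oner_eq0.
  by rewrite -rc0 (inj_eq (@rc_inj R)) subr_eq0 => /eqP.
have t01 : t0 != t1.
  by apply/eqP => e; have := me_neq0 a (seg u v t0); rewrite {2}e b0 b1 eqxx => -[].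
pose s := (t0 + t1) / 2; pose w := seg u v s.
have sI : 0 <= s <= 1 by case/andP: t0I => *; case/andP: t1I => *; rewrite /s; apply/andP; split; lra.
case/andP: sI => s0 s1.
have first t : seg u w t = seg u v (t * s) by rewrite -{1}(seg0 u v) seg_seg subr0 add0r.
have second t : seg w v t = seg u v (s + t * (1 - s)) by rewrite -{1}(seg1 u v) seg_seg.
have fI t : 0 <= t <= 1 -> 0 <= t * s <= s by move=> /andP[a0 a1]; rewrite mulr_ge0//= ler_piMl.
have sI t : 0 <= t <= 1 -> s <= s + t * (1 - s) <= 1.
  move=> /andP[a0 a1]; have d0 : 0 <= 1 - s by lra.
  have : t * (1 - s) <= 1 - s by rewrite ler_piMl.
  by have := mulr_ge0 a0 d0 => *; apply/andP; split; lra.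
have two k k' : (forall t : R, 0 <= t <= s -> me a k (seg u v t) != 0) ->
    (forall t : R, s <= t <= 1 -> me a k' (seg u v t) != 0) ->
    exists2 l', path_length Om rho (TT a u) y l' & (l' <= (2 * B * nm (v - u))%:E + l)%E.
  move=> hk hk'; have [|l1 P1 L1] := @path_seg k' w v B y l _ hv.
    move=> t tI; rewrite second; have /andP[c0 c1] := sI t tI.
    by have [|] := hs (s + t * (1 - s)); [rewrite (le_trans s0 c0)|split => //; apply: hk'; rewrite c0].
  have [|l2 P2 L2] := @path_seg k u w B y l1 _ P1.
    move=> t tI; rewrite first; have /andP[c0 c1] := fI t tI.
    by have [|] := hs (t * s); [rewrite c0 (le_trans c1 s1)|split => //; apply: hk; rewrite c0].
  exists l2 => //; apply: (le_trans L2).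
  have -> : nm (v - u) = nm (w - u) + nm (v - w).
    rewrite -{2}(seg0 u v) -{3}(seg1 u v) /w !segB !nmM !nm_real !ger0_norm ?subr_ge0//; ring.
  by rewrite mulrDr EFinD -addeA leeD2l.
have [lt|lt|e] := ltgtP t0 t1; last by rewrite e eqxx in t01.
  apply: (two at_infinity at_zero) => t /andP[c0 c1]; apply/eqP.
    by move=> /u1 e; move: c1; rewrite e /s; lra.
  by move=> /u0 e; move: c0; rewrite e /s; lra.
apply: (two at_zero at_infinity) => t /andP[c0 c1]; apply/eqP.
  by move=> /u0 e; move: c1; rewrite e /s; lra.
by move=> /u1 e; move: c0; rewrite e /s; lra.
Qed.

Lemma chain_path u v (l : R) : chain U f u v l ->
  exists2 l', path_length Om rho (TT a u) (TT a v) l' & (l' <= (2 * l)%:E)%E.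
Proof.
elim=> {u v l} [z Uz|u v w B l hB _ [l' P L]].
  by exists 0%E; [exact: path_nil|rewrite mulr0].
have [l2 P2 L2] := path_link hB P; exists l2 => //; apply: (le_trans L2).
by rewrite mulrDr EFinD mulrA leeD2l.
Qed.

(** A lower bound for lengths that avoids following the path up to its exit from a disc: [bump] has
    slope at most 4/r in the disc and 0 outside, and the hypothesis bounds 4/r by the density. *)
Lemma path_bump (r K0 : R) z x y l : 0 < r -> 0 <= K0 ->
  (forall w, nm (w - z) < r -> U w -> 4 / r <= K0 * expR (f w / 2)) ->
  path_length Om rho x y l -> forall u v, TT a u = x -> TT a v = y ->
  ((bump r z v - bump r z u)%:E <= K0%:E * l)%E.
Proof.
move=> r0 K00 hK; elim=> {x y l} [x Ox|k c y l C1 Oc P IH] u v ux vy.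
  by rewrite (TT_inj (etrans ux (esym vy))) subrr mule0.
have na t : 0 <= t <= 1 -> param k (pt (cplx (c t))) <> finite_pt a.
  by move=> tI e; apply: aA; rewrite -e ptK; apply: component_sub cOm _ (Oc t tI).
pose g t := bump r z (mN a k (cplx (c t))).
have I0 : 0 <= (0 : R) <= 1 by rewrite lexx ler01.
have I1 : 0 <= (1 : R) <= 1 by rewrite lexx ler01.
have [_ _ _ T0] := mN_spec (na 0 I0); have [_ _ _ T1] := mN_spec (na 1 I1).
rewrite ptK in T0; rewrite ptK in T1.
have uE : u = mN a k (cplx (c 0)) by apply: (@TT_inj a); rewrite ux T0.
have := IH _ v T1 vy; rewrite -/(g 1) => IH1.
have [cf _ _] := hr; have ch := speed_cont cf C1 Oc.
pose pb w := (2 * Num.max 0 (1 - nm (w - z) ^+ 2 / r ^+ 2))%:C * (- (r ^- 2)%:C * (w - z)^*).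
pose N t := mN a k (cplx (c t)).
have := @integral01_ge R g (fun t => 2 * re (pb (N t) * (mdet R k * me a k (N t) ^+ 2) * cplx ('D_1 c t))) _ K0 ch _ _.
rewrite -/(g 0) => h; have {}h := h _ _.
have -> : bump r z v - bump r z u = (g 1 - g 0) + (bump r z v - g 1) by rewrite uE /g; ring.
rewrite EFinD ge0_muleDr; [|by apply: integral_ge0 => t _; rewrite lee_fin mulr_ge0 ?sqrtr_ge0// /enorm sqrtr_ge0|exact: path_ge0 P].
apply: leeD => //; apply: h => t tI.
  have [d0 e0 _ _] := mN_spec (na t tI).
  have DN := mN_D1 d0.
  have c0 : (0 : C)^* = 0 by rewrite -rc0 cj_rc.
  have D : DR (fun w => bump r z (mN a k w)) (cplx (c t)) (pb (N t) * (mdet R k * me a k (N t) ^+ 2)).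
    apply: (D1_cast (D1_comp (bump_DR r z (mN a k (cplx (c t)))) DN)); first by rewrite c0 mulr0 addr0.
    by rewrite mulr0 add0r -cjM.
  by apply: (DR_curve D); case: C1.
have [d0 e0 M1 T] := mN_spec (na t tI).
have Ot : Om (TT a (N t)) by rewrite /N T ptK; exact: Oc.
have [nb out] := @bump_slope r z (N t) r0; rewrite -/(pb (N t)) in nb out.
have := sqrt_rho Ot e0; rewrite -/(N t) /N M1 ptK => ->; rewrite -/(N t) enormE.
rewrite normrM ger0_norm//; apply: (@le_trans _ _ (2 * nm (pb (N t) * (mdet R k * me a k (N t) ^+ 2) * cplx ('D_1 c t)))).
  by rewrite ler_wpM2l// re_le.
have hKN : nm (N t - z) < r -> 4 / r <= K0 * expR (f (N t) / 2) by move=> hh; exact: hK.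
move: nb out hKN; move: (pb (N t)) => P1; move: (N t) (cplx ('D_1 c t)) => Nt dc nb out hKN.
rewrite (nmM (P1 * _)) (nmM P1) (nmM (mdet R k)) nm_mdet mul1r nmX.
have X0 : 0 <= nm (me a k Nt) ^+ 2 * nm dc by rewrite mulr_ge0 ?nm_ge0 ?sqr_ge0.
have [h1|h1] := leP r (nm (Nt - z)).
  rewrite (out h1) nm0 !mul0r mulr0; apply: mulr_ge0 => //.
  by rewrite -mulrA; apply: mulr_ge0 => //; exact: expR_ge0.
have h2 : 2 * nm P1 <= K0 * expR (f Nt / 2).
  by apply: le_trans (hKN h1); apply: (@le_trans _ _ (2 * (2 / r))); [rewrite ler_wpM2l|rewrite mulrA -natrM].
by have := ler_wpM2r X0 h2; rewrite !mulrA.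
Qed.

Lemma path_near z (e : R) : U z -> 0 < e -> exists2 eta : R, 0 < eta &
  forall u l, path_length Om rho (TT a u) (TT a z) l -> (l < eta%:E)%E -> nm (u - z) < e.
Proof.
move=> Uz e0; have [d d0 [K K0 hK]] := hyp_loc H Uz.
pose r := Num.min e d; have r0 : 0 < r by rewrite lt_min e0.
pose K1 := 4 / r * expR (K / 2).
have K10 : 0 < K1 by rewrite mulr_gt0 ?expR_gt0// divr_gt0.
exists K1^-1; first by rewrite invr_gt0.
move=> u l P lE.
have hb w : nm (w - z) < r -> U w -> 4 / r <= K1 * expR (f w / 2).
  rewrite lt_min => /andP[_ wd] _; have := hK w 0 wd; rewrite nm0 => /(_ d0) [_ fK _ _ _].
  rewrite -mulrA -expRD ler_peMr ?divr_ge0 ?(ltW r0)// -[leLHS]expR0 ler_expR.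
  by move: fK; rewrite ler_norml => /andP[fK _]; lra.
have := path_bump r0 (ltW K10) hb P (erefl _) (erefl _).
have l0 := path_ge0 P; case: l lE l0 P => [l| |]// lE l0 P.
rewrite -EFinM lee_fin => hl.
have lt1 : K1 * l < 1 by rewrite mulrC -ltr_pdivlMr// div1r; rewrite lte_fin in lE.
have bz : bump r z z = 1 by rewrite /bump subrr nm0 expr0n mul0r subr0 (max_idPr _) ?expr1n.
have : 0 < bump r z u by move: hl; rewrite bz; lra.
rewrite /bump => hb2; apply: lt_le_trans (_ : r <= e); last by rewrite ge_min lexx.
rewrite ltNge; apply/negP => h; move: hb2; rewrite (max_idPl _) ?expr0n ?ltxx//.
by rewrite subr_le0 ler_pdivlMr ?exprn_gt0// mul1r ler_sqr ?nnegrE ?nm_ge0 ?(ltW r0).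
Qed.

(** Geometric chain steps give a Cauchy sequence for [conf_dist]. Its limit is some TT a z because
    [a] is outside the component, and [path_near] makes the convergence Euclidean. *)
Lemma plane_complete : complete U f.
Proof.
move=> s B hs.
have B0 : 0 <= B by have [l lB /chain_ge0 l0] := hs 0%N; rewrite expr0 mulr1 in lB; exact: le_trans lB.
have sum m j : exists2 l, chain U f (s m) (s (m + j)%N) l & l <= 3 * B * (2 / 3) ^+ m * (1 - (2 / 3) ^+ j).
  elim: j => [|j [l cl lB]].
    by exists 0; [rewrite addn0; apply: chain_nil; have [l _ cl] := hs m; exact: (chain_U cl).1|rewrite expr0 subrr mulr0].
  have [l' lB' cl'] := hs (m + j)%N; exists (l + l'); first by rewrite addnS; exact: chain_cat cl cl'.
  by apply: le_trans (lerD lB lB') _; apply: eqle; rewrite exprD exprS; field.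
have bound m j : exists2 l, chain U f (s m) (s (m + j)%N) l & l <= 3 * B * (2 / 3) ^+ m.
  have [l cl lB] := sum m j; exists l => //; apply: le_trans lB _.
  have q0 i : 0 <= (2 / 3 : R) ^+ i by rewrite exprn_ge0// divr_ge0.
  apply: ler_piMr; first by apply: mulr_ge0 => //; exact: mulr_ge0.
  by have := q0 j; lra.
have dist u v l : chain U f u v l -> (conf_dist Om rho (TT a u) (TT a v) <= (2 * l)%:E)%E.
  by move=> /chain_path [l' P]; apply: le_trans; apply: ereal_inf_lbound.
have [_ _ cm] := hr.
have [n|e e0|x Ox hx] := cm (fun n => TT a (s n)).
- by have [l _ cl] := hs n; exact: (chain_U cl).1.
- have [N hN] := geom_small (6 * B) e0; exists N => m n Nm Nn.
  have lt (i : nat) (l : R) : (N <= i)%N -> l <= 3 * B * (2 / 3) ^+ i -> 2 * l < e.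
    by move=> /hN hi li; lra.
  have [mn|nm'] := leqP m n.
    have [l cl lB] := bound m (n - m)%N; rewrite subnKC// in cl.
    by apply: le_lt_trans (dist _ _ _ cl) _; rewrite lte_fin; exact: lt lB.
  have [l cl lB] := bound n (m - n)%N; rewrite subnKC ?(ltnW nm')// in cl.
  by apply: le_lt_trans (dist _ _ _ (chain_rev cl)) _; rewrite lte_fin; exact: lt lB.
have [|z xz] := @TT_surj a x; first by move=> e; apply: aA; rewrite -e; exact: component_sub cOm _ Ox.
rewrite xz in Ox hx; exists z => // e e0.
have [eta eta0 h] := path_near Ox e0.
have : \forall n \near \oo, (conf_dist Om rho (TT a (s n)) (TT a z) < eta%:E)%E.
  by apply: (hx [set y | (y < eta%:E)%E]); apply: (@open_nbhs_nbhs _ 0%E); split; [exact: open_ereal_lt_ereal|rewrite /= lte_fin].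
move=> [N _ hN]; exists N => n Nn.
have [l P le] := ereal_inf_lt (hN n Nn).
exact: h P le.
Qed.

End Paths.

(** * Horospheres and circles *)

Section Final.
Variable R : realType.
Local Notation C := R[i].
Local Notation re := (@complex.Re R).
Local Notation im := (@complex.Im R).
Implicit Types (z w u v a b : C) (k : chart).

(** By injectivity, 1 and -1 cannot both be sent to infinity. *)
Lemma jordan_finite (gamma : set (sphere R)) : jordan_curve gamma -> exists a, gamma (finite_pt a).
Proof.
move=> [g [_ gi ->]].
have u1 : @unit_circle R 1 by rewrite /unit_circle /mkset normr1.
have u2 : @unit_circle R (-1) by rewrite /unit_circle /mkset normrN1.
case e1 : (g 1) => [a|]; first by exists a; exists 1.
case e2 : (g (-1)) => [a|]; first by exists a; exists (-1).
have := gi 1 (-1); rewrite !inE e1 e2 => /(_ u1 u2 erefl) => -[/eqP].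
by rewrite -subr_eq0 opprK (_ : (1 + 1 : R) = 2) ?pnatr_eq0.
Qed.

Lemma nmD_sqr u v : nm (u + v) ^+ 2 = nm u ^+ 2 + 2 * re (u^* * v) + nm v ^+ 2.
Proof. by rewrite !nm_sqr; case: u => a1 a2; case: v => b1 b2 /=; ring. Qed.

(* The factor by which the visual metric from x scales the coordinate z of TT a z. *)
Definition horo a (x : R * R * R) z : R := x.2 ^+ 2 * nm z ^+ 2 + nm (1 + z * (a - cplx x.1)) ^+ 2.

Lemma visual_TT a (x : R * R * R) k z : me a k z != 0 ->
  visual x k (pt (mM a k z)) / nm (me a k z) ^+ 4 = 4 * x.2 ^+ 2 / horo a x z ^+ 2.
Proof.
move=> e0; have n0 : nm (me a k z) != 0 by rewrite nm_eq0.
have key (X Y N : R) : N != 0 -> N ^+ 2 * X = Y -> 4 * x.2 ^+ 2 / X ^+ 2 / N ^+ 4 = 4 * x.2 ^+ 2 / Y ^+ 2.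
  move=> N0 <-; rewrite exprMn -mulrA -invfM; congr (_ / _); ring.
case: k e0 n0 => /= e0 n0; rewrite !sqmodE cplxK; apply: key => //; rewrite /horo.
  rewrite mulrDr mulrC; congr (_ + _); rewrite -exprMn -nmM; congr (nm _ ^+ 2); field.
  exact: e0.
rewrite mulrDr !nmM nmV; congr (_ + _); first by field.
by rewrite -exprMn -nmM; congr (nm _ ^+ 2); field; rewrite e0.
Qed.

(** The difference of the two sides is the square of s^2 X X' - Y Y', as in Lagrange's identity. *)
Lemma horo_cauchy (s X Y X' Y' : R) :
  s ^+ 2 * (X * Y' + X' * Y) ^+ 2 <= (s ^+ 2 * X ^+ 2 + Y ^+ 2) * (s ^+ 2 * X' ^+ 2 + Y' ^+ 2).
Proof.
rewrite -subr_ge0 (_ : _ - _ = (s ^+ 2 * X * X' - Y' * Y) ^+ 2) ?sqr_ge0//; ring.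
Qed.

(** With t = a - Z, one has z - w = z (1 + w t) - w (1 + z t). The triangle inequality and
    [horo_cauchy] bound xi^2 |z - w|^2 by the product of the two values of [horo], which is S <=
    4. *)
Lemma pairS_horo (f f' : C -> R) a (x : R * R * R) z w : 0 < x.2 ->
  expR (f z) = 4 * x.2 ^+ 2 / horo a x z ^+ 2 -> expR (f' w) = 4 * x.2 ^+ 2 / horo a x w ^+ 2 ->
  pairS f f' z w <= 4.
Proof.
move=> x0 ez ew; set D := horo a x z in ez; set D' := horo a x w in ew.
have half (g e E : R) : 0 <= E -> expR g = 4 * e ^+ 2 / E ^+ 2 -> 0 < e -> 0 < E /\ expR (g / 2) = 2 * e / E.
  move=> E0 h e0; have En : 0 < E.
    by rewrite lt_def E0 andbT; apply/eqP => E00; have := expR_gt0 g; rewrite h E00 expr0n invr0 mulr0 ltxx.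
  split=> //; apply/eqP; rewrite -(@eqrXn2 _ 2) ?expR_ge0 ?divr_ge0 ?mulr_ge0 ?(ltW e0)//.
  rewrite expr2 -expRD (_ : g / 2 + g / 2 = g) ?h; last by field.
  by apply/eqP; field; rewrite gt_eqF.
have hg y : 0 <= horo a x y.
  by apply: addr_ge0; [apply: mulr_ge0; exact: sqr_ge0|exact: sqr_ge0].
have [D0 e1] := half _ _ _ (hg z) ez x0; have [D0' e2] := half _ _ _ (hg w) ew x0.
rewrite /pairS mulrDl expRD e1 e2 -/D -/D'.
have -> : 2 * x.2 / D * (2 * x.2 / D') * nm (z - w) ^+ 2 = 4 * (x.2 ^+ 2 * nm (z - w) ^+ 2) / (D * D').
  by field; rewrite !gt_eqF.
rewrite ler_pdivrMr ?mulr_gt0// ler_wpM2l//.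
rewrite (_ : z - w = z * (1 + w * (a - cplx x.1)) - w * (1 + z * (a - cplx x.1))); last by ring.
have := nmB (z * (1 + w * (a - cplx x.1))) (w * (1 + z * (a - cplx x.1))); rewrite !nmM => h.
have h2 := lerXn2r 2 (nm_ge0 _ : _ \in Num.nneg) (le_trans (nm_ge0 _) h : _ \in Num.nneg) h.
apply: le_trans (ler_wpM2l (sqr_ge0 x.2) h2) _.
exact: horo_cauchy.
Qed.

(** * Gamma as the common boundary of two half-planes *)

Section Circle.
Variables (gamma Om Oms : set (sphere R)).
Hypotheses (oA : open (~` gamma)) (cOm : component (~` gamma) Om) (cOms : component (~` gamma) Oms).
Hypothesis neq : Om <> Oms.
Variables (a b : C) (c : R).
Hypotheses (ga : gamma (finite_pt a)) (b0 : b != 0).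
Hypotheses (hU : forall z, 0 < 2 * re (b * z) + c -> Om (TT a z)).
Hypotheses (hU' : forall z, 2 * re (b * z) + c < 0 -> Oms (TT a z)).

(** The complement of gamma contains a chart disc around the point; a short segment in it leads to
    points of the normal ray, which are in [O]. *)
Lemma reach (O : set (sphere R)) (e : R) z : component (~` gamma) O -> (~` gamma) (TT a z) -> `|e| = 1 ->
  (forall t : R, 0 < t -> O (TT a (z + (e * t)%:C * b^*))) -> O (TT a z).
Proof.
move=> cO Az e1 hO.
have [k ek] : exists k, me a k z != 0 by have [h|h] := me_neq0 a z; eexists; exact: h.
rewrite (TT_param ek) in Az *.
have [d d0 hd] := chart_open oA Az.
have [d1 d10 h1] := D1_cont (mM_D1 ek) d0.
have [d2 d20 h2] := D1_cont (me_D1 a k z) (etrans (nm_gt0 _) ek).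
pose m := Num.min d1 d2; have m0 : 0 < m by rewrite lt_min d10.
have nb : 0 < nm b by rewrite nm_gt0.
pose t := m / (2 * nm b); have t0 : 0 < t by rewrite divr_gt0// mulr_gt0.
pose h := (e * t)%:C * b^*.
have nh : nm h < m.
  rewrite /h nmM nm_conj nm_real normrM e1 mul1r (gtr0_norm t0) /t.
  by rewrite (_ : _ * nm b = m / 2); [lra|field; rewrite gt_eqF].
have /andP[hd1 hd2] : (nm h < d1) && (nm h < d2) by rewrite -lt_min.
have e2 : me a k (z + h) != 0.
  by apply/eqP => e0; have := h2 _ hd2; rewrite e0 sub0r nmN ltxx.
have := hO t t0; rewrite -/h (TT_param e2); apply: component_seg cO _ => s /andP[s0 s1].
rewrite (_ : seg _ _ s = mM a k z + (1 - s)%:C * (mM a k (z + h) - mM a k z)); last first.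
  by rewrite /seg rcB rc1; ring.
apply: hd; rewrite nmM nm_real ger0_norm ?subr_ge0//; apply: le_lt_trans (h1 _ hd1).
by rewrite ler_piMl ?nm_ge0//; lra.
Qed.

(** A point of the line lying off gamma would be reached from both half-planes, hence belong to two
    distinct components. *)
Lemma gamma_TT z : gamma (TT a z) <-> 2 * re (b * z) + c = 0.
Proof.
split=> [gz|e].
  apply/eqP; rewrite eq_le !leNgt; apply/andP; split; apply/negP.
    by move=> /hU /(component_sub cOm); apply.
  by move=> /hU' /(component_sub cOms); apply.
apply: contrapT => Az; apply: neq.
have side (e1 t : R) : 2 * re (b * (z + (e1 * t)%:C * b^*)) + c = e1 * (2 * t * nm b ^+ 2).
  rewrite mulrDr reD (mulrCA b) mul_conj -rcM /= mulrDr addrAC e add0r; ring.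
have pos (t : R) : 0 < t -> 0 < 2 * t * nm b ^+ 2 by move=> t0; rewrite !mulr_gt0// nm_gt0.
apply: (component_meet cOm cOms (x := TT a z)).
  apply: (reach (e := 1)) => //; first by rewrite normr1.
  by move=> t /pos t0; apply: hU; rewrite side mul1r.
apply: (reach (e := -1)) => //; first by rewrite normrN1.
by move=> t /pos t0; apply: hU'; rewrite side mulN1r oppr_lt0.
Qed.

Lemma gamma_finite x : gamma (finite_pt x) <-> 2 * re (b^* * (x - a)) + c * nm (x - a) ^+ 2 = 0.
Proof.
have [->|xa] := eqVneq x a; first by rewrite subrr mulr0 nm0 expr0n /= !mulr0 addr0; split.
have u0 : x - a != 0 by rewrite subr_eq0.
have -> : finite_pt x = TT a (x - a)^-1.
  by rewrite /TT invr_eq0 (negbTE u0) invrK addrC subrK.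
apply: iff_trans (gamma_TT _) _.
have n0 : nm (x - a) ^+ 2 != 0 by rewrite expf_neq0// nm_eq0.
have -> : b * (x - a)^-1 = (nm (x - a) ^- 2)%:C * (b * (x - a)^*).
  rewrite rcV -mul_conj; have uc : (x - a)^* != 0 by rewrite -nm_gt0 nm_conj nm_gt0.
  by move: u0 uc; move: (x - a) => u u0 uc; field; rewrite u0 uc.
have -> : re (b^* * (x - a)) = re (b * (x - a)^*) by rewrite -re_conj cjM cjK.
rewrite reZ; move: n0; move: (nm _ ^+ 2) (re _) => n s n0; split=> h.
  rewrite (_ : _ + _ = (2 * (n^-1 * s) + c) * n); first by rewrite h mul0r.
  by field.
rewrite (_ : _ + _ = (2 * s + c * n) / n); first by rewrite h mul0r.
by field.
Qed.

(** c = 0 means that the boundary line passes through z = 0, the place of infinity, and gamma is a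
    line through [a]. Otherwise completing the square in [gamma_finite] gives centre a - b/c and
    radius |b| / |c|. *)
Lemma gamma_circle : circle gamma.
Proof.
have ginf : gamma (infty R) <-> c = 0.
  by have := gamma_TT 0; rewrite /TT eqxx mulr0 /= mulr0 add0r.
have [cz|c0] := eqVneq c 0.
  right; exists b^*, (re (b^* * a)); split; first by rewrite -nm_gt0 nm_conj nm_gt0.
  apply/seteqP; split => [[x|] gx|x].
  - right; exists x => //; move/gamma_finite: gx; rewrite cz mul0r addr0 mulrBr reB /= => h; lra.
  - by left.
  case=> [->|[y hy <-]]; first exact/ginf.
  by apply/gamma_finite; rewrite cz mul0r addr0 mulrBr reB (hy : re _ = _) subrr mulr0.
left; exists (a - b / c%:C), (nm b / `|c|).
have cC := real_nz c0.
split; first by rewrite divr_gt0 ?normr_gt0// nm_gt0.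
have eqv x : gamma (finite_pt x) <-> sqmod (x - (a - b / c%:C)) = (nm b / `|c|) ^+ 2.
  apply: iff_trans (gamma_finite x) _.
  have -> : x - (a - b / c%:C) = (x - a) + c^-1%:C * b by rewrite rcV mulrC; ring.
  rewrite sqmodE (nmD_sqr (x - a)) nmZ (mulrC (nm b)) -normfV.
  have -> : re ((x - a)^* * (c^-1%:C * b)) = c^-1 * re (b^* * (x - a)).
    by rewrite mulrCA reZ; congr (_ * _); rewrite -[LHS]re_conj cjM cjK mulrC.
  move: (nm (x - a) ^+ 2) (re _) ((_ * nm b) ^+ 2) => n s r; split=> h.
    have -> : n = - 2 * s / c by apply: (mulIf c0); rewrite divfK//; lra.
    by field.
  have {}h : n + 2 * (c^-1 * s) = 0 by lra.
  have : c * (n + 2 * (c^-1 * s)) = 0 by rewrite h mulr0.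
  by rewrite mulrDr (_ : c * (2 * (c^-1 * s)) = 2 * s) => [|]; [lra|field].
apply/seteqP; split => [[x|] gx|x [y hy <-]].
- by exists x => //; exact/eqv.
- by have /ginf e := gx; rewrite e eqxx in c0.
exact/eqv.
Qed.

End Circle.
End Final.

Theorem proposition1p1 (R : realType) (gamma Omega Omegas : set (sphere R))
    (Ep Eps : sphere R -> R * R * R)
    (gamma_jordan : jordan_curve gamma)
    (Omega_component : component (~` gamma) Omega)
    (Omegas_component : component (~` gamma) Omegas)
    (Omega_neq : Omega <> Omegas)
    (gamma_not_circle : ~ circle gamma)
    (Ep_Omega : epstein_poincare_map Omega Ep)
    (Ep_Omegas : epstein_poincare_map Omegas Eps) :
  [/\ Ep @` Omega `<=` @H3 R, Eps @` Omegas `<=` @H3 R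
    & (Ep @` Omega) `&` (Eps @` Omegas) = set0].
Proof.
have [rho [hyp1 [N [_ [hor1 _]]]]] := Ep_Omega.
have [rho' [hyp2 [N' [_ [hor2 _]]]]] := Ep_Omegas.
split; [by move=> _ [P OP <-]; case: (hor1 P OP)|by move=> _ [P OP <-]; case: (hor2 P OP)|].
apply/seteqP; split => // x [[P OP Px] [P' OP' Px']]; apply: gamma_not_circle.
have oA : open (~` gamma) by apply: closed_openC; exact: jordan_closed.
have [a ga] := jordan_finite gamma_jordan.
have aA : ~ (~` gamma) (finite_pt a) by apply.
have [f [p [q [H fE]]]] := sphere_hyp oA Omega_component hyp1 a.
have [f' [p' [q' [H' fE']]]] := sphere_hyp oA Omegas_component hyp2 a.
have cU := plane_complete Omega_component hyp1 aA H fE.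
have cU' := plane_complete Omegas_component hyp2 aA H' fE'.
have dis z : Omega (TT a z) -> Omegas (TT a z) -> False.
  by move=> h h'; apply: Omega_neq; exact: (component_meet Omega_component Omegas_component h h').
have S4 z w : Omega (TT a z) -> Omegas (TT a w) -> 4 <= pairS f f' z w.
  by move=> Uz Uw; exact: (pairS_ge4 H H' cU cU' dis Uz Uw).
have surj (O : set (sphere R)) Q : component (~` gamma) O -> O Q -> exists z, Q = TT a z.
  move=> cO OQ; apply: TT_surj => e; apply: aA; rewrite -e; exact: component_sub cO _ OQ.
have [z zE] := surj _ _ Omega_component OP; have [w wE] := surj _ _ Omegas_component OP'.
have horoE (O : set (sphere R)) (r : density R) (g : R[i] -> R) y :
    (forall k z, O (TT a z) -> me a k z != 0 -> expR (g z) = r k (pt (mM a k z)) / nm (me a k z) ^+ 4) ->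
    O (TT a y) -> horosphere r (TT a y) x -> expR (g y) = 4 * x.2 ^+ 2 / horo a x y ^+ 2.
  move=> gE Oy [_ hx].
  have [k ek] : exists k, me a k y != 0 by have [h|h] := me_neq0 a y; eexists; exact: h.
  by rewrite (gE k y Oy ek) -(visual_TT x ek) (hx k) ?(TT_param ek).
rewrite zE in OP Px; rewrite wE in OP' Px'.
have hz := hor1 _ OP; have hw := hor2 _ OP'; rewrite Px in hz; rewrite Px' in hw.
have x0 : 0 < x.2 by case: hz.
(* The comparison inequality gives S >= 4 for every pair, and the common point [x] of the two
   horospheres gives S <= 4 for this one. *)
have s4 : pairS f f' z w = 4.
  apply/eqP; rewrite eq_le S4// andbT.
  exact: (pairS_horo x0 (horoE _ _ _ _ fE OP hz) (horoE _ _ _ _ fE' OP' hw)).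
have [b [c [b0 hU hU']]] := half_planes H H' dis S4 cU cU' OP OP' s4.
exact: (gamma_circle oA Omega_component Omegas_component Omega_neq ga b0 hU hU').
Qed.
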